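(* Let $(\Omega,\mathcal F,P)$ be $[0,1]$ with its Borel sigma-algebra and the uniform probability measure, let $1\le p<\infty$, $1/p+1/q=1$, $0\le\lambda\le1$, and consider the $p$-semideviation risk measure $$\rho(Z):=\mathbb E[Z]+\lambda\,\|(Z-\mathbb E[Z])_+\|_p,\qquad Z\in\mathcal Z=L_p(\Omega,\mathcal F,P).$$ The Kusuoka representation of $\rho$ is $$\rho(Z)=\sup_{\sigma\in\mathfrak S\cap L_q}\Big\{\Big(1-\tfrac{\lambda}{\|\sigma\|_q}\Big)\mathbb E[Z]+\tfrac{\lambda}{\|\sigma\|_q}\,\rho_\sigma(Z)\Big\},\qquad Z\in\mathcal Z,$$ i.e., the set $$\mathfrak M:=\Big\{\Big(1-\tfrac{\lambda}{\|\mathbb T\mu\|_q}\Big)\delta_0+\tfrac{\lambda}{\|\mathbb T\mu\|_q}\,\mu:\ \mu\in\mathfrak P,\ \mathbb T\mu\in L_q\Big\}$$ is a Kusuoka set of $\rho$. Moreover, whenever $p>1$ this is the minimal Kusuoka representation, i.e., the closure of $\mathfrak M$ is the minimal Kusuoka set of $\rho$.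
   Context: For $Z\in\mathcal Z$, $F_Z(z)=P(Z\le z)$ and $F_Z^{-1}(\tau)=\sup\{t:F_Z(t)\le\tau\}$; $\mathrm{AV@R}_\alpha(Z)=(1-\alpha)^{-1}\int_\alpha^1F_Z^{-1}(\tau)\,d\tau$, $\alpha\in[0,1)$; $x_+=\max\{x,0\}$; $\delta_\alpha$ is the unit mass at $\alpha$. $\mathfrak S$ is the set of spectral functions: right-continuous, nondecreasing $\sigma:[0,1)\to[0,\infty)$ with $\int_0^1\sigma(t)\,dt=1$; $L_q=L_q([0,1])$ with norm $\|\cdot\|_q$. For $\sigma\in\mathfrak S\cap L_q$, $\rho_\sigma(Z)=\int_0^1\sigma(t)F_Z^{-1}(t)\,dt$. $\mathfrak P$ is the set of probability measures on $[0,1]$ with zero mass at $1$, with the weak topology of probability measures (closedness and closures are taken in $\mathfrak P$). Integrals with respect to $\mu\in\mathfrak P$ include the mass at $0$. The map $\mathbb T:\mathfrak P\to\mathfrak S$, $(\mathbb T\mu)(\tau)=\int_0^\tau(1-\alpha)^{-1}d\mu(\alpha)$, is a bijection, and $\rho_\sigma(Z)=\int_0^1\mathrm{AV@R}_\alpha(Z)\,d\mu(\alpha)$ for $\sigma=\mathbb T\mu$. A set $\mathfrak M\subset\mathfrak P$ is a Kusuoka set of $\rho$ if $\rho(Z)=\sup_{\mu\in\mathfrak M}\int_0^1\mathrm{AV@R}_\alpha(Z)\,d\mu(\alpha)$ for all $Z\in\mathcal Z$. It is minimal if it is closed and contained in every closed Kusuoka set of $\rho$. *)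

(* Defs.v *)
From HB Require Import structures.
From mathcomp Require Import all_boot all_order all_algebra.
From mathcomp Require Import all_classical all_reals all_analysis.

Set Implicit Arguments.
Unset Strict Implicit.
Unset Printing Implicit Defensive.

Import Order.TTheory GRing.Theory Num.Def Num.Theory.
Import numFieldNormedType.Exports.

Local Open Scope classical_set_scope.
Local Open Scope ring_scope.

(* The sample space [0,1] with its Borel sets and the uniform probability is
   rendered by the library's uniform law, a Borel probability on the real line
   carried by [0,1]; the values of Z outside [0,1] are therefore irrelevant. *)
Definition U01 (R : realType) : probability (measurableTypeR R) R :=
  uniform_prob (@ltr01 R).

Definition in_Lp (R : realType) (p : \bar R) (f : R -> R) : Prop :=
  f \in Lfun (U01 R) p.

Definition semideviation (R : realType) (p lam : R) (Z : {RV (U01 R) >-> R}) :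
    \bar R :=
  ('E_(U01 R)[Z] + lam%:E *
    Lnorm (U01 R) p%:E
      (fun w => (Num.max (Z w - fine 'E_(U01 R)[Z]) 0)%:E))%E.

(* F_Z^{-1}(tau) is extended-real: it may be -oo at tau = 0, and it is +oo at
   tau = 1, a null set for all the integrals below. *)
Definition quantile (R : realType) (Z : {RV (U01 R) >-> R}) (tau : R) :
    \bar R :=
  ereal_sup [set t%:E | t in [set t : R | (cdf Z t <= tau%:E)%E]].

Definition AVaR (R : realType) (alpha : R) (Z : {RV (U01 R) >-> R}) : \bar R :=
  (((1 - alpha)^-1)%:E *
    \int[lebesgue_measure]_(tau in `[alpha, 1%R]) quantile Z tau)%E.

(* Spectral functions have domain [0,1[; they are represented by total functions
   about whose values elsewhere nothing is said. *)
Definition spectral (R : realType) (sigma : R -> R) : Prop :=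
  [/\ forall t, 0 <= t < 1 -> 0 <= sigma t,
      forall s t, 0 <= s -> s <= t -> t < 1 -> sigma s <= sigma t,
      forall t, 0 <= t < 1 -> sigma x @[x --> t^'+] --> sigma t
    & (\int[lebesgue_measure]_(t in `[0%R, 1%R[) (sigma t)%:E = 1)%E].

Definition spectral_Lq (R : realType) (q : \bar R) (sigma : R -> R) : Prop :=
  in_Lp q (sigma \_ `[0, 1[).

Definition spectral_norm (R : realType) (q : \bar R) (sigma : R -> R) : R :=
  fine (Lnorm (U01 R) q (EFin \o (sigma \_ `[0, 1[))).

Definition rho_spectral (R : realType) (sigma : R -> R)
    (Z : {RV (U01 R) >-> R}) : \bar R :=
  (\int[lebesgue_measure]_(t in `[0%R, 1%R[) ((sigma t)%:E * quantile Z t))%E.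

(* Probability measures on [0,1] without mass at 1, as Borel probabilities on
   the real line carried by [0,1[. *)
Definition prob01 (R : realType) : set (probability (measurableTypeR R) R) :=
  [set mu : probability (measurableTypeR R) R | mu `[0, 1[%classic = 1%E].
Arguments prob01 R : clear implicits.

Definition C01 (R : realType) : set (R -> R) :=
  [set f : R -> R | {within `[0, 1], continuous f}].
Arguments C01 R : clear implicits.

Definition integrals (R : realType) (mu : prob01 R) :
    {ptws C01 R -> R} :=
  fun f => \int[set_val mu]_(x in `[0, 1]) (set_val f x).

(* The weak topology: the coarsest one that makes mu |-> \int f dmu continuous
   for every f continuous on [0,1]. *)
Definition frakP (R : realType) : Type := initial_topology (@integrals R).
HB.instance Definition _ (R : realType) := Topological.on (frakP R).

Definition measure_of (R : realType) (mu : frakP R) :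
    probability (measurableTypeR R) R :=
  set_val (mu : prob01 R).

Definition bbT (R : realType) (mu : frakP R) (tau : R) : R :=
  \int[measure_of mu]_(alpha in `[0, tau]) (1 - alpha)^-1.

Definition Kusuoka_set (R : realType) (p : R)
    (rho : {RV (U01 R) >-> R} -> \bar R) (M : set (frakP R)) : Prop :=
  forall Z : {RV (U01 R) >-> R}, in_Lp p%:E Z ->
    rho Z = ereal_sup
      [set (\int[measure_of mu]_(alpha in `[0%R, 1%R[) AVaR alpha Z)%E
        | mu in M].

Definition minimal_Kusuoka_set (R : realType) (p : R)
    (rho : {RV (U01 R) >-> R} -> \bar R) (M : set (frakP R)) : Prop :=
  [/\ Kusuoka_set p rho M, closed M
    & forall N : set (frakP R), closed N -> Kusuoka_set p rho N -> M `<=` N].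

(* Measures of the library are set functions on all sets, so an equality of
   measures is stated on measurable sets. *)
Definition frakM (R : realType) (q : \bar R) (lam : R) : set (frakP R) :=
  [set nu : frakP R | exists mu : frakP R,
    spectral_Lq q (bbT mu) /\
    let c := lam / spectral_norm q (bbT mu) in
    forall A : set (measurableTypeR R), measurable A ->
      measure_of nu A = ((1 - c)%:E * \d_(0%R : R) A + c%:E * measure_of mu A)%E].

(* Main.v *)
(* Put G = F_Z^{-1} and m = E Z. Hoelder's inequality for int sigma (G - m) and its
   equality case sigma = c (G - m)_+^(p-1) give the spectral representation; Fubini
   and the surjectivity of T turn it into the Kusuoka representation. The closure
   of M is still a Kusuoka set because a |-> AV@R_a(Z) is the increasing limit of
   the functions a |-> AV@R_{min(a, c)}(Z), which are continuous on [0, 1].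

   For minimality let N be a closed Kusuoka set. If w is a bounded centered quantile
   function with increments at least k (t - s), k > 0, the semideviation is
   differentiable at w and perturbations of w in smooth directions remain quantile
   functions. Hence measures of N that nearly attain the supremum at w have moments
   converging to those of the unique measure given by the derivative at w, which
   thus lies in N. An element of M built from sigma is the limit of such measures,
   w running through truncations of sigma^(1/(p-1)). *)
Require Import Defs.
From HB Require Import structures.
From mathcomp Require Import all_boot all_order all_algebra.
From mathcomp Require Import all_classical all_reals all_analysis.
From mathcomp Require Import measurable_realfun ess_sup_inf ring lra.
Import Order.TTheory GRing.Theory Num.Def Num.Theory.
Import numFieldNormedType.Exports.
Local Open Scope classical_set_scope.
Local Open Scope ring_scope.

Set Implicit Arguments.
Unset Strict Implicit.
Unset Printing Implicit Defensive.

(** * Uniform law and quantile functions *)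

(** [frakP] is not compact, since mass may escape to 1, so measures of N that nearly attain the
    supremum at w cannot simply be given a convergent subsequence. Their moments are controlled
    directly: perturbing w by e y and by - e y squeezes the mean of y, and y runs through multiples
    of (1 - t)^i, whose tail averages are the moments (1 - a)^i. A Kusuoka set can be tested on
    nondecreasing functions only, while these directions do not increase; this is why w must
    increase at a definite rate k. For p > 1 the function x_+^p is differentiable, so both signs of
    e give the same limit. The elements of M are reached because the derivative at a centered w
    depends on w only through w_+. The function g = sigma^(1/(p-1)) is nonnegative and so not
    centered, but it is a limit of positive parts of centered functions: a large negative value on a
    short interval [0, a[ restores mean zero, and it is invisible in w_+. *)

Section measure_lemmas.
Context {R : realType}.

Lemma measurable_fun_nondecreasing_on (D : set R) (f : R -> R) :
  is_interval D -> {in D &, {homo f : x y / x <= y}} -> measurable_fun D f.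
Proof.
move=> iD fnd mD; apply: (measurability (@RGenCInfty.G R)) => //.
  exact: RGenCInfty.measurableE.
move=> /= _ [_ [r ->] <-]; apply: is_interval_measurable => s t/=.
rewrite !in_itv/= !andbT => -[Ds fs] [Dt ft] u /andP[su ut].
have Du : D u by apply: (iD _ _ Ds Dt); rewrite su.
by split => //; rewrite in_itv/= andbT (le_trans fs)// fnd// inE.
Qed.

Lemma eq_probability_cdf (m1 m2 : probability R R) :
  (forall x : R, m1 `]-oo, x]%classic = m2 `]-oo, x]%classic) ->
  forall A, measurable A -> m1 A = m2 A.
Proof.
move=> m12 A mA.
pose g (n : nat) : set R := `]- n%:R, n%:R]%classic.
apply: (@measure_unique _ R R (@ocitv R) g _ _ _ _ m1 m2) => //.
- exact: ocitvI.
- by move=> n; exact: is_ocitv.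
- rewrite -subTset => x _; exists (truncn `|x|).+1 => //=.
  rewrite /g/= in_itv/=; have := truncnS_gt `|x|; rewrite ltr_norml => /andP[-> /ltW].
  by [].
- move=> _ [[a b] _ <-]/=; have [ab|ba] := leP a b; last first.
    by rewrite set_itv_ge ?measure0// bnd_simp -leNgt ltW.
  have -> : `]a, b]%classic = `]-oo, b] `\` `]-oo, a] :> set R.
    by rewrite -[RHS]setCK setCD setCitvl setUC -[LHS]setCK setCitv.
  rewrite !measureD//= ?setIidr ?m12//; try exact: subset_itvl.
  + by rewrite -ge0_fin_numE// fin_num_measure.
  + by rewrite -ge0_fin_numE// fin_num_measure.
- by move=> k; rewrite (le_lt_trans (probability_le1 _ _)) ?ltry//; exact: measurable_itv.
Qed.

End measure_lemmas.

#[global] Instance ae_U01_filter (R : realType) :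
  Filter (nbhs (almost_everywhere (U01 R))).
Proof. exact: ae_filter_ringOfSetsType. Qed.

Section uniform_law.
Context {R : realType}.
Implicit Types (f : R -> \bar R) (A : set R) (t : R).
Local Notation leb := (@lebesgue_measure R).

Lemma integral_U01 f : measurable_fun setT f ->
  (\int[U01 R]_x f x = \int[leb]_(x in `[0%R, 1%R]) f x)%E.
Proof.
move=> mf; rewrite integralE [RHS]integralE /U01.
rewrite !integral_uniform//; last 2 first.
  exact: measurable_funeneg.
  exact: measurable_funepos.
by rewrite subr0 invr1 !mul1e.
Qed.

Lemma integral_U01_sub A f : measurable A -> A `<=` `[0, 1] ->
  measurable_fun A f ->
  (\int[leb]_(x in A) f x = \int[U01 R]_(x in A) f x)%E.
Proof.
move=> mA A01 mf; rewrite [RHS]integral_mkcond integral_U01; last first.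
  by apply/(measurable_restrictT _ _).1.
by rewrite -integral_mkcondr setIidr.
Qed.

Lemma U01_itv (a b : itv_bound R) : [set` Interval a b] `<=` `[0, 1] ->
  U01 R [set` Interval a b] = leb [set` Interval a b].
Proof.
move=> h; rewrite -[LHS]mul1e -[RHS]mul1e.
rewrite -!(@integral_cst _ _ _ _ _ _ 1%E)//.
by rewrite [RHS]integral_U01_sub.
Qed.

Lemma U01_out0 : U01 R (~` `]0, 1[%classic) = 0%E.
Proof.
rewrite probability_setC// U01_itv; last exact: subset_itv_oo_cc.
by rewrite lebesgue_measure_itv/= lte_fin ltr01 oppr0 adde0 subee.
Qed.

Lemma U01_ae_itvoo : {ae U01 R, forall t, 0 < t < 1}.
Proof.
exists (~` `]0, 1[%classic); split.
- exact: measurableC.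
- exact: U01_out0.
- by move=> t /= h; rewrite in_itv.
Qed.

(** The law does not charge the complement of ]0, 1[. Open, half-open and closed intervals, as well
    as default values outside ]0, 1[, are exchanged through this lemma. *)
Lemma eq_integral_U01 A B f (g : R -> \bar R) : measurable A -> measurable B ->
  measurable_fun A f -> measurable_fun B g ->
  (forall t, 0 < t < 1 -> (A t <-> B t)) ->
  (forall t, 0 < t < 1 -> A t -> f t = g t) ->
  (\int[U01 R]_(x in A) f x = \int[U01 R]_(x in B) g x)%E.
Proof.
move=> mA mB mf mg AB fg; rewrite integral_mkcond [RHS]integral_mkcond.
apply: ae_eq_integral => //.
- by apply/(measurable_restrictT _ _).1.
- by apply/(measurable_restrictT _ _).1.
apply: filterS U01_ae_itvoo => t t01 _; rewrite !patchE.
have [tA|tA] := boolP (t \in A).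
  rewrite inE in tA; rewrite mem_set; last exact/AB.
  exact: fg.
by rewrite memNset// => /AB => /(_ t01)/mem_set; rewrite (negbTE tA).
Qed.

End uniform_law.

Definition U01_rv (R : realType) (g : R -> R) (mg : measurable_fun setT g) :
    {RV (U01 R) >-> R} :=
  @mfun_Sub _ _ (measurableTypeR R) R g (mem_set mg).

Section quantile_theory.
Context {R : realType} (Z : {RV (U01 R) >-> R}).
Implicit Types (s t x : R).

Let S t := [set s : R | (cdf Z s <= t%:E)%E].

Lemma quantile_level_nonempty t : 0 < t -> S t !=set0.
Proof.
move=> t0; have /fine_cvgP[_] := @cvg_cdfNy0 _ _ _ _ Z.
move=> /cvgrPdist_lt/(_ _ t0)[M [_ h]].
have := h (M - 1) ltac:(rewrite ltrBlDr ltrDl//).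
rewrite /= sub0r normrN => hh; exists (M - 1); suff : (cdf Z (M - 1) <= t%:E)%E by [].
rewrite -[X in (X <= _)%E]fineK ?fin_num_measure// lee_fin.
exact: le_trans (ler_norm _) (ltW hh).
Qed.

Lemma quantile_level_ub t : t < 1 -> exists M, forall x, S t x -> x <= M.
Proof.
move=> t1; have /fine_cvgP[_] := @cvg_cdfy1 _ _ _ _ Z.
have t0 : 0 < 1 - t by rewrite subr_gt0.
move=> /cvgrPdist_lt/(_ _ t0)[M [_ h]]; exists (M + 1) => x Sx.
have := h (M + 1) ltac:(rewrite ltrDl//) => hh.
rewrite leNgt; apply/negP => Mx.
have := @cdf_nondecreasing _ _ _ _ Z _ _ (ltW Mx).
move=> /le_trans/(_ Sx); rewrite -[X in (X <= _)%E]fineK ?fin_num_measure//.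
by rewrite lee_fin; move: hh => /= /(le_lt_trans (ler_norm _)); lra.
Qed.

Lemma quantile_fin_num t : 0 < t < 1 -> quantile Z t \is a fin_num.
Proof.
move=> /andP[t0 t1]; have [s Ss] := @quantile_level_nonempty t t0.
have [M hM] := @quantile_level_ub t t1.
rewrite fin_numElt; apply/andP; split.
  by apply: (@lt_le_trans _ _ s%:E); rewrite ?ltNyr//; apply: ereal_sup_ubound; exists s.
apply: (@le_lt_trans _ _ M%:E); rewrite ?ltry//.
by apply: ge_ereal_sup => _ [x Sx <-]; rewrite lee_fin hM.
Qed.

Lemma quantile_le s t : s <= t -> (quantile Z s <= quantile Z t)%E.
Proof.
move=> st; apply: le_ereal_sup => _ [x Sx <-]; exists x => //=.
by rewrite (le_trans Sx)// lee_fin.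
Qed.

(** The quantile is the upper inverse, so F and F^-1 are adjoint only up to strictness. This
    implication and [lt_cdf_quantile] are the two halves; the gap between < and <= is closed by
    right limits. *)
Lemma quantile_lt_cdf t x : (quantile Z t < x%:E)%E -> (t%:E < cdf Z x)%E.
Proof.
apply: contraPT; rewrite -leNgt => h; apply/negP; rewrite -leNgt.
by apply: ereal_sup_ubound; exists x.
Qed.

Lemma lt_cdf_quantile t x : (t%:E < cdf Z x)%E -> (quantile Z t <= x%:E)%E.
Proof.
move=> h; apply: ge_ereal_sup => _ [s /= Ss <-]; rewrite lee_fin leNgt.
apply/negP => xs; have := @cdf_nondecreasing _ _ _ _ Z _ _ (ltW xs).
by move=> /le_trans/(_ Ss); rewrite leNgt h.
Qed.

Definition quantile_fun t : R := if 0 < t < 1 then fine (quantile Z t) else 0.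

Lemma quantile_funE t : 0 < t < 1 -> quantile Z t = (quantile_fun t)%:E.
Proof. by move=> t01; rewrite /quantile_fun t01 fineK// quantile_fin_num. Qed.

Lemma quantile_fun_le s t : 0 < s -> s <= t -> t < 1 ->
  quantile_fun s <= quantile_fun t.
Proof.
move=> s0 st t1; rewrite -lee_fin -!quantile_funE ?quantile_le//.
  by rewrite (lt_le_trans s0).
by rewrite s0 (le_lt_trans st).
Qed.

(** Any x between t and F(F^-1(t) + e) has quantile at most F^-1(t) + e, and this interval is
    nonempty by [quantile_lt_cdf]. *)
Lemma quantile_fun_rc t : 0 < t < 1 -> quantile_fun x @[x --> t^'+] --> quantile_fun t.
Proof.
move=> /andP[t0 t1]; apply/cvgrPdist_le => e e0.
have : (t%:E < cdf Z (quantile_fun t + e))%E.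
  by apply: quantile_lt_cdf; rewrite quantile_funE ?t0// lte_fin ltrDl.
rewrite -[X in (_ < X)%E]fineK ?fin_num_measure// lte_fin.
set c := fine _ => tc.
near=> x.
have tx : t < x by near: x; exact: nbhs_right_gt.
have xc : x < c by near: x; exact: nbhs_right_lt.
have x1 : x < 1 by near: x; exact: nbhs_right_lt.
have le1 : quantile_fun t <= quantile_fun x by apply: quantile_fun_le => //; exact: ltW.
rewrite ler0_norm ?subr_le0// opprB lerBlDl.
rewrite -lee_fin -quantile_funE ?x1 ?(lt_trans t0)//; apply: lt_cdf_quantile.
by rewrite -[X in (_ < X)%E]fineK ?fin_num_measure// lte_fin.
Unshelve. all: by end_near. Qed.

Lemma measurable_quantile_fun : measurable_fun setT quantile_fun.
Proof.
have -> : quantile_fun = quantile_fun \_ `]0, 1[.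
  apply/funext => t; rewrite patchE; case: ifPn => //.
  rewrite notin_setE/= in_itv/= => /negP/negbTE h.
  by rewrite /quantile_fun h.
apply/(measurable_restrictT _ _).1 => //.
apply: measurable_fun_nondecreasing_on; first exact: interval_is_interval.
move=> s t; rewrite !inE/= !in_itv/= => /andP[s0 s1] /andP[t0 t1] st.
exact: quantile_fun_le.
Qed.

(** Up to a null set the event contains ]0, F(x)[ and is contained in ]0, F(y)[ for every y > x;
    right-continuity of F closes the gap. *)
Lemma U01_quantile_law x :
  U01 R (quantile_fun @^-1` `]-oo, x]) = cdf Z x.
Proof.
have mG : measurable (quantile_fun @^-1` `]-oo, x]).
  by rewrite -[X in measurable X]setTI; apply: measurable_quantile_fun.
have cE y : cdf Z y = (fine (cdf Z y))%:E by rewrite fineK// fin_num_measure.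
have c1 y : fine (cdf Z y) <= 1 by rewrite -lee_fin -cE cdf_le1.
have c0 y : 0 <= fine (cdf Z y) by rewrite -lee_fin -cE cdf_ge0.
have U0c y : U01 R `]0, fine (cdf Z y)[%classic = cdf Z y.
  rewrite [RHS]cE; move: (c0 y) (c1 y); move: (fine (cdf Z y)) => c cc0 cc1.
  rewrite U01_itv; last first.
    move=> t /=; rewrite !in_itv/= => /andP[/ltW -> /ltW tc].
    exact: le_trans tc cc1.
  rewrite lebesgue_measure_itv/= lte_fin; case: ltP => [_|h].
    by rewrite oppr0 adde0.
  by congr EFin; apply/le_anti; rewrite h cc0.
apply/eqP; rewrite eq_le; apply/andP; split.
- have : cdf Z y @[y --> x^'+] --> cdf Z x by exact: cdf_right_continuous.
  move=> /cvg_lim <- //; apply: lime_ge.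
    by apply/cvg_ex; exists (cdf Z x); exact: cdf_right_continuous.
  near=> y.
  have xy : x < y by near: y; exact: nbhs_right_gt.
  rewrite -(U0c y).
  have -> : U01 R (quantile_fun @^-1` `]-oo, x]) =
      U01 R (quantile_fun @^-1` `]-oo, x] `&` `]0, 1[).
    apply/eqP; rewrite eq_le; apply/andP; split; last first.
      by apply: le_measure; rewrite ?inE//; exact: measurableI.
    rewrite -[leRHS]adde0 -U01_out0.
    apply: le_trans (measureU2 _ _ _); [|exact: measurableI|exact: measurableC].
    apply: le_measure; rewrite ?inE//.
      by apply: measurableU; [exact: measurableI|exact: measurableC].
    move=> t /= Gt; have [t01|t01] := boolP (t \in `]0, 1[); first by left.
    by right; apply/negP.
  apply: le_measure; rewrite ?inE//; first exact: measurableI.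
  move=> t /= []; rewrite !in_itv/= => Gt /andP[t0 t1]; rewrite t0/=.
  rewrite -lte_fin -cE; apply: quantile_lt_cdf; rewrite quantile_funE ?t0//.
  by rewrite lte_fin (le_lt_trans Gt).
- rewrite -[leLHS]U0c; apply: le_measure; rewrite ?inE//.
  move: (c1 x) (cE x); move: (fine (cdf Z x)) => c cc1 cxE.
  move=> t /=; rewrite !in_itv/= => /andP[t0 tc].
  rewrite -lee_fin -quantile_funE; last by rewrite t0 (lt_le_trans tc).
  by apply: lt_cdf_quantile; rewrite cxE lte_fin.
Unshelve. all: by end_near. Qed.

Lemma integral_quantile_fun f : measurable_fun setT f -> (forall x, 0 <= f x)%E ->
  (\int[U01 R]_t f (quantile_fun t) = \int[U01 R]_t f (Z t))%E.
Proof.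
move=> mf f0.
transitivity (\int[distribution (U01 R) (U01_rv measurable_quantile_fun)]_y f y)%E.
  by rewrite ge0_integral_distribution.
rewrite -[RHS](ge0_integral_distribution Z mf f0).
apply: eq_measure_integral => A mA _.
apply: (@eq_probability_cdf _ (distribution _ (U01_rv measurable_quantile_fun))
  (distribution _ Z)) => // x.
exact: U01_quantile_law.
Qed.

Lemma integrable_quantile_fun (f : R -> R) : measurable_fun setT f ->
  (U01 R).-integrable setT (EFin \o (f \o Z)) ->
  (U01 R).-integrable setT (EFin \o (f \o quantile_fun)).
Proof.
move=> mf /integrableP[_ i]; apply/integrableP; split.
  by apply/measurable_EFinP; apply: measurableT_comp => //; exact: measurable_quantile_fun.
move: i; rewrite -(@integral_quantile_fun (fun x => `|(f x)%:E|%E))//.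
by apply: measurableT_comp => //; exact/measurable_EFinP.
Qed.

Lemma Rintegral_quantile_fun (f : R -> R) : measurable_fun setT f ->
  \int[U01 R]_t f (quantile_fun t) = \int[U01 R]_t f (Z t).
Proof.
move=> mf; rewrite /Rintegral; congr fine.
rewrite integralE [RHS]integralE; congr (_ - _)%E.
- under eq_integral => t _ do rewrite -[_^\+%E t]/(((EFin \o f) \o quantile_fun)^\+ t)%E funepos_comp/=.
  under [RHS]eq_integral => t _ do rewrite -[_^\+%E t]/(((EFin \o f) \o Z)^\+ t)%E funepos_comp/=.
  apply: integral_quantile_fun => //.
  by apply: measurable_funepos; exact/measurable_EFinP.
- under eq_integral => t _ do rewrite -[_^\-%E t]/(((EFin \o f) \o quantile_fun)^\- t)%E funeneg_comp/=.
  under [RHS]eq_integral => t _ do rewrite -[_^\-%E t]/(((EFin \o f) \o Z)^\- t)%E funeneg_comp/=.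
  apply: integral_quantile_fun => //.
  by apply: measurable_funeneg; exact/measurable_EFinP.
Qed.

End quantile_theory.

Section quantile_monotone.
Context {R : realType}.

(** Through this lemma a function on ]0, 1[ can be used as a test variable for a Kusuoka set.
    Right-continuity enters because the quantile is the upper inverse. *)
Lemma quantile_monotone (Z : {RV (U01 R) >-> R}) (g : R -> R) :
  (forall t, 0 < t < 1 -> Z t = g t) ->
  (forall s t, 0 < s -> s <= t -> t < 1 -> g s <= g t) ->
  (forall t, 0 < t < 1 -> g x @[x --> t^'+] --> g t) ->
  forall t, 0 < t < 1 -> quantile Z t = (g t)%:E.
Proof.
move=> Zg gnd grc t /andP[t0 t1]; apply/eqP; rewrite eq_le; apply/andP; split.
- apply: ge_ereal_sup => _ [s /= cs <-]; rewrite lee_fin leNgt; apply/negP => gs.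
  (* If g t < s, right-continuity gives g < s up to some u > t, whence F(s) >= u > t, against the
     choice of s. *)
  suff [u [tu u1 gu]] : exists u, [/\ t < u, u < 1 & g u < s].
    move: cs; apply/negP; rewrite -ltNge.
    apply: (@lt_le_trans _ _ (U01 R `]0, u[%classic)).
      rewrite U01_itv ?lebesgue_measure_itv/= ?lte_fin ?(lt_trans t0)//.
        by rewrite oppr0 adde0 lte_fin.
      by move=> x /=; rewrite !in_itv/= => /andP[/ltW -> xu]; exact/ltW/(lt_trans xu).
    apply: le_measure; rewrite ?inE//; first exact: measurable_funPTI.
    move=> x /=; rewrite !in_itv/= => /andP[x0 xu].
    have x1 := lt_trans xu u1.
    by rewrite Zg ?x0// ltW// (le_lt_trans _ gu)// gnd// ltW.
  have t01 : 0 < t < 1 by rewrite t0.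
  have /cvgr_lt/(_ _ gs) h := grc t t01.
  have : \forall x \near t^'+, [/\ t < x, x < 1 & g x < s].
    near=> x; split; near: x => //; [exact: nbhs_right_gt|exact: nbhs_right_lt].
  by move=> /filter_ex.
- apply/lee_addgt0Pr => e e0; rewrite -leeBlDr//.
  apply: ereal_sup_ubound; exists (g t - e) => //=.
  rewrite /cdf /distribution /pushforward/=.
  apply: (@le_trans _ _ (U01 R (`]0, t[%classic `|` ~` `]0, 1[%classic))).
    apply: le_measure; rewrite ?inE//; first exact: measurable_funPTI.
      by apply: measurableU => //; exact: measurableC.
    move=> x /=; rewrite !in_itv/= => Zx.
    have [/andP[x0 x1]|x01] := boolP (0 < x < 1); last by right; apply/negP.
    left; rewrite x0/= ltNge; apply/negP => tx.
    move: Zx; rewrite Zg ?x0//; apply/negP; rewrite -ltNge.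
    by rewrite (lt_le_trans _ (gnd _ _ t0 tx x1))// ltrBlDr ltrDl.
  apply: (le_trans (measureU2 _ _ _)) => //; first exact: measurableC.
  rewrite [X in (_ + X)%E](_ : _ = 0%E); last exact: U01_out0.
  rewrite adde0; suff U0t : U01 R `]0, t[%classic = t%:E by rewrite -[leRHS]U0t.
  rewrite U01_itv ?lebesgue_measure_itv/= ?lte_fin ?t0 ?oppr0 ?adde0//.
  by move=> x /=; rewrite !in_itv/= => /andP[/ltW -> xu]; exact/ltW/(lt_trans xu).
Unshelve. all: by end_near. Qed.

End quantile_monotone.

Section tail_average.
Context {R : realType}.
Implicit Types (g : R -> R) (a : R).

Definition tail_average g a : R := (1 - a)^-1 * \int[U01 R]_(t in `[a, 1]) g t.

Lemma AVaR_tail_average (Z : {RV (U01 R) >-> R}) g a :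
  (U01 R).-integrable setT (EFin \o g) ->
  (forall t, 0 < t < 1 -> quantile Z t = (g t)%:E) ->
  0 <= a < 1 -> AVaR a Z = (tail_average g a)%:E.
Proof.
move=> ig Zg /andP[a0 a1]; rewrite /AVaR /tail_average EFinM; congr (_ * _)%E.
have mg : measurable_fun setT g by apply/measurable_EFinP; exact: measurable_int ig.
rewrite /Rintegral fineK; last first.
  by apply: integrable_fin_num => //; exact: integrableS ig.
(* The quantile is +oo at 1 and, when a = 0, possibly -oo at 0. Both endpoints are dropped before it
   is replaced by g. *)
have Zg' : {in `]a, 1[%classic, forall t, quantile Z t = (g t)%:E}.
  move=> t; rewrite inE/= in_itv/= => /andP[at' t1]; apply: Zg.
  by rewrite t1 (le_lt_trans a0).
rewrite integral_itv_bndoo; last first.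
  apply: (eq_measurable_fun (EFin \o g)); first by move=> t /Zg'.
  by apply: measurable_funTS; exact/measurable_EFinP.
transitivity (\int[lebesgue_measure]_(z in `]a, 1%R[) (g z)%:E)%E.
  by apply: eq_integral => t /Zg'.
have mgA (A : set R) : measurable_fun A (EFin \o g).
  by apply: measurable_funTS; exact/measurable_EFinP.
rewrite -(@integral_itv_bndoo R a 1 (EFin \o g) true false)//.
rewrite integral_U01_sub//.
by move=> x /=; rewrite !in_itv/= => /andP[ax ->]; rewrite (le_trans a0).
Qed.

Lemma rho_spectral_Rintegral (Z : {RV (U01 R) >-> R}) (s g : R -> R) :
  measurable_fun setT (s \_ `[0, 1[) -> measurable_fun setT g ->
  (forall t, 0 < t < 1 -> quantile Z t = (g t)%:E) ->
  rho_spectral s Z = (\int[U01 R]_t ((s \_ `[0%R, 1%R[) t * g t)%:E)%E.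
Proof.
move=> ms mg Zg; rewrite /rho_spectral.
have msg : measurable_fun setT (fun t => ((s \_ `[0, 1[) t * g t)%:E).
  by apply/measurable_EFinP; exact: measurable_funM.
have Zg' : {in `]0%R, 1%R[%classic, forall t,
    ((s t)%:E * quantile Z t)%E = ((s \_ `[0, 1[) t * g t)%:E}.
  move=> t; rewrite inE/= in_itv/= => t01; rewrite Zg// patchE mem_set//=.
  by rewrite in_itv/=; move: t01 => /andP[/ltW -> ->].
rewrite integral_itv_bndoo; last first.
  apply: (eq_measurable_fun (fun t => ((s \_ `[0, 1[) t * g t)%:E)).
    by move=> t /Zg'.
  exact: measurable_funTS msg.
transitivity (\int[lebesgue_measure]_(z in `]0%R, 1%R[)
    ((s \_ `[0, 1[) z * g z)%:E)%E.
  by apply: eq_integral => t /Zg'.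
rewrite integral_U01_sub//; last 2 first.
  exact: subset_itv_oo_cc.
  exact: measurable_funTS msg.
by apply: eq_integral_U01 => //; exact: measurable_funTS msg.
Qed.

End tail_average.

(** * The semideviation functional on L_p *)

Lemma pos_powR_continuous (R : realType) (r : R) : 0 < r -> 
  continuous (fun x : R => Num.max x 0 `^ r).
Proof.
move=> r0 x; have [x0|x0|x0] := ltgtP x 0.
- apply/cvgrPdist_lt => e e0; near=> y.
  have y0 : y < 0 by near: y; exact: lt_nbhsl.
  by rewrite (max_idPr (ltW y0)) (max_idPr (ltW x0)) subrr normr0.
- have c : {for x, continuous (fun y : R => expR (r * ln y))}.
    have cl : {for x, continuous (fun y : R => r * ln y)}.
      apply: (@continuousM _ _ (cst r) (@ln R)); first exact: cst_continuous.
      exact: continuous_ln.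
    by have := continuous_comp cl (@continuous_expR _ _); apply.
  apply/cvgrPdist_lt => e e0; move/cvgrPdist_lt/(_ e e0) : c => c.
  near=> y; have y0 : 0 < y by near: y; exact: lt_nbhsr.
  rewrite (max_idPl (ltW x0)) (max_idPl (ltW y0)) /powR !gt_eqF//.
  by near: y; exact: c.
- apply/cvgrPdist_lt => e e0; rewrite x0 maxxx powR0 ?gt_eqF//.
  near=> y; rewrite sub0r normrN ger0_norm ?powR_ge0//.
  have y0 : y < e `^ r^-1.
    by near: y; apply: lt_nbhsl; exact: powR_gt0.
  have -> : e = (e `^ r^-1) `^ r by rewrite -powRrM mulVf ?gt_eqF// powRr1// ltW.
  apply: gt0_ltr_powR => //; rewrite ?nnegrE ?le_max ?lexx ?orbT ?powR_ge0//.
  by rewrite gt_max y0 powR_gt0.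
Unshelve. all: by end_near. Qed.

Section Lp_uniform.
Context {R : realType}.
Implicit Types (f g : R -> R) (p r : R) (q : \bar R).

Lemma U01_setT_gt0 : (0 < U01 R setT)%E.
Proof. by rewrite probability_setT lte01. Qed.

Definition Lp_norm q f : R := fine (Lnorm (U01 R) q (EFin \o f)).

Lemma in_Lp_measurable q f : in_Lp q f -> measurable_fun setT f.
Proof. by rewrite /in_Lp inE => /andP[]; rewrite inE. Qed.

Lemma in_Lp_Lnorm q f : in_Lp q f ->
  Lnorm (U01 R) q (EFin \o f) = (Lp_norm q f)%:E.
Proof.
rewrite /in_Lp inE => /andP[_]; rewrite inE/= => fo.
by rewrite /Lp_norm fineK// ge0_fin_numE ?Lnorm_ge0.
Qed.

Lemma Lp_norm_ge0 q f : 0 <= Lp_norm q f.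
Proof. by rewrite /Lp_norm fine_ge0// Lnorm_ge0. Qed.

Lemma measurable_norm_powR f r : measurable_fun setT f ->
  measurable_fun setT (fun t => `|f t| `^ r).
Proof.
move=> mf; apply: (measurableT_comp (measurable_powR r)) => //.
exact: measurableT_comp.
Qed.

Lemma in_Lp_integrable r f : 1 <= r -> in_Lp r%:E f <->
  measurable_fun setT f /\
  (U01 R).-integrable setT (EFin \o (fun t => `|f t| `^ r)).
Proof.
move=> r1; split=> [fr|[mf /integrableP[_ i]]].
  by split; [exact: in_Lp_measurable fr|exact: Lfun_integrable].
rewrite /in_Lp inE; apply/andP; split; rewrite inE//= /finite_norm unlock.
rewrite poweR_lty//; apply: le_lt_trans i.
by under [leRHS]eq_integral => x _ do rewrite gee0_abs ?lee_fin ?powR_ge0//.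
Qed.

Lemma Lp_normE r f : 1 <= r -> in_Lp r%:E f ->
  Lp_norm r%:E f = (\int[U01 R]_t (`|f t| `^ r)) `^ r^-1.
Proof.
move=> r1 /(in_Lp_integrable _ r1)[mf i].
rewrite /Lp_norm /Rintegral unlock.
under eq_integral do rewrite abse_EFin poweR_EFin.
rewrite -[X in fine (X `^ _)%E]fineK ?poweR_EFin//.
exact: (integrable_fin_num _ i).
Qed.

Lemma in_Lp_bounded q f M : (1 <= q)%E -> measurable_fun setT f ->
  (forall t, `|f t| <= M) -> in_Lp q f.
Proof.
move=> q1 mf fM; rewrite /in_Lp.
suff : f \in Lfun (U01 R) +oo%E.
  by apply: Lfun_subset; rewrite ?leey ?fin_num_measure.
rewrite inE; apply/andP; split; rewrite inE//= /finite_norm unlock.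
case: ifPn => [_|/negP[]]; last exact: U01_setT_gt0.
apply: (@le_lt_trans _ _ M%:E); last exact: ltry.
by apply/ess_supP; apply: nearW => x /=; rewrite lee_fin.
Qed.

Lemma conjugate_fin p q : 1 < p -> ((p%:E)^-1 + q^-1 = 1)%E ->
  q = (p / (p - 1))%:E.
Proof.
move=> p1 /hoelder_conjugateP; have p0 : 0 < p by apply: lt_trans p1.
move=> /(_ (ltNyr _)); rewrite eqe gt_eqF// => /(_ isT) ->.
rewrite /hoelder_conjugate/= eqe gt_eqF// -[(p%:E - 1)%E]/((p - 1)%:E).
by rewrite inver subr_eq0 gt_eqF.
Qed.

(** For p = 1 the conjugate is +oo, and f is bounded almost everywhere by its essential supremum;
    for p > 1 both exponents are finite. *)
Lemma hoelder_Lnorm p q f g : 1 <= p -> ((p%:E)^-1 + q^-1 = 1)%E ->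
  in_Lp q f -> in_Lp p%:E g ->
  ('N[U01 R]_1[EFin \o (f \* g)%R] <=
   'N[U01 R]_q[EFin \o f] * 'N[U01 R]_p%:E[EFin \o g])%E.
Proof.
move=> p1 pq fq gp.
have mf := in_Lp_measurable fq; have mg := in_Lp_measurable gp.
have p0 : 0 < p by apply: lt_le_trans p1.
have /hoelder_conjugateP : ((p%:E)^-1 + q^-1 = 1)%E by [].
move=> /(_ (ltNyr _)); rewrite eqe gt_eqF// => /(_ isT) qE.
move: p1; rewrite le_eqVlt => /predU1P[p1|p1].
  move: qE fq gp; rewrite -p1 hoelder_conjugate1 => -> fq gp.
  rewrite !Lnorm1 (in_Lp_Lnorm fq).
  rewrite -ge0_integralZl//; last 2 first.
  - by apply: measurableT_comp => //; exact/measurable_EFinP.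
  - by rewrite lee_fin Lp_norm_ge0.
  apply: ae_ge0_le_integral => //.
  - by apply: measurableT_comp => //; apply/measurable_EFinP; exact: measurable_funM.
  - by move=> x _; rewrite mule_ge0// lee_fin Lp_norm_ge0.
  - apply: measurable_funeM; apply: measurableT_comp => //; exact/measurable_EFinP.
  - have := ess_sup_ge (U01 R) (abse \o (EFin \o f)).
    apply: filterS => x /= h _; rewrite normrM EFinM lee_wpmul2r//.
    rewrite -(in_Lp_Lnorm fq) unlock; case: ifPn => [//|/negP[]].
    exact: U01_setT_gt0.
have p11 : 0 < p - 1 by rewrite subr_gt0.
have qE' := conjugate_fin p1 pq.
rewrite qE' muleC; have -> : f \* g = g \* f by apply/funext => x/=; rewrite mulrC.
apply: hoelder => //; first by rewrite divr_gt0.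
by rewrite invf_div -{1}(mul1r p^-1) -mulrDl addrC subrK mulfV// gt_eqF.
Qed.

Lemma hoelder_integrable p q f g : 1 <= p -> ((p%:E)^-1 + q^-1 = 1)%E ->
  in_Lp q f -> in_Lp p%:E g ->
  (U01 R).-integrable setT (EFin \o (fun t => f t * g t)).
Proof.
move=> p1 pq fq gp; apply/integrableP; split.
  apply/measurable_EFinP; apply: measurable_funM.
    exact: in_Lp_measurable fq.
  exact: in_Lp_measurable gp.
have := hoelder_Lnorm p1 pq fq gp; rewrite Lnorm1 => /le_lt_trans; apply.
by rewrite !in_Lp_Lnorm// -EFinM ltry.
Qed.

Lemma hoelder_Rintegral p q f g : 1 <= p -> ((p%:E)^-1 + q^-1 = 1)%E ->
  in_Lp q f -> in_Lp p%:E g ->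
  \int[U01 R]_t (f t * g t) <= Lp_norm q f * Lp_norm p%:E g.
Proof.
move=> p1 pq fq gp; have i := hoelder_integrable p1 pq fq gp.
apply: (le_trans (ler_norm _)); apply: (le_trans (le_normr_Rintegral _ _)) => //.
rewrite -lee_fin EFinM -(in_Lp_Lnorm fq) -(in_Lp_Lnorm gp).
apply: le_trans (hoelder_Lnorm p1 pq fq gp); rewrite Lnorm1 /Rintegral fineK//.
by apply: integrable_fin_num => //; exact: (integrable_norm i).
Qed.

Lemma conjugate_ge1 p q : 1 <= p -> ((p%:E)^-1 + q^-1 = 1)%E -> (1 <= q)%E.
Proof.
move=> p1 /hoelder_conjugateP.
have p0 : 0 < p by apply: lt_le_trans p1.
move=> /(_ (ltNyr _)); rewrite eqe gt_eqF// => /(_ isT) ->.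
by apply: hoelder_conj_ge1.
Qed.

Lemma in_Lp_cst q (c : R) : (1 <= q)%E -> in_Lp q (cst c).
Proof. by move=> q1; apply: (@in_Lp_bounded _ _ `|c|). Qed.

Lemma in_Lp_integrable1 q f : (1 <= q)%E -> in_Lp q f ->
  (U01 R).-integrable setT (EFin \o f).
Proof.
move=> q1 fq; apply/Lfun1_integrable; move: fq.
by apply: Lfun_subset; rewrite ?lexx ?fin_num_measure.
Qed.

Lemma Rintegral_U01_cst (c : R) : \int[U01 R]_t c = c.
Proof. by rewrite Rintegral_cst// [X in fine X](_ : _ = 1%E) ?mulr1//; exact: probability_setT. Qed.

(** Hoelder's inequality against the constant 1. Together with lam <= 1 it makes lam / ||sigma||_q a
    weight in [0, 1]. *)
Lemma Lp_norm_ge1 p q f : 1 <= p -> ((p%:E)^-1 + q^-1 = 1)%E ->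
  in_Lp q f -> \int[U01 R]_t f t = 1 -> 1 <= Lp_norm q f.
Proof.
move=> p1 pq fq f1.
have l1 : in_Lp p%:E (cst 1 : R -> R) by apply: in_Lp_cst; rewrite lee_fin.
have := hoelder_Rintegral p1 pq fq l1.
under eq_Rintegral do rewrite mulr1.
rewrite f1 (Lp_normE p1 l1).
under eq_Rintegral do rewrite normr1 powR1.
by rewrite Rintegral_U01_cst powR1 mulr1.
Qed.

Definition pos_part f (t : R) : R := Num.max (f t) 0.

Lemma pos_part_ge0 f t : 0 <= pos_part f t.
Proof. by rewrite /pos_part le_max lexx orbT. Qed.

Lemma in_Lp_le q f g : (1 <= q)%E -> measurable_fun setT f -> in_Lp q g ->
  (forall t, `|f t| <= `|g t|) -> in_Lp q f.
Proof.
move=> q1 mf gq fg; case: q q1 gq => [r| |]// q1 gq.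
  apply/in_Lp_integrable => //; split => //.
  have [mg ig] := (in_Lp_integrable g q1).1 gq.
  apply: le_integrable ig => //.
    by apply/measurable_EFinP; exact: measurable_norm_powR.
  move=> x _ /=; rewrite lee_fin !(ger0_norm (powR_ge0 _ _)).
  by apply: ge0_ler_powR; rewrite ?nnegrE ?normr_ge0 ?(le_trans ler01).
move: gq; rewrite /in_Lp !inE => /andP[_]; rewrite inE/= => ng.
apply/andP; split; rewrite inE//=; apply: le_lt_trans ng.
rewrite unlock; case: ifPn => [_|/negP[]]; last exact: U01_setT_gt0.
apply: le_ess_sup; by apply: nearW => x /=; rewrite lee_fin.
Qed.

Lemma in_LpD q f g : (1 <= q)%E -> in_Lp q f -> in_Lp q g ->
  in_Lp q (fun t => f t + g t).
Proof.
move=> q1 fq gq; rewrite /in_Lp.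
rewrite -[X in X \in _]/((f : _ -> _) + g)%R.
have [_ h] := @Lfun_submod_closed _ _ _ (U01 R) q q1.
by have := h 1 f g fq gq; rewrite scale1r.
Qed.

Lemma in_LpZ q f (c : R) : (1 <= q)%E -> in_Lp q f -> in_Lp q (fun t => c * f t).
Proof.
move=> q1 fq; have [h0 h] := @Lfun_submod_closed _ _ _ (U01 R) q q1.
by have := h c f 0 fq h0; rewrite addr0.
Qed.

Lemma in_Lp_pos_part q f : (1 <= q)%E -> in_Lp q f -> in_Lp q (pos_part f).
Proof.
move=> q1 fq; apply: (in_Lp_le q1 _ fq).
  by apply: measurable_maxr => //; exact: in_Lp_measurable fq.
move=> t; rewrite /pos_part; case: (lerP (f t) 0) => h; rewrite ?normr0//.
Qed.

Lemma in_Lp_pos_dev p f (m : R) : 1 <= p -> in_Lp p%:E f ->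
  in_Lp p%:E (pos_part (fun t => f t - m)).
Proof.
move=> p1 fp; apply: in_Lp_pos_part => //; apply: in_LpD => //.
exact: (@in_Lp_cst _ (- m)).
Qed.

Definition semidev p (lam : R) f : R :=
  \int[U01 R]_t f t + lam *
  (\int[U01 R]_t (pos_part (fun s => f s - \int[U01 R]_u f u) t `^ p)) `^ p^-1.

Lemma Lp_norm_pos_part p f (m : R) : 1 <= p -> in_Lp p%:E f ->
  Lp_norm p%:E (pos_part (fun t => f t - m)) =
  (\int[U01 R]_t (pos_part (fun s => f s - m) t `^ p)) `^ p^-1.
Proof.
move=> p1 fp; rewrite (Lp_normE p1 (in_Lp_pos_dev m p1 fp)).
by under eq_Rintegral => t _ do rewrite (ger0_norm (pos_part_ge0 _ _)).
Qed.

Lemma semidevE p lam f : 1 <= p -> in_Lp p%:E f ->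
  semidev p lam f = \int[U01 R]_t f t +
    lam * Lp_norm p%:E (pos_part (fun t => f t - \int[U01 R]_u f u)).
Proof. by move=> p1 fp; rewrite (Lp_norm_pos_part _ p1 fp). Qed.

Lemma expectation_Rintegral p (Z : {RV (U01 R) >-> R}) : 1 <= p ->
  in_Lp p%:E Z -> 'E_(U01 R)[Z]%E = (\int[U01 R]_t Z t)%:E.
Proof.
move=> p1 Zp; rewrite unlock /Rintegral fineK//; apply: integrable_fin_num => //.
exact: (in_Lp_integrable1 _ Zp).
Qed.

Lemma semideviation_semidev p lam (Z : {RV (U01 R) >-> R}) : 1 <= p ->
  in_Lp p%:E Z -> semideviation p lam Z = (semidev p lam Z)%:E.
Proof.
move=> p1 Zp; rewrite (semidevE _ p1 Zp) /semideviation (expectation_Rintegral p1 Zp) EFinD EFinM.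
congr (_ + _ * _)%E.
exact: (in_Lp_Lnorm (in_Lp_pos_dev _ p1 Zp)).
Qed.

Section quantile_transfer.
Context (Z : {RV (U01 R) >-> R}) (p : R) (p1 : 1 <= p) (Zp : in_Lp p%:E Z).

Lemma in_Lp_quantile_fun : in_Lp p%:E (quantile_fun Z).
Proof.
have [mZ iZ] := (in_Lp_integrable Z p1).1 Zp.
apply/in_Lp_integrable => //; split; first exact: measurable_quantile_fun.
apply: (@integrable_quantile_fun _ Z (fun x => `|x| `^ p)) => //.
exact: (measurable_norm_powR _ (@measurable_id _ _ setT)).
Qed.

Lemma Rintegral_quantile : \int[U01 R]_t quantile_fun Z t = \int[U01 R]_t Z t.
Proof. exact: (@Rintegral_quantile_fun _ Z idfun (@measurable_id _ _ setT)). Qed.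

Lemma semidev_quantile lam : semidev p lam (quantile_fun Z) = semidev p lam Z.
Proof.
rewrite /semidev Rintegral_quantile /pos_part; move: (\int[U01 R]_u Z u) => m.
rewrite (@Rintegral_quantile_fun _ Z (fun x => Num.max (x - m) 0 `^ p))//.
apply: (measurableT_comp (measurable_powR p)) => //.
by apply: measurable_maxr => //; apply: measurable_funB.
Qed.

End quantile_transfer.

End Lp_uniform.

(** * Spectral functions attaining the semideviation *)

Section extremal_spectral_function.
Context {R : realType}.
Implicit Types (f g : R -> R) (p lam m : R) (q : \bar R).

Lemma ae_eq0_Rintegral f : (U01 R).-integrable setT (EFin \o f) ->
  (forall t, 0 <= f t) -> \int[U01 R]_t f t = 0 -> {ae U01 R, forall t, f t = 0}.
Proof.
move=> fi f0 if0.
have h := (ae_eq_integral_abs (U01 R) measurableT (measurable_int _ fi)).1.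
have /h : (\int[U01 R]_t `|(EFin \o f) t| = 0)%E.
  under eq_integral => t _ do rewrite /= (ger0_norm (f0 t)).
  rewrite -[LHS]fineK; last exact: (integrable_fin_num _ fi).
  by rewrite -[fine _]/(\int[U01 R]_t f t) if0.
by apply: filterS => t /(_ I) /= [].
Qed.

Lemma ae_eq_Rintegral f g : measurable_fun setT f -> measurable_fun setT g ->
  {ae U01 R, forall t, f t = g t} -> \int[U01 R]_t f t = \int[U01 R]_t g t.
Proof.
move=> mf mg fg; rewrite /Rintegral; congr fine; apply: ae_eq_integral => //.
- exact/measurable_EFinP.
- exact/measurable_EFinP.
- by apply: filterS fg => t /= -> _.
Qed.

Lemma ae0_Rintegral f : measurable_fun setT f ->
  {ae U01 R, forall t, f t = 0} -> \int[U01 R]_t f t = 0.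
Proof.
move=> mf f0; rewrite (ae_eq_Rintegral mf (measurable_cst (0 : R)) f0).
exact: Rintegral_U01_cst.
Qed.

Lemma U01_eq_Rintegral f g : measurable_fun setT f -> measurable_fun setT g ->
  (forall t, 0 < t < 1 -> f t = g t) -> \int[U01 R]_t f t = \int[U01 R]_t g t.
Proof.
move=> mf mg fg; apply: ae_eq_Rintegral => //.
by apply: filterS U01_ae_itvoo => t; exact: fg.
Qed.

Lemma U01_le_Rintegral f g : (U01 R).-integrable setT (EFin \o f) ->
  (U01 R).-integrable setT (EFin \o g) ->
  (forall t, 0 < t < 1 -> f t <= g t) -> \int[U01 R]_t f t <= \int[U01 R]_t g t.
Proof.
move=> fi gi fg.
have mg : measurable_fun setT g by apply/measurable_EFinP; exact: measurable_int gi.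
have mf : measurable_fun setT f by apply/measurable_EFinP; exact: measurable_int fi.
have oo (h : R -> R) : measurable_fun setT h ->
    \int[U01 R]_t h t = \int[U01 R]_(t in `]0, 1[) h t.
  move=> mh; rewrite /Rintegral; congr fine.
  apply: eq_integral_U01 => //; first exact/measurable_EFinP.
  by apply: measurable_funTS; exact/measurable_EFinP.
rewrite (oo _ mf) (oo _ mg); apply: le_Rintegral => //.
- exact: integrableS fi.
- exact: integrableS gi.
Qed.

Lemma spectral_integralE (s : R -> R) : measurable_fun setT (s \_ `[0, 1[) ->
  (\int[lebesgue_measure]_(t in `[0%R, 1%R[) (s t)%:E =
   \int[U01 R]_t ((s \_ `[0%R, 1%R[) t)%:E)%E.
Proof.
move=> ms; have ms' : measurable_fun (`[0, 1[%classic : set R) s by apply/(measurable_restrictT _ _).2.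
rewrite integral_U01_sub//; last 2 first.
- by move=> t /=; rewrite !in_itv/= => /andP[-> /ltW].
- exact/measurable_EFinP.
rewrite integral_mkcond; apply: eq_integral => t _.
by rewrite /= !patchE; case: ifP.
Qed.

Lemma Rintegral_dev f g m : in_Lp 1 f -> \int[U01 R]_t f t = 1 ->
  (U01 R).-integrable setT (EFin \o (fun t => f t * g t)) ->
  \int[U01 R]_t (f t * (g t - m)) = \int[U01 R]_t (f t * g t) - m.
Proof.
move=> f1 if1 ifg; have fi := in_Lp_integrable1 (lexx _) f1.
under eq_Rintegral => t _ do rewrite mulrBr [f t * m]mulrC.
rewrite RintegralB//; last exact: (integrableZl measurableT m fi).
by rewrite RintegralZl// if1 mulr1.
Qed.

(** Since f has integral 1, the left side is E g + lam / ||f||_q times the integral of f (g - E g).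
    As f >= 0, the deviation may be replaced by its positive part before Hoelder's inequality is
    applied. *)
Lemma le_semidev p q lam f g : 1 <= p -> ((p%:E)^-1 + q^-1 = 1)%E -> 0 <= lam ->
  in_Lp q f -> (forall t, 0 <= f t) -> \int[U01 R]_t f t = 1 -> in_Lp p%:E g ->
  (1 - lam / Lp_norm q f) * \int[U01 R]_t g t +
    lam / Lp_norm q f * \int[U01 R]_t (f t * g t) <= semidev p lam g.
Proof.
move=> p1 pq lam0 fq f0 if1 gp.
have q1 := conjugate_ge1 p1 pq.
have N1 := Lp_norm_ge1 p1 pq fq if1.
have N0 : 0 < Lp_norm q f by apply: lt_le_trans N1.
rewrite (semidevE _ p1 gp); set m := \int[U01 R]_t g t.
have f1 : in_Lp 1 f by move: fq; apply: Lfun_subset; rewrite ?lexx ?fin_num_measure.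
have ifg := hoelder_integrable p1 pq fq gp.
have dp := in_Lp_pos_dev m p1 gp.
have := hoelder_Rintegral p1 pq fq dp.
set K := Lp_norm p%:E _ => hK.
have : \int[U01 R]_t (f t * (g t - m)) <= Lp_norm q f * K.
  apply: le_trans hK; apply: le_Rintegral => //.
  - have gm : in_Lp p%:E (fun t => g t - m).
      by apply: in_LpD => //; exact: (@in_Lp_cst _ _ (- m)).
    exact: hoelder_integrable p1 pq fq gm.
  - exact: hoelder_integrable p1 pq fq dp.
  - by move=> t _; apply: ler_wpM2l => //; rewrite /pos_part le_max lexx.
rewrite Rintegral_dev// => h.
have -> : (1 - lam / Lp_norm q f) * m +
    lam / Lp_norm q f * \int[U01 R]_t (f t * g t) =
  m + lam / Lp_norm q f * (\int[U01 R]_t (f t * g t) - m) by ring.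
rewrite lerD2l -mulrA; apply: ler_wpM2l => //.
by rewrite mulrC ler_pdivrMr// mulrC.
Qed.

(* The equality case of Hoelder's inequality against the positive part of g - m;
   for p = 1 any function equal to 1 on [g > m] and 0 on [g < m] will do, and
   the choice [g >= m] makes it right-continuous. *)
Lemma hoelder_extremal p q g m : 1 <= p -> ((p%:E)^-1 + q^-1 = 1)%E ->
  in_Lp p%:E g ->
  (forall s t, 0 < s -> s <= t -> t < 1 -> g s <= g t) ->
  (forall t, 0 < t < 1 -> g x @[x --> t^'+] --> g t) ->
  exists f, [/\ in_Lp q f,
    (forall t, 0 <= f t) /\ (forall t, g t < m -> f t = 0),
    (forall s t, 0 < s -> s <= t -> t < 1 -> f s <= f t) /\
    (forall t, 0 < t < 1 -> f x @[x --> t^'+] --> f t),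
    (forall t, f t * (g t - m) = pos_part (fun s => g s - m) t `^ p)
  & Lp_norm q f * Lp_norm p%:E (pos_part (fun s => g s - m)) <=
    \int[U01 R]_t (pos_part (fun s => g s - m) t `^ p)].
Proof.
move=> p1 pq gp gnd grc; have p0 : 0 < p by apply: lt_le_trans p1.
have q1 := conjugate_ge1 p1 pq; have mg := in_Lp_measurable gp.
have dp := in_Lp_pos_dev m p1 gp.
have mpos : measurable_fun setT (pos_part (fun s => g s - m)).
  exact: in_Lp_measurable dp.
move: (p1); rewrite le_eqVlt => /predU1P[p1'|p1'].
  pose f t : R := if m <= g t then 1 else 0.
  have mf : measurable_fun setT f.
    apply: measurable_fun_ifT => //.
    by apply: measurable_fun_ler => //; exact: measurable_cst.
  have qy : q = +oo%E.
    have /hoelder_conjugateP := pq; move=> /(_ (ltNyr _)).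
    by rewrite eqe gt_eqF// => /(_ isT) ->; rewrite -p1' hoelder_conjugate1.
  exists f; split.
  - apply: (@in_Lp_bounded _ _ _ 1) => // t; rewrite /f; case: ifP; rewrite ?normr1// normr0//.
  - split => t; rewrite /f; first by case: ifP.
    by rewrite ltNge => /negbTE ->.
  - split.
      move=> s t s0 st t1; rewrite /f; case: ifP => [ms|_]; last by case: ifP.
      by rewrite (le_trans ms)// gnd.
    move=> t t01; have /andP[t0 t1] := t01; apply/cvgrPdist_le => e e0.
    rewrite /f; case: ifPn => [mt|].
      near=> x; have tx : t <= x by near: x; exact: nbhs_right_ge.
      have x1 : x < 1 by near: x; exact: nbhs_right_lt.
      by rewrite (le_trans mt) ?subrr ?normr0 ?(ltW e0)//; exact: gnd.
    rewrite -ltNge => tm; have /cvgr_lt/(_ _ tm) := grc t t01.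
    apply: filterS => x xm; rewrite ifF ?subrr ?normr0 ?(ltW e0)//.
    by apply/negbTE; rewrite -ltNge.
  - move=> t; rewrite -p1' powRr1 ?pos_part_ge0// /f /pos_part.
    case: (leP m (g t)) => mt; first by rewrite mul1r (max_idPl _)// subr_ge0.
    by rewrite mul0r (max_idPr _)// subr_le0 ltW.
  - have := Lp_normE p1 dp.
    rewrite -p1' invr1 powRr1; last by apply: Rintegral_ge0 => t _; rewrite powR_ge0.
    move=> ->; under eq_Rintegral do rewrite ger0_norm ?pos_part_ge0//.
    apply: ler_piMl; first by apply: Rintegral_ge0 => t _; rewrite powR_ge0.
    rewrite /Lp_norm qy unlock; case: ifPn => [_|/negP[]]; last exact: U01_setT_gt0.
    rewrite -[leRHS]/(fine 1%E); apply: fine_le => //.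
      rewrite ge0_fin_numE.
        apply: (@le_lt_trans _ _ 1%E); rewrite ?ltry//.
        apply/ess_supP; apply: nearW => t /=; rewrite lee_fin /f.
        by case: ifP; rewrite ?normr1// normr0.
      by apply: ess_sup_gee; [exact: U01_setT_gt0|apply: nearW => t /=].
    apply/ess_supP; apply: nearW => t /=; rewrite lee_fin /f.
    by case: ifP; rewrite ?normr1// normr0.
have p10 : 0 < p - 1 by rewrite subr_gt0.
have qE := conjugate_fin p1' pq.
set r := p / (p - 1) in qE.
have r1 : 1 <= r by move: q1; rewrite qE lee_fin.
have r0 : 0 < r by apply: lt_le_trans r1.
have pr : (p - 1) * r = p by rewrite /r mulrC divfK// gt_eqF.
pose h := pos_part (fun s => g s - m).
pose f t : R := h t `^ (p - 1).
have h0 t : 0 <= h t by exact: pos_part_ge0.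
have frE t : `|f t| `^ r = h t `^ p.
  by rewrite ger0_norm ?powR_ge0// /f -powRrM pr.
have mf : measurable_fun setT f by apply: (measurableT_comp (measurable_powR _)).
have fq : in_Lp q f.
  rewrite qE; apply/in_Lp_integrable => //; split => //.
  have [_] := (in_Lp_integrable h p1).1 dp.
  apply: eq_integrable => // t _ /=.
  by rewrite frE (ger0_norm (h0 t)).
have hnd s t : 0 < s -> s <= t -> t < 1 -> h s <= h t.
  move=> s0 st t1; rewrite /h /pos_part ge_max !le_max lexx !orbT andbT.
  by rewrite lerB// gnd.
exists f; split => //.
- split => t; first exact: powR_ge0.
  move=> gm; rewrite /f /h /pos_part (max_idPr _) ?powR0 ?gt_eqF//.
  by rewrite subr_le0 ltW.
- split=> [s t s0 st t1|t t01].
    by apply: ge0_ler_powR; rewrite ?nnegrE ?h0 ?(ltW p10)//; exact: hnd.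
  apply: (@continuous_cvg _ _ _ _ _ (fun x => g x - m) (fun x : R => Num.max x 0 `^ (p - 1))).
    exact: pos_powR_continuous.
  by apply: cvgB; [exact: grc|exact: cvg_cst].
- move=> t; rewrite -[pos_part _]/h /f.
  have [gm|gm] := lerP (g t - m) 0.
    have -> : h t = 0 by rewrite /h /pos_part (max_idPr _).
    by rewrite !powR0 ?gt_eqF// mul0r.
  have -> : g t - m = h t by rewrite /h /pos_part (max_idPl _)// ltW.
  rewrite -{2}[h t]powRr1// -powRD ?subrK//.
  by rewrite gt_eqF.
- rewrite qE in fq *; rewrite (Lp_normE r1 fq) (Lp_normE p1 dp).
  under eq_Rintegral do rewrite frE.
  under [X in _ * (X `^ _) <= _]eq_Rintegral do rewrite ger0_norm ?pos_part_ge0//.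
  rewrite -[pos_part _]/h.
  have K0 : 0 <= \int[U01 R]_t (h t `^ p) by apply: Rintegral_ge0 => t _; rewrite powR_ge0.
  rewrite -powRD.
    have -> : r^-1 + p^-1 = 1.
      by rewrite /r invf_div -{2}(mul1r p^-1) -mulrDl subrK divff// gt_eqF.
    by rewrite powRr1.
  by apply/implyP; rewrite gt_eqF// addr_gt0// invr_gt0.
Unshelve. all: by end_near. Qed.

Lemma spectral_U01 (s : R -> R) : measurable_fun setT (s \_ `[0, 1[) -> spectral s ->
  (forall t, 0 <= (s \_ `[0, 1[) t) /\ \int[U01 R]_t ((s \_ `[0, 1[) t) = 1.
Proof.
move=> ms [s0 _ _]; rewrite spectral_integralE// /Rintegral => ->; split => // t.
by rewrite patchE; case: ifPn => //; rewrite inE/= in_itv/= => /s0.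
Qed.

(** The constant 1 is the transform of the unit mass at 0. It attains the supremum when there is no
    positive deviation, and it is the constant part of the transform of a mixture. *)
Lemma spectral_one q : (1 <= q)%E ->
  [/\ spectral (cst 1 : R -> R), spectral_Lq q (cst 1 : R -> R) &
    forall f, measurable_fun setT f ->
    \int[U01 R]_t (((cst 1 : R -> R) \_ `[0, 1[) t * f t) = \int[U01 R]_t f t].
Proof.
move=> q1.
have one1 : ((cst 1 : R -> R) \_ `[0, 1[) = \1_(`[0, 1[%classic : set R).
  by apply/funext => t; rewrite patchE indicE; case: ifP.
have oneq : spectral_Lq q (cst 1 : R -> R).
  rewrite /spectral_Lq one1; apply: (@in_Lp_bounded _ _ _ 1) => // t.
  by rewrite indicE; case: (_ \in _); rewrite ?normr1 ?normr0.
have one_int (f : R -> R) : measurable_fun setT f ->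
    \int[U01 R]_t (((cst 1 : R -> R) \_ `[0, 1[) t * f t) = \int[U01 R]_t f t.
  move=> mf; apply: U01_eq_Rintegral => //.
    by apply: measurable_funM => //; exact: in_Lp_measurable oneq.
  move=> t /andP[/ltW t0 t1]; rewrite one1 indicE mem_set ?mul1r//.
  by rewrite /= in_itv/= t0.
split => //; split => //; first by move=> t _; exact: cvg_cst.
rewrite spectral_integralE; last exact: in_Lp_measurable oneq.
have := one_int (cst 1) (measurable_cst _).
rewrite Rintegral_U01_cst; under eq_Rintegral do rewrite mulr1.
move=> h1; rewrite -[RHS]/((1 : R)%:E) -[in RHS]h1 /Rintegral fineK//.
exact: (integrable_fin_num _ (in_Lp_integrable1 q1 oneq)).
Qed.

Lemma semidev_attained p q lam g : 0 <= lam -> 1 <= p -> ((p%:E)^-1 + q^-1 = 1)%E ->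
  in_Lp p%:E g ->
  (forall s t, 0 < s -> s <= t -> t < 1 -> g s <= g t) ->
  (forall t, 0 < t < 1 -> g x @[x --> t^'+] --> g t) ->
  exists s, [/\ spectral s, spectral_Lq q s & semidev p lam g <=
    (1 - lam / spectral_norm q s) * \int[U01 R]_t g t +
    lam / spectral_norm q s * \int[U01 R]_t ((s \_ `[0, 1[) t * g t)].
Proof.
move=> lam0 p1 pq gp gnd grc; have p0 : 0 < p by apply: lt_le_trans p1.
have q1 := conjugate_ge1 p1 pq; have mg := in_Lp_measurable gp.
have gi : (U01 R).-integrable setT (EFin \o g) by exact: (in_Lp_integrable1 _ gp).
have [m mE] : exists m, m = \int[U01 R]_t g t by exists (\int[U01 R]_t g t).
(* Outside ]0, 1[ any value below m does: the extremal function vanishes where g' < m, hence outside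
   ]0, 1[ and in particular at 0, so that its monotonicity extends to [0, 1[. *)
pose g' t := if 0 < t < 1 then g t else m - 1.
have g'E t : 0 < t < 1 -> g' t = g t by rewrite /g' => ->.
have mg' : measurable_fun setT g'.
  apply: measurable_fun_ifT => //.
  by apply: measurable_and; apply: measurable_fun_ltr.
have g'p : in_Lp p%:E g'.
  apply: (@in_Lp_le _ _ _ (fun t => `|g t| + `|m - 1|)) => //.
    apply: in_LpD => //; last exact: in_Lp_cst.
    apply: (in_Lp_le _ _ gp) => //; first exact: measurableT_comp.
    by move=> t; rewrite normr_id.
  move=> t; rewrite [leRHS]ger0_norm ?addr_ge0// /g'.
  by case: ifP => _; rewrite ?lerDl ?lerDr.
pose h := pos_part (fun s => g' s - m).
have hp := in_Lp_pos_dev m p1 g'p; rewrite -/h in hp.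
have mh := in_Lp_measurable hp.
have h0 t : 0 <= h t by exact: pos_part_ge0.
have mhp : measurable_fun setT (fun t => h t `^ p).
  by apply: (measurableT_comp (measurable_powR p)).
have hpi : (U01 R).-integrable setT (EFin \o (fun t => h t `^ p)).
  have [_] := (in_Lp_integrable h p1).1 hp.
  by apply: eq_integrable => // t _ /=; rewrite (ger0_norm (h0 t)).
have [K KE] : exists K, K = \int[U01 R]_t (h t `^ p).
  by exists (\int[U01 R]_t (h t `^ p)).
have K0 : 0 <= K by rewrite KE; apply: Rintegral_ge0 => t _; rewrite powR_ge0.
have sdE : semidev p lam g = m + lam * K `^ p^-1.
  rewrite /semidev -mE KE; suff -> : \int[U01 R]_t
      (pos_part (fun s => g s - m) t `^ p) = \int[U01 R]_t (h t `^ p) by [].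
  apply: (U01_eq_Rintegral _ mhp).
    apply: (measurableT_comp (measurable_powR p)) => //.
    exact: in_Lp_measurable (in_Lp_pos_dev m p1 gp).
  by move=> t t01; rewrite /h /pos_part g'E.
have hE : {ae U01 R, forall t, h t = 0} -> K = 0.
  move=> hae; rewrite KE; apply: (ae0_Rintegral mhp); apply: filterS hae => t ->.
  exact: powR0 (lt0r_neq0 p0).
have nE : Lp_norm p%:E h = K `^ p^-1.
  rewrite (Lp_normE p1 hp) KE.
  by under eq_Rintegral => t _ do rewrite (ger0_norm (h0 t)).
(* Without positive deviation the extremal function may vanish and could not be normalized; the
   constant 1 then already gives E g. *)
have [K00|/eqP K00] := pselect (K = 0).
  have [ss sq sg] := spectral_one q1.
  exists (cst 1); split; [exact: ss|exact: sq|].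
  rewrite sdE K00 (powR0 (invr_neq0 (lt0r_neq0 p0))) mulr0 addr0 (sg _ mg) -mE.
  by rewrite -mulrDl subrK mul1r.
have Kp : 0 < K by rewrite lt_neqAle eq_sym K00.
have g'nd s t : 0 < s -> s <= t -> t < 1 -> g' s <= g' t.
  move=> s0 st t1; rewrite !g'E ?s0 ?t1 ?(le_lt_trans st) ?(lt_le_trans s0)//.
  exact: gnd.
have g'rc t : 0 < t < 1 -> g' x @[x --> t^'+] --> g' t.
  move=> t01; rewrite g'E//; apply: cvg_trans (grc t t01).
  apply: near_eq_cvg; have /andP[t0 t1] := t01; near=> x.
  rewrite g'E//; apply/andP; split; near: x; last exact: nbhs_right_lt.
  by near=> x; apply: (lt_trans t0); near: x; exact: nbhs_right_gt.
have [f [fq [f0 fm] [fnd frc] fE fN]] := @hoelder_extremal p q g' m p1 pq g'p g'nd g'rc.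
rewrite -/h -KE in fE fN.
have fi := in_Lp_integrable1 q1 fq; have mf := in_Lp_measurable fq.
have fout t : ~ (0 < t < 1) -> f t = 0.
  by move=> /negP/negbTE h01; apply: fm; rewrite /g' h01 ltrBlDr ltrDl.
have [C CE] : exists C, C = \int[U01 R]_t f t by exists (\int[U01 R]_t f t).
have C0 : 0 < C.
  have : 0 <= C by rewrite CE; exact: Rintegral_ge0.
  rewrite le_eqVlt => /predU1P[C00|//].
  have f00 := ae_eq0_Rintegral fi f0 (esym (etrans C00 CE)).
  suff K00' : K = 0 by rewrite K00' ltxx in Kp.
  rewrite KE.
  apply: (ae0_Rintegral mhp).
  by apply: filterS f00 => t ft0; rewrite -fE ft0 mul0r.
(* If g >= m on all of ]0, 1[, then g = m almost everywhere and K = 0. The extremal function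
   vanishes on ]0, d[, which makes it right-continuous at 0. *)
have [d [/andP[d0 d1] gd]] : exists d, 0 < d < 1 /\ g d < m.
  apply: contrapT => hn.
  have gm t : 0 < t < 1 -> m <= g t.
    by move=> t01; rewrite leNgt; apply/negP => gtm; apply: hn; exists t.
  have : \int[U01 R]_t h t = 0.
    transitivity (\int[U01 R]_t (g t - m)).
      apply: U01_eq_Rintegral => //; first exact: measurable_funB.
      by move=> t t01; rewrite /h /pos_part g'E// (max_idPl _)// subr_ge0 gm.
    rewrite RintegralB//; last exact: finite_measure_integrable_cst.
    by rewrite Rintegral_U01_cst -mE subrr.
  move=> /(ae_eq0_Rintegral (in_Lp_integrable1 _ hp) h0) h00.
  by have := Kp; rewrite (hE (h00 _)) ?ltxx// lee_fin.
pose s t := C^-1 * f t.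
have sE : s \_ `[0, 1[ = s.
  apply/funext => t; rewrite patchE; case: ifPn => // t01.
  rewrite /s fout ?mulr0// => /andP[/ltW t0 t1]; move: t01.
  by rewrite notin_setE/= in_itv/= t0 t1.
have sq : in_Lp q s by exact: in_LpZ.
have s1 : \int[U01 R]_t s t = 1 by rewrite RintegralZl// -CE mulVf// gt_eqF.
exists s; split.
- split.
  + by move=> t _; rewrite mulr_ge0// invr_ge0 ltW.
  + move=> u t u0 ut t1; apply: ler_wpM2l; first by rewrite invr_ge0 ltW.
    move: u0; rewrite le_eqVlt => /predU1P[<-|u0]; last exact: fnd.
    by rewrite [f 0]fout// ltxx.
  + move=> t /andP[t0 t1]; apply: cvgM; first exact: cvg_cst.
    move: t0; rewrite le_eqVlt => /predU1P[<-|t0]; last by apply: frc; rewrite t0.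
    rewrite [f 0]fout ?ltxx//; apply/cvgrPdist_le => e e0; near=> x.
    rewrite fm ?subrr ?normr0 ?(ltW e0)//.
    have x0 : 0 < x by near: x; exact: nbhs_right_gt.
    have xd : x < d by near: x; exact: nbhs_right_lt.
    rewrite g'E ?x0 ?(lt_trans xd)//; apply: le_lt_trans gd.
    by apply: gnd => //; exact: ltW.
  + rewrite spectral_integralE sE; last exact: in_Lp_measurable sq.
    move: s1; rewrite /Rintegral => <-; rewrite fineK//.
    exact: (integrable_fin_num _ (in_Lp_integrable1 q1 sq)).
- by rewrite /spectral_Lq sE.
- rewrite /spectral_norm sE -[fine _]/(Lp_norm q s).
  have N1 := Lp_norm_ge1 p1 pq sq s1.
  have N0 : 0 < Lp_norm q s by apply: lt_le_trans N1.
  have sgi := hoelder_integrable p1 pq sq gp.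
  have sg : \int[U01 R]_t (s t * g t) - m = C^-1 * K.
    rewrite -(Rintegral_dev m _ s1 sgi); last first.
      by move: sq; apply: Lfun_subset; rewrite ?lexx ?fin_num_measure.
    rewrite KE -RintegralZl//; apply: U01_eq_Rintegral.
    - apply: measurable_funM; first exact: in_Lp_measurable sq.
      exact: measurable_funB.
    - exact: measurable_funM.
    - by move=> t t01; rewrite -fE /s g'E// mulrA.
  have Ns : Lp_norm q s = C^-1 * Lp_norm q f.
    have qf1 : (1 <= q)%E by [].
    have := @LnormZ _ _ _ (U01 R) q q1 (Lfun_Sub q1 fq) C^-1.
    rewrite /Lp_norm => NZ; rewrite -[EFin \o s]/(EFin \o (C^-1 *: f)).
    move: NZ; rewrite Lfun_valP => ->.
    by rewrite fineM// ?in_Lp_Lnorm//= gtr0_norm// invr_gt0.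
  rewrite sdE -mE -nE.
  have -> : (1 - lam / Lp_norm q s) * m + lam / Lp_norm q s *
      \int[U01 R]_t (s t * g t) =
    m + lam * ((\int[U01 R]_t (s t * g t) - m) / Lp_norm q s).
    by field; rewrite gt_eqF.
  rewrite lerD2l sg; apply: ler_wpM2l => //.
  by rewrite ler_pdivlMr// Ns mulrCA ler_wpM2l ?invr_ge0 ?(ltW C0)// mulrC.
Unshelve. all: by end_near. Qed.

Lemma spectral_combination p q lam (s : R -> R) (Z : {RV (U01 R) >-> R}) :
  1 <= p -> ((p%:E)^-1 + q^-1 = 1)%E -> in_Lp p%:E Z -> spectral_Lq q s ->
  ((1 - lam / spectral_norm q s)%:E * 'E_(U01 R)[Z]
    + (lam / spectral_norm q s)%:E * rho_spectral s Z)%E =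
  ((1 - lam / spectral_norm q s) * \int[U01 R]_t quantile_fun Z t
    + lam / spectral_norm q s *
      \int[U01 R]_t ((s \_ `[0, 1[) t * quantile_fun Z t))%:E.
Proof.
move=> p1 pq Zp sq; have Gp := in_Lp_quantile_fun p1 Zp.
rewrite (expectation_Rintegral p1 Zp) -Rintegral_quantile.
rewrite (@rho_spectral_Rintegral _ _ _ (quantile_fun Z)); last 3 first.
- exact: in_Lp_measurable sq.
- exact: measurable_quantile_fun.
- exact: quantile_funE.
have -> : (\int[U01 R]_t ((s \_ `[0%R, 1%R[) t * quantile_fun Z t)%:E =
    (\int[U01 R]_t ((s \_ `[0, 1[) t * quantile_fun Z t))%:E)%E.
  rewrite /Rintegral fineK//.
  exact: (integrable_fin_num _ (hoelder_integrable p1 pq sq Gp)).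
by rewrite -!EFinM -EFinD.
Qed.

Lemma semideviation_spectral p q lam (Z : {RV (U01 R) >-> R}) :
  1 <= p -> ((p%:E)^-1 + q^-1 = 1)%E -> 0 <= lam -> in_Lp p%:E Z ->
  semideviation p lam Z = ereal_sup
    [set ((1 - lam / spectral_norm q sigma)%:E * 'E_(U01 R)[Z]
          + (lam / spectral_norm q sigma)%:E * rho_spectral sigma Z)%E
      | sigma in [set sigma : R -> R | spectral sigma /\ spectral_Lq q sigma]].
Proof.
move=> p1 pq lam0 Zp; have Gp := in_Lp_quantile_fun p1 Zp.
rewrite (semideviation_semidev _ p1 Zp) -semidev_quantile.
apply/eqP; rewrite eq_le; apply/andP; split.
  have [s [ss sq h]] := semidev_attained lam0 p1 pq Gp
    (@quantile_fun_le _ Z) (@quantile_fun_rc _ Z).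
  apply: (@le_trans _ _ ((1 - lam / spectral_norm q s)%:E * 'E_(U01 R)[Z]
    + (lam / spectral_norm q s)%:E * rho_spectral s Z)%E).
    by rewrite (spectral_combination lam p1 pq Zp sq) lee_fin.
  by apply: ereal_sup_ubound; exists s.
apply: ge_ereal_sup => _ [s [ss sq] <-].
rewrite (spectral_combination lam p1 pq Zp sq) lee_fin.
have [s0 s1] := spectral_U01 (in_Lp_measurable sq) ss.
exact: le_semidev.
Qed.

End extremal_spectral_function.

(** * The transform T and tail averages *)

(** [mnormalize] leaves a measure of mass 1 unchanged and equips it as a probability; P0 is its
    fallback for mass 0 or +oo. *)
Lemma exists_probability d (T : measurableType d) (R : realType)
    (mu : {measure set T -> \bar R}) (P0 : probability T R) :
  mu setT = 1%E -> exists P : probability T R, forall A, P A = mu A.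
Proof.
move=> mu1; exists (mnormalize mu P0) => A.
transitivity (mnormalize mu P0 A) => //.
rewrite [mnormalize _ _](_ : _ = fun U => (mu U * (fine (mu setT))^-1%:E)%E).
  by rewrite mu1 invr1 mule1.
by rewrite /mnormalize mu1 onee_eq0.
Qed.

Section tail_kernel.
Context {R : realType}.
Implicit Types (a t : R) (g : R -> R) (mu : frakP R).

(* The kernel of T: T mu = \int tail_kernel a _ dmu(a) on [0, 1[, and
   AVaR_a(Z) = \int tail_kernel a t F_Z^-1(t) dt. The power -1 stands for the
   inverse, which it equals on nonnegative reals. *)
Definition tail_kernel (a t : R) : R :=
  if [&& 0 <= a, a <= t & t < 1] then (1 - a) `^ (-1) else 0.

Lemma tail_kernel_ge0 a t : 0 <= tail_kernel a t.
Proof. by rewrite /tail_kernel; case: ifP => // _; exact: powR_ge0. Qed.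

Lemma measurable_tail_kernel : measurable_fun setT
  (fun z : measurableTypeR R * measurableTypeR R => tail_kernel z.1 z.2).
Proof.
have m1 : measurable_fun setT
    (fst : measurableTypeR R * measurableTypeR R -> R) by exact: measurable_fst.
have m2 : measurable_fun setT
    (snd : measurableTypeR R * measurableTypeR R -> R) by exact: measurable_snd.
apply: measurable_fun_ifT => //.
  apply: measurable_and; first by apply: measurable_fun_ler => //.
  by apply: measurable_and; [exact: measurable_fun_ler|apply: measurable_fun_ltr].
apply: (measurableT_comp (measurable_powR (-1))).
by apply: measurable_funB.
Qed.

Lemma measure_of_itv mu : measure_of mu `[0, 1[%classic = 1%E.
Proof. exact: (set_valP (mu : prob01 R)). Qed.

Lemma measure_of_ae mu : {ae measure_of mu, forall a, 0 <= a < 1}.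
Proof.
exists (~` `[0, 1[%classic); split.
- exact: measurableC.
- by rewrite probability_setC// measure_of_itv subee.
- by move=> t /= h; rewrite in_itv.
Qed.

Lemma integrable_inv_onem mu t : t < 1 ->
  (measure_of mu).-integrable `[0, t] (EFin \o (fun a => (1 - a)^-1)).
Proof.
move=> t1; have mA : measurable (`[0, t]%classic : set (measurableTypeR R)).
  exact: measurable_itv.
apply: measurable_bounded_integrable => //.
- by apply: le_lt_trans (ltry 1); exact: probability_le1.
- apply: (eq_measurable_fun (fun a => (1 - a) `^ (-1))).
    move=> a; rewrite inE/= in_itv/= => /andP[a0 at'].
    by rewrite powR_inv1// subr_ge0 (le_trans at')// ltW.
  apply: measurable_funTS; apply: (measurableT_comp (measurable_powR (-1))).
  by apply: measurable_funB.
- exists (1 - t)^-1; split; first by rewrite num_real.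
  move=> x tx a /=; rewrite in_itv/= => /andP[a0 at'].
  have t10 : 0 < 1 - t by rewrite subr_gt0.
  rewrite ger0_norm ?invr_ge0 ?subr_ge0 ?(le_trans at' (ltW t1))//.
  apply: le_trans (ltW tx); rewrite lef_pV2 ?posrE// ?lerB//.
  by rewrite subr_gt0 (le_lt_trans at').
Qed.

Lemma bbT_kernel mu t :
  (\int[measure_of mu]_a (tail_kernel a t)%:E = ((bbT mu \_ `[0, 1[) t)%:E)%E.
Proof.
rewrite patchE; case: ifPn => [|t01]; last first.
  apply: integral0_eq => a _; rewrite /tail_kernel ifF//.
  apply/negP => /and3P[a0 at' t1]; move: t01; apply/negP; rewrite negbK inE/=.
  by rewrite in_itv/= (le_trans a0).
rewrite inE/= in_itv/= => /andP[t0 t1].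
rewrite /bbT /Rintegral fineK; last first.
  apply: integrable_fin_num; last exact: integrable_inv_onem.
  exact: measurable_itv.
rewrite [RHS]integral_mkcond; apply: eq_integral => a _.
rewrite patchE /tail_kernel mem_setE in_itv/= t1 andbT.
by case: ifP => // /andP[a0 at']; rewrite powR_inv1// subr_ge0 (le_trans at')// ltW.
Qed.

Lemma bbT_restr_ge0 mu t : 0 <= (bbT mu \_ `[0, 1[) t.
Proof.
rewrite -lee_fin -bbT_kernel; apply: integral_ge0 => a _.
by rewrite lee_fin tail_kernel_ge0.
Qed.

Lemma bbT_ge0 mu t : 0 <= t < 1 -> 0 <= bbT mu t.
Proof.
move=> t01; have := bbT_restr_ge0 mu t; by rewrite patchE mem_set.
Qed.

Lemma measurable_bbT mu : measurable_fun setT (bbT mu \_ `[0, 1[).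
Proof.
have mk : measurable_fun setT
    (fun z : measurableTypeR R * measurableTypeR R => (tail_kernel z.1 z.2)%:E).
  by apply/measurable_EFinP; exact: measurable_tail_kernel.
have := @measurable_fun_fubini_tonelli_G _ _ _ _ _ (measure_of mu) _ mk _.
move=> h; apply/measurable_EFinP.
apply: (eq_measurable_fun (fun t => \int[measure_of mu]_a (tail_kernel a t)%:E)%E).
  by move=> t _; rewrite bbT_kernel.
by apply: h => z; rewrite lee_fin tail_kernel_ge0.
Qed.

Lemma integral_tail_kernel a g : (U01 R).-integrable setT (EFin \o g) ->
  (\int[U01 R]_t (tail_kernel a t * g t)%:E =
   (((tail_average g) \_ `[0, 1[) a)%:E)%E.
Proof.
move=> gi; have mg : measurable_fun setT (EFin \o g) by exact: measurable_int gi.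
rewrite patchE; case: ifPn => [|a01]; last first.
  apply: integral0_eq => t _; rewrite /tail_kernel ifF ?mul0r//.
  apply/negP => /and3P[a0 at' t1]; move: a01; apply/negP; rewrite negbK inE/=.
  by rewrite in_itv/= a0 (le_lt_trans at').
rewrite inE/= in_itv/= => /andP[a0 a1].
transitivity (\int[U01 R]_(t in `[a, 1%R]) (((1 - a)^-1)%:E * (g t)%:E))%E.
  rewrite [RHS]integral_mkcond; apply: eq_integral_U01 => //.
  - apply/measurable_EFinP.
    apply: measurable_funM; last exact/measurable_EFinP.
    by have := measurable_fun_pair2 a measurable_tail_kernel.
  - apply/(measurable_restrictT _ _).1; first exact: measurable_itv.
    by apply: measurable_funeM; exact: measurable_funTS mg.
  - move=> t /andP[t0 t1] _; rewrite patchE /tail_kernel a0 t1 andbT/=.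
    rewrite mem_setE in_itv/= (ltW t1) andbT; case: ifP => at'; last by rewrite mul0r.
    by rewrite powR_inv1 ?subr_ge0 ?ltW.
rewrite integralZl//; last first.
  by apply: integrableS gi => //; exact: measurable_itv.
rewrite /tail_average EFinM /Rintegral fineK//.
apply: integrable_fin_num; first exact: measurable_itv.
by apply: integrableS gi => //; exact: measurable_itv.
Qed.

(** For a in [0, 1[ the kernel integrates in t to (1 - a)^-1 (1 - a) = 1, and mu has mass 1 on [0,
    1[. *)
Lemma tonelli_tail_average mu : (\int[U01 R]_t ((bbT mu \_ `[0, 1[) t)%:E = 1)%E.
Proof.
under eq_integral do rewrite -bbT_kernel.
rewrite -(@fubini_tonelli _ _ _ _ _ (measure_of mu) (U01 R)
  (fun z => (tail_kernel z.1 z.2)%:E)); last 2 first.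
- by apply/measurable_EFinP; exact: measurable_tail_kernel.
- by move=> z; rewrite lee_fin tail_kernel_ge0.
have one_i : (U01 R).-integrable setT (EFin \o (cst 1 : R -> R)).
  exact: finite_measure_integrable_cst.
transitivity (\int[measure_of mu]_a (\1_(`[0, 1[%classic : set R) a)%:E)%E.
  apply: eq_integral => a _.
  transitivity (\int[U01 R]_t (tail_kernel a t * (cst 1 : R -> R) t)%:E)%E.
    by apply: eq_integral => t _; rewrite /= mulr1.
  rewrite (integral_tail_kernel _ one_i) patchE indicE; case: ifPn => //.
  rewrite inE/= in_itv/= => /andP[a0 a1]; congr EFin.
  rewrite /tail_average Rintegral_cst//.
  rewrite [X in fine X](_ : _ = (1 - a)%:E)/= ?mul1r ?mulVf ?subr_eq0 ?gt_eqF//.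
  transitivity (lebesgue_measure (`[a, 1%R]%classic : set R)).
    apply: U01_itv; move=> x /=; rewrite !in_itv/= => /andP[ax ->].
    by rewrite (le_trans a0).
  by rewrite lebesgue_measure_itv/= lte_fin a1.
rewrite integral_indic//.
by rewrite setIT; exact: measure_of_itv.
Qed.

(** With g a quantile function this is the identity between the mixture of AV@R by mu and rho_sigma
    for sigma = T mu. Fubini applies because the kernel times |g| integrates in a to (T mu) |g|. *)
Lemma fubini_tail_average mu g : (U01 R).-integrable setT (EFin \o g) ->
  (U01 R).-integrable setT (EFin \o (fun t => (bbT mu \_ `[0, 1[) t * g t)) ->
  (measure_of mu).-integrable setT (EFin \o (tail_average g \_ `[0, 1[)) /\
  (\int[measure_of mu]_(a in `[0%R, 1%R[) (tail_average g a)%:E =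
   (\int[U01 R]_t ((bbT mu \_ `[0, 1[) t * g t))%:E)%E.
Proof.
move=> gi Tgi.
have mg : measurable_fun setT g by apply/measurable_EFinP; exact: measurable_int gi.
pose f (z : measurableTypeR R * measurableTypeR R) := (tail_kernel z.1 z.2 * g z.2)%:E.
have mf : measurable_fun setT f.
  apply/measurable_EFinP; apply: measurable_funM; first exact: measurable_tail_kernel.
  by apply: (measurableT_comp mg); exact: measurable_snd.
have kG t (x : R) : (\int[measure_of mu]_a (tail_kernel a t * x)%:E =
    ((bbT mu \_ `[0, 1[) t * x)%:E)%E.
  have mk : measurable_fun setT
      (fun a : measurableTypeR R => (tail_kernel a t)%:E).
    apply/measurable_EFinP.
    by have := measurable_fun_pair1 t measurable_tail_kernel.
  under eq_integral do rewrite EFinM.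
  rewrite integralZr//; first by rewrite bbT_kernel.
  apply/integrableP; split => //.
  under eq_integral do rewrite gee0_abs ?lee_fin ?tail_kernel_ge0//.
  by rewrite bbT_kernel ltry.
have fi : (measure_of mu \x U01 R)%E.-integrable setT f.
  apply/(integrable21ltyP _ _ mf).
  have /integrableP[_] := Tgi; apply: le_lt_trans.
  apply: ge0_le_integral => //.
  - by move=> t _; apply: integral_ge0.
  - apply: (@measurable_fun_fubini_tonelli_G _ _ _ _ _ (measure_of mu) (abse \o f)) => //.
      exact: measurableT_comp.
    by move=> z; exact: abse_ge0.
  - by apply: measurableT_comp => //; exact: measurable_int Tgi.
  - move=> t _; rewrite /f /=.
    under eq_integral do rewrite normrM (ger0_norm (tail_kernel_ge0 _ _)).
    by rewrite kG lee_fin normrM (ger0_norm (bbT_restr_ge0 _ _)).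
have tE a : (\int[U01 R]_t f (a, t) = ((tail_average g \_ `[0, 1[) a)%:E)%E.
  by rewrite /f /= integral_tail_kernel.
split.
  have := integrable_fubini_F fi; apply: eq_integrable => // a _.
  by rewrite /fubini_F tE.
rewrite integral_mkcond.
transitivity (\int[measure_of mu]_a \int[U01 R]_t f (a, t))%E.
  by apply: eq_integral => a _; rewrite tE !patchE; case: ifP.
rewrite (Fubini fi) /Rintegral fineK; last first.
  by apply: integrable_fin_num => //.
by apply: eq_integral => t _; rewrite /f /= kG.
Qed.

Lemma bbT_nondecreasing mu s t : 0 <= s -> s <= t -> t < 1 ->
  bbT mu s <= bbT mu t.
Proof.
move=> s0 st t1; have t0 := le_trans s0 st; have s1 := le_lt_trans st t1.
have sE := bbT_kernel mu s; have tE := bbT_kernel mu t.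
rewrite !patchE !mem_setE !in_itv/= s0 s1 t0 t1/= in sE tE.
rewrite -lee_fin -sE -tE; apply: ge0_le_integral => //.
- by move=> a _; rewrite lee_fin tail_kernel_ge0.
- by apply/measurable_EFinP; have := measurable_fun_pair1 s measurable_tail_kernel.
- by apply/measurable_EFinP; have := measurable_fun_pair1 t measurable_tail_kernel.
- move=> a _; rewrite lee_fin /tail_kernel s1 t1 !andbT; case: ifP => [/andP[a0 as']|_].
    by rewrite a0 (le_trans as' st).
  by case: ifP => // _; exact: powR_ge0.
Qed.

(** The increment of T mu from t to x is at most mu(]t, x]) / (1 - u) for x below the midpoint u of
    t and 1, and distribution functions are right-continuous. *)
Lemma bbT_right_continuous mu t : 0 <= t < 1 -> bbT mu x @[x --> t^'+] --> bbT mu t.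
Proof.
move=> /andP[t0 t1]; set m := measure_of mu.
pose idR : {RV m >-> R} := @mfun_Sub _ _ (measurableTypeR R) R idfun
  (mem_set (@measurable_id _ _ setT)).
have cdfE x : cdf idR x = m `]-oo, x]%classic by [].
have rc := @cdf_right_continuous _ _ _ _ idR t.
have fin x : cdf idR x = (fine (cdf idR x))%:E by rewrite fineK// fin_num_measure.
have /fine_cvgP[_ {}rc] : cdf idR x @[x --> t^'+] --> (fine (cdf idR t))%:E.
  by rewrite -fin.
pose u : R := (t + 1) / 2.
have u1 : u < 1 by rewrite /u; lra.
have tu : t < u by rewrite /u; lra.
apply/cvgrPdist_le => e e0.
have eu : 0 < e * (1 - u) by rewrite mulr_gt0// subr_gt0.
move/cvgrPdist_le/(_ _ eu) : rc => rc.
near=> x.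
have tx : t < x by near: x; exact: nbhs_right_gt.
have xu : x < u by near: x; exact: nbhs_right_lt.
have x1 := lt_trans xu u1.
have : `|fine (cdf idR t) - (fine \o cdf idR) x| <= e * (1 - u) by near: x; exact: rc.
rewrite /= ler0_norm; last first.
  rewrite subr_le0 fine_le ?fin_num_measure//.
  by apply: cdf_nondecreasing; exact: ltW.
rewrite opprB => h.
rewrite ler0_norm ?subr_le0 ?bbT_nondecreasing ?(ltW tx)// opprB.
have mA (A : interval R) : measurable ([set` A] : set (measurableTypeR R)).
  exact: measurable_itv.
have itvU : `[0, x]%classic = `[0, t] `|` `]t, x] :> set R.
  by rewrite -itv_bndbnd_setU// bnd_simp// ltW.
have xi := integrable_inv_onem mu x1.
have -> : bbT mu x - bbT mu t = \int[m]_(a in `]t, x]) (1 - a)^-1.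
  rewrite /bbT itvU Rintegral_setU -?itvU//; first by rewrite addrC addKr.
  apply/disj_set2P; rewrite -subset0 => a [] /=; rewrite !in_itv/= => /andP[_ at'].
  by rewrite ltNge at'.
have ti : m.-integrable `]t, x] (EFin \o (fun a => (1 - a)^-1)).
  by apply: integrableS xi => // a /=; rewrite !in_itv/= => /andP[/ltW/(le_trans t0) -> ->].
have mtx : m `]t, x]%classic = (fine (cdf idR x) - fine (cdf idR t))%:E.
  rewrite EFinB -!fin !cdfE.
  have -> : `]t, x]%classic = `]-oo, x] `\` `]-oo, t] :> set R.
    by rewrite -[RHS]setCK setCD setCitvl setUC -[LHS]setCK setCitv.
  rewrite measureD//; last by rewrite -ge0_fin_numE// fin_num_measure.
  by rewrite setIidr//; apply: subset_itvl; rewrite bnd_simp ltW.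
apply: (@le_trans _ _ (\int[m]_(a in `]t, x]) (1 - u)^-1)).
  apply: le_Rintegral => //.
    exact: finite_measure_integrable_cst.
  move=> a /=; rewrite in_itv/= => /andP[ta ax].
  rewrite lef_pV2 ?posrE ?subr_gt0// ?lerB// ?(le_lt_trans ax)//.
  by rewrite (le_trans ax)// ltW.
rewrite Rintegral_cst//.
have -> : fine (m `]t, x]%classic) = fine (cdf idR x) - fine (cdf idR t) by rewrite mtx.
by rewrite mulrC ler_pdivrMr ?subr_gt0.
Unshelve. all: by end_near. Qed.

Lemma bbT_spectral mu : spectral (bbT mu).
Proof.
split.
- exact: bbT_ge0.
- exact: bbT_nondecreasing.
- exact: bbT_right_continuous.
- by rewrite spectral_integralE ?tonelli_tail_average//; exact: measurable_bbT.
Qed.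

End tail_kernel.

Lemma ge0_integral_mrestr d (T : measurableType d) (R : realType)
    (mu : {measure set T -> \bar R}) (D : set T) (mD : measurable D)
    (f : T -> \bar R) : measurable_fun setT f -> (forall x, 0 <= f x)%E ->
  (\int[mrestr mu mD]_x f x = \int[mu]_(x in D) f x)%E.
Proof.
move=> mf f0; rewrite -(setUv D) ge0_integral_setU//; last 3 first.
- exact: measurableC.
- by rewrite setUv.
- by apply/disj_set2P; rewrite setICr.
rewrite [X in (_ + X)%E]null_set_integral ?adde0//.
- apply: eq_measure_integral => A mA AD.
  by rewrite -[LHS]/(mu (A `&` D)) setIidl.
- exact: measurableC.
- exact: measurable_funTS.
- by rewrite -[LHS]/(mu (~` D `&` D)) setICl measure0.
Qed.

Lemma spectral_norm_ge1 (R : realType) (p : R) q (s : R -> R) : 1 <= p ->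
  ((p%:E)^-1 + q^-1 = 1)%E -> spectral s -> spectral_Lq q s ->
  1 <= spectral_norm q s.
Proof.
move=> p1 pq ss sq; apply: (Lp_norm_ge1 p1 pq sq).
by have [] := spectral_U01 (in_Lp_measurable sq) ss.
Qed.

Lemma U01_eq_integrable (R : realType) (f g : R -> R) : measurable_fun setT f ->
  (forall t, 0 < t < 1 -> f t = g t) -> (U01 R).-integrable setT (EFin \o g) ->
  (U01 R).-integrable setT (EFin \o f).
Proof.
move=> mf fg gi; have mg := measurable_int _ gi.
apply/integrableP; split; first exact/measurable_EFinP.
have /integrableP[_] := gi; apply: le_lt_trans; rewrite le_eqVlt; apply/orP; left.
apply/eqP; apply: eq_integral_U01 => //.
- by apply: measurableT_comp => //; exact/measurable_EFinP.
- by apply: measurableT_comp.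
- by move=> t /fg /= ->.
Qed.

(** * Mixtures with the unit mass at 0 *)

Section mixture.
Context {R : realType}.
Implicit Types (c t : R) (mu nu : frakP R).

Definition frakP_of (m : probability (measurableTypeR R) R)
  (m01 : m `[0, 1[%classic = 1%E) : frakP R :=
  (exist _ m (mem_set m01) : set_type (@prob01 R)).

Definition mixture_with_dirac0 c (mu nu : frakP R) :=
  forall A : set (measurableTypeR R), measurable A ->
    measure_of nu A = ((1 - c)%:E * \d_(0%R : R) A + c%:E * measure_of mu A)%E.

Lemma exists_mixture c mu : 0 <= c -> c <= 1 ->
  exists nu, mixture_with_dirac0 c mu nu.
Proof.
move=> c0 c1; have c1' : 0 <= 1 - c by rewrite subr_ge0.
pose d0 : {measure set (measurableTypeR R) -> \bar R} := dirac (0 : measurableTypeR R).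
pose mm := measure_add (mscale (NngNum c1') d0) (mscale (NngNum c0) (measure_of mu)).
have mmE A : mm A = ((1 - c)%:E * \d_(0%R : R) A + c%:E * measure_of mu A)%E.
  by rewrite /mm measure_addE.
have mm1 : mm setT = 1%E.
  rewrite mmE diracT probability_setT !mule1 -EFinD.
  by rewrite subrK.
have [P PE] := exists_probability (dirac (0 : measurableTypeR R)) mm1.
have P01 : P `[0, 1[%classic = 1%E.
  rewrite PE; apply: etrans (mmE _) _.
  rewrite measure_of_itv diracE mem_set ?mule1 -?EFinD ?subrK//.
  by rewrite /= in_itv/= lexx ltr01.
exists (frakP_of P01) => A mA.
by rewrite -[LHS]/(P A) PE; exact: mmE.
Qed.

(** T is linear, and the kernel at a = 0 equals 1 on [0, 1[. *)
Lemma bbT_mixture c mu nu : 0 <= c -> c <= 1 -> mixture_with_dirac0 c mu nu ->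
  forall t, 0 <= t < 1 -> bbT nu t = (1 - c) + c * bbT mu t.
Proof.
move=> c0 c1 numu t /andP[t0 t1]; have c1' : 0 <= 1 - c by rewrite subr_ge0.
pose d0 : {measure set (measurableTypeR R) -> \bar R} := dirac (0 : measurableTypeR R).
have mk : measurable_fun setT (fun a : measurableTypeR R => (tail_kernel a t)%:E).
  by apply/measurable_EFinP; have := measurable_fun_pair1 t (@measurable_tail_kernel R).
have k0 (a : measurableTypeR R) : setT a -> (0 <= (tail_kernel a t)%:E)%E.
  by move=> _; rewrite lee_fin tail_kernel_ge0.
have E nu' : (\int[measure_of nu']_a (tail_kernel a t)%:E = (bbT nu' t)%:E)%E.
  by rewrite bbT_kernel patchE mem_set//= in_itv/= t0.
apply: EFin_inj; rewrite -E.
pose mm := measure_add (mscale (NngNum c1') d0) (mscale (NngNum c0) (measure_of mu)).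
have mmE A : mm A = ((1 - c)%:E * \d_(0%R : R) A + c%:E * measure_of mu A)%E.
  by rewrite /mm measure_addE.
transitivity (\int[mm]_a (tail_kernel a t)%:E)%E.
  apply: eq_measure_integral => A mA _.
  exact: (etrans (numu _ mA) (esym (mmE A))).
rewrite /mm ge0_integral_measure_add// !ge0_integral_mscale// E [RHS]EFinD EFinM.
congr (_ + _)%E; rewrite integral_dirac// diracT mul1e /tail_kernel lexx t0 t1/=.
by rewrite subr0 powR1 mule1.
Qed.

End mixture.

(** * Surjectivity of the transform T *)

Section surjectivity.
Context {R : realType}.
Context (s : R -> R) (s_spectral : spectral s)
  (s_meas : measurable_fun setT (s \_ `[0, 1[)).

(** The point 1 keeps the set nonempty when u exceeds all values of s, and the infimum is then 1. *)
Let levels (u : R) : set R := [set t | t = 1 \/ (0 <= t < 1 /\ u < s t)].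

Let levels_lb u : lbound (levels u) 0.
Proof. by move=> x [->|[/andP[]]]. Qed.

Let levels_inf u : has_inf (levels u).
Proof. by split; [exists 1; left|exists 0; exact: levels_lb]. Qed.

(* The measure with transform s is the law of inv_s u for (t, u) distributed
   uniformly on the region 0 <= u < s t, which has area 1. *)
Let inv_s (u : R) : R := inf (levels u).

Let inv_s_ge0 u : 0 <= inv_s u.
Proof. by apply: lb_le_inf; [exists 1; left|exact: levels_lb]. Qed.

Let inv_s_le1 u : inv_s u <= 1.
Proof. by apply: ge_inf; [have [] := levels_inf u|left]. Qed.

Let inv_s_le t u : 0 <= t < 1 -> u < s t -> inv_s u <= t.
Proof. by move=> t01 ut; apply: ge_inf; [have [] := levels_inf u|right]. Qed.

Let le_s_of_inv_s t u : 0 <= t < 1 -> inv_s u < t -> u < s t.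
Proof.
move=> /andP[t0 t1] ut; have [x [->|[/andP[x0 x1] ux]] xt] := inf_lt (levels_inf u).1 ut.
  by rewrite ltNge (ltW xt) in t1.
case: s_spectral => _ snd _ _.
by apply: lt_le_trans ux _; apply: snd => //; exact: ltW.
Qed.

(** To the right of t the strict version applies; right-continuity of s carries the bound to t
    itself, at the price of a weak inequality. *)
Let le_s_of_inv_s_le t u : 0 <= t < 1 -> inv_s u <= t -> u <= s t.
Proof.
move=> /andP[t0 t1] ut; case: s_spectral => _ _ src _.
have t01 : 0 <= t < 1 by rewrite t0.
have rc := src t t01.
rewrite leNgt; apply/negP => st; have /cvgr_lt/(_ _ st) := rc.
move=> h; have : \forall x \near t^'+, False.
  near=> x; have tx : t < x by near: x; exact: nbhs_right_gt.
  have x1 : x < 1 by near: x; exact: nbhs_right_lt.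
  have x01 : 0 <= x < 1 by rewrite x1 (le_trans t0)// ltW.
  have := le_s_of_inv_s x01 (le_lt_trans ut tx).
  by apply/negP; rewrite -leNgt ltW//; near: x.
by move=> /filter_ex[].
Unshelve. all: by end_near. Qed.

Let inv_s_nd : nondecreasing_fun inv_s.
Proof.
move=> u v uv; apply: lb_le_inf; first by exists 1; left.
move=> x [->|[x01 vx]]; first exact: inv_s_le1.
by apply: inv_s_le => //; exact: le_lt_trans uv vx.
Qed.

Let m_inv_s : measurable_fun setT inv_s.
Proof. exact: nondecreasing_measurable inv_s_nd. Qed.

Let D : set (measurableTypeR R * measurableTypeR R) :=
  [set z | (0 <= z.2) && (z.2 < (s \_ `[0, 1[) z.1)].

Let mD : measurable D.
Proof.
have m1 : measurable_fun setT
    (fst : measurableTypeR R * measurableTypeR R -> R) by exact: measurable_fst.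
have m2 : measurable_fun setT
    (snd : measurableTypeR R * measurableTypeR R -> R) by exact: measurable_snd.
rewrite -[D]setTI.
have : measurable_fun setT (fun z : measurableTypeR R * measurableTypeR R =>
    (0 <= z.2) && (z.2 < (s \_ `[0, 1[) z.1)).
  apply: measurable_and; first exact: measurable_fun_ler.
  apply: measurable_fun_ltr => //.
  exact: (measurableT_comp s_meas).
move=> h; exact: (h measurableT [set true]).
Qed.

Let D_itv t u : D (t, u) -> 0 <= t < 1 /\ 0 <= u < s t.
Proof.
rewrite /D /= patchE; case: ifPn => [|_ /andP[u0 /(le_lt_trans u0)]]; last by rewrite ltxx.
by rewrite inE/= in_itv.
Qed.

Let P2 := (U01 R \x (@lebesgue_measure R : {sigma_finite_measure set (measurableTypeR R) -> \bar R}))%E.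

(** Tonelli: the slice of D at height u >= 0 is an interval from inv_s u to 1, with or without its
    left end, hence of length 1 - inv_s u. *)
Let integral_D (f : R -> R) : measurable_fun setT f -> (forall u, 0 <= f u) ->
  (\int[P2]_(z in D) (f z.2)%:E =
   \int[@lebesgue_measure R]_(u in `[0%R, +oo[) ((f u * (1 - inv_s u))%:E))%E.
Proof.
move=> mf f0.
have mfD : measurable_fun setT ((fun z : measurableTypeR R * measurableTypeR R =>
    (f z.2)%:E) \_ D).
  apply: (iffLR (measurable_restrictT (fun z => (f z.2)%:E) mD)).
  apply: measurable_funTS; apply/measurable_EFinP.
  by apply: (measurableT_comp mf); exact: measurable_snd.
rewrite integral_mkcond.
rewrite (@fubini_tonelli2 _ _ _ _ _ (U01 R)
  (@lebesgue_measure R : {sigma_finite_measure set (measurableTypeR R) -> \bar R})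
  ((fun z => (f z.2)%:E) \_ D) mfD); last first.
  by move=> z; rewrite patchE; case: ifP => // _; rewrite lee_fin.
rewrite [RHS]integral_mkcond; apply: eq_integral => u _.
rewrite patchE mem_setE in_itv/= andbT.
case: ifPn => [u0|u0]; last first.
  apply: integral0_eq => t _; rewrite patchE memNset//.
  by move=> /D_itv[_ /andP[]]; rewrite (negbTE u0).
have mDu : measurable (ysection D u) by exact: measurable_ysection.
have DuE t : ysection D u t <-> D (t, u) by rewrite ysectionE.
transitivity (\int[U01 R]_(t in ysection D u) (cst (f u)%:E t))%E.
  rewrite [RHS]integral_mkcond; apply: eq_integral => t _; rewrite !patchE.
  have -> : ((t, u) \in D) = (t \in ysection D u).
    by apply/idP/idP => /set_mem h; apply/mem_set; exact/DuE.
  by [].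
rewrite integral_cst// EFinM; congr (_ * _)%E.
apply/eqP; rewrite eq_le; apply/andP; split.
  have -> : (1 - inv_s u)%:E = U01 R `[inv_s u, 1[%classic.
    rewrite U01_itv ?lebesgue_measure_itv/=.
      rewrite lte_fin; case: ltgtP (inv_s_le1 u) => // -> _; rewrite ?EFinB//.
      by rewrite subee.
    by move=> t /=; rewrite !in_itv/= => /andP[/(le_trans (inv_s_ge0 u)) -> /ltW].
  apply: le_measure; rewrite ?inE//.
  move=> t /DuE/D_itv[t01 /andP[_ ut]]; rewrite /= in_itv/= inv_s_le//.
  by case/andP: t01.
have -> : (1 - inv_s u)%:E = U01 R `]inv_s u, 1[%classic.
  rewrite U01_itv ?lebesgue_measure_itv/=.
    rewrite lte_fin; case: ltgtP (inv_s_le1 u) => // -> _; rewrite ?EFinB//.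
    by rewrite subee.
  by move=> t /=; rewrite !in_itv/= => /andP[/ltW/(le_trans (inv_s_ge0 u)) -> /ltW].
apply: le_measure; rewrite ?inE//.
move=> t /=; rewrite in_itv/= => /andP[ut t1].
have t01 : 0 <= t < 1 by rewrite t1 (le_trans (inv_s_ge0 u))// ltW.
have tm : t \in (`[0, 1[%classic : set R) by rewrite inE/= in_itv.
apply/DuE; rewrite /D/= u0 patchE tm/=.
exact: le_s_of_inv_s.
Qed.

Let P2D : P2 D = 1%E.
Proof.
transitivity (\int[U01 R]_t ((s \_ `[0, 1[) t)%:E)%E.
  rewrite /P2 /product_measure1; apply: eq_integral => t _ /=.
  have -> : xsection D t = `[0, (s \_ `[0, 1[) t[%classic.
    by apply/seteqP; split => u; rewrite xsectionE /D /= in_itv.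
  rewrite lebesgue_measure_itv/= lte_fin; case: ltP; rewrite ?oppr0 ?adde0// => h.
  congr EFin; apply/le_anti; rewrite h andbT patchE; case: ifP => //.
  by rewrite inE/= in_itv/= => t01; case: s_spectral => /(_ t t01).
by rewrite -spectral_integralE//; case: s_spectral.
Qed.

(** The length 1 - inv_s u of the slice cancels the kernel (1 - inv_s u)^-1. What remains is the
    length of the set of u >= 0 with inv_s u <= t, enclosed between [0, s t[ and [0, s t]. *)
Lemma bbT_surjective : exists mu : frakP R, forall t, 0 <= t < 1 -> bbT mu t = s t.
Proof.
have mass : mrestr P2 mD setT = 1%E by rewrite /mrestr setTI P2D.
have [P PE] := exists_probability
  (dirac (0 : measurableTypeR R, 0 : measurableTypeR R)) mass.
have mX : measurable_fun setT (fun z : measurableTypeR R * measurableTypeR R =>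
    inv_s z.2 : measurableTypeR R).
  by apply: (measurableT_comp m_inv_s); exact: measurable_snd.
pose X : {RV P >-> measurableTypeR R} :=
  @mfun_Sub _ _ _ (measurableTypeR R) _ (mem_set mX).
have m01 : distribution P X `[0, 1[%classic = 1%E.
  rewrite /distribution /pushforward PE -P2D /mrestr; congr (P2 _).
  apply/seteqP; split => [z []//|[t u] Dtu]; split => //=.
  have [/andP[t0 t1] /andP[_ ut]] := D_itv Dtu.
  rewrite in_itv/= inv_s_ge0/= (le_lt_trans _ t1)// inv_s_le//.
  by rewrite t0.
exists (frakP_of m01) => t t01; have /andP[t0 t1] := t01.
apply: EFin_inj.
transitivity (\int[measure_of (frakP_of m01)]_a (tail_kernel a t)%:E)%E.
  by rewrite bbT_kernel patchE mem_set//= in_itv.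
transitivity (\int[distribution P X]_a (tail_kernel a t)%:E)%E; first by [].
have mk : measurable_fun setT (fun a : R => tail_kernel a t).
  by have := measurable_fun_pair1 t (@measurable_tail_kernel R).
have mkX : measurable_fun setT (fun z : measurableTypeR R * measurableTypeR R =>
    (tail_kernel (inv_s z.2) t)%:E).
  apply/measurable_EFinP; apply: (measurableT_comp mk).
  by apply: (measurableT_comp m_inv_s); exact: measurable_snd.
rewrite ge0_integral_distribution; last 2 first.
- exact/measurable_EFinP.
- by move=> a; rewrite lee_fin tail_kernel_ge0.
transitivity (\int[mrestr P2 mD]_z (tail_kernel (inv_s z.2) t)%:E)%E.
  by apply: eq_measure_integral => A mA _; exact: PE.
rewrite ge0_integral_mrestr//; last by move=> z; rewrite lee_fin tail_kernel_ge0.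
rewrite (integral_D (f := fun u => tail_kernel (inv_s u) t)); last 2 first.
- exact: (measurableT_comp mk).
- by move=> u; exact: tail_kernel_ge0.
have mI : measurable ((inv_s @^-1` `]-oo, t]) `&` `[0, +oo[ : set R).
  by apply: measurableI => //; rewrite -[X in measurable X]setTI; exact: m_inv_s.
transitivity (\int[@lebesgue_measure R]_(u in (inv_s @^-1` `]-oo, t]) `&` `[0%R, +oo[)
    (cst 1%E u))%E.
  rewrite integral_mkcondl; apply: eq_integral => u _.
  have E : (u \in inv_s @^-1` `]-oo, t]) = (inv_s u <= t).
    by apply/idP/idP => [/set_mem|h]; [|apply/mem_set]; rewrite /= in_itv.
  rewrite patchE E /tail_kernel inv_s_ge0 t1 andbT/=.
  case: ifP => ut; last by rewrite mul0r.
  have iu : inv_s u < 1 by exact: le_lt_trans ut t1.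
  by rewrite powR_inv1 ?subr_ge0 ?ltW// mulVf// subr_eq0 gt_eqF.
rewrite integral_cst// mul1e.
have st0 : 0 <= s t by case: s_spectral => /(_ t t01).
have leb0 (b : bool) : lebesgue_measure [set` Interval (BLeft 0) (BSide b (s t))] = (s t)%:E.
  rewrite lebesgue_measure_itv/= lte_fin; case: ltgtP st0 => // [_ _|<- _//].
  by rewrite oppr0 adde0.
apply/eqP; rewrite eq_le; apply/andP; split.
  rewrite -(leb0 false); apply: le_measure; rewrite ?inE//.
  move=> u [/=]; rewrite !in_itv/= andbT => iu ->/=.
  exact: le_s_of_inv_s_le.
rewrite -[leLHS](leb0 true); apply: le_measure; rewrite ?inE//.
move=> u /=; rewrite !in_itv/= andbT => /andP[u0 us]; split => //.
exact: inv_s_le.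
Qed.

End surjectivity.

(** * The set M as a Kusuoka set *)

Section kusuoka_set.
Context {R : realType}.
Implicit Types (p lam : R) (q : \bar R) (mu nu : frakP R).

Lemma tail_average_AVaR mu (Z : {RV (U01 R) >-> R}) g :
  (U01 R).-integrable setT (EFin \o g) ->
  (forall t, 0 < t < 1 -> quantile Z t = (g t)%:E) ->
  (\int[measure_of mu]_(a in `[0%R, 1%R[) AVaR a Z =
   \int[measure_of mu]_(a in `[0%R, 1%R[) (tail_average g a)%:E)%E.
Proof.
move=> gi Zg; apply: eq_integral => a; rewrite inE/= in_itv/= => a01.
exact: AVaR_tail_average.
Qed.

Lemma mixture_spectral_Lq q c mu nu : (1 <= q)%E -> 0 <= c -> c <= 1 ->
  spectral_Lq q (bbT mu) -> mixture_with_dirac0 c mu nu -> spectral_Lq q (bbT nu).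
Proof.
move=> q1 c0 c1 sq numu; have [_ oneq _] := @spectral_one R q q1.
have := in_LpD q1 (in_LpZ (1 - c) q1 oneq) (in_LpZ c q1 sq).
rewrite /spectral_Lq; congr in_Lp; apply/funext => t; rewrite !patchE.
case: ifPn => [|_]; last by rewrite !mulr0 addr0.
by rewrite inE/= in_itv/= => t01; rewrite mulr1 (bbT_mixture c0 c1 numu).
Qed.

Lemma mixture_AVaR p q lam mu nu (Z : {RV (U01 R) >-> R}) :
  1 <= p -> ((p%:E)^-1 + q^-1 = 1)%E -> 0 <= lam -> lam <= 1 ->
  in_Lp p%:E Z -> spectral_Lq q (bbT mu) ->
  mixture_with_dirac0 (lam / spectral_norm q (bbT mu)) mu nu ->
  (\int[measure_of nu]_(a in `[0%R, 1%R[) AVaR a Z =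
    (1 - lam / spectral_norm q (bbT mu))%:E * 'E_(U01 R)[Z]
    + (lam / spectral_norm q (bbT mu))%:E * rho_spectral (bbT mu) Z)%E.
Proof.
move=> p1 pq lam0 lam1 Zp sq numu; have Gp := in_Lp_quantile_fun p1 Zp.
rewrite (spectral_combination lam p1 pq Zp sq).
have N1 := spectral_norm_ge1 p1 pq (bbT_spectral mu) sq.
have N0 : 0 < spectral_norm q (bbT mu) by apply: lt_le_trans N1.
have c0 : 0 <= lam / spectral_norm q (bbT mu) by rewrite divr_ge0// ltW.
have c1 : lam / spectral_norm q (bbT mu) <= 1.
  by rewrite ler_pdivrMr// mul1r (le_trans lam1).
move: (lam / spectral_norm q (bbT mu)) c0 c1 numu => c c0 c1 numu.
have Gi : (U01 R).-integrable setT (EFin \o quantile_fun Z).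
  exact: (in_Lp_integrable1 _ Gp).
have TGi := hoelder_integrable p1 pq sq Gp.
have bE t : 0 < t < 1 -> (bbT nu \_ `[0, 1[) t * quantile_fun Z t =
    (1 - c) * quantile_fun Z t + c * ((bbT mu \_ `[0, 1[) t * quantile_fun Z t).
  move=> /andP[/ltW t0 t1]; rewrite !patchE mem_set/= ?in_itv/= ?t0//.
  by rewrite (bbT_mixture c0 c1 numu) ?t0// mulrDl mulrA.
have mG : measurable_fun setT (quantile_fun Z) by exact: measurable_quantile_fun.
have i1 := integrableZl measurableT (1 - c) Gi.
have i2 := integrableZl measurableT c TGi.
have m12 : measurable_fun setT (fun t => (1 - c) * quantile_fun Z t +
    c * ((bbT mu \_ `[0, 1[) t * quantile_fun Z t)).
  apply: measurable_funD; apply: measurable_funM => //.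
  by apply: measurable_funM => //; exact: measurable_bbT.
have mnu : measurable_fun setT (fun t => (bbT nu \_ `[0, 1[) t * quantile_fun Z t).
  by apply: measurable_funM => //; exact: measurable_bbT.
have TGnu := hoelder_integrable p1 pq
  (mixture_spectral_Lq (conjugate_ge1 p1 pq) c0 c1 sq numu) Gp.
rewrite (tail_average_AVaR nu Gi (@quantile_funE _ Z)).
have [_ ->] := fubini_tail_average Gi TGnu.
congr EFin; rewrite (U01_eq_Rintegral mnu m12 bE).
by rewrite RintegralD// !RintegralZl.
Qed.

Lemma frakM_Kusuoka_set p q lam : 1 <= p -> ((p%:E)^-1 + q^-1 = 1)%E ->
  0 <= lam -> lam <= 1 -> Kusuoka_set p (semideviation p lam) (frakM q lam).
Proof.
move=> p1 pq lam0 lam1 Z Zp; rewrite (semideviation_spectral p1 pq lam0 Zp).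
apply/eqP; rewrite eq_le; apply/andP; split.
  apply: ge_ereal_sup => _ [s [ss sq] <-].
  have [mu muE] := bbT_surjective ss (in_Lp_measurable sq).
  have sE : s \_ `[0, 1[ = bbT mu \_ `[0, 1[.
    apply/funext => t; rewrite !patchE; case: ifP => //.
    by rewrite inE/= in_itv/= => /muE.
  have muq : spectral_Lq q (bbT mu) by rewrite /spectral_Lq -sE.
  have N1 := spectral_norm_ge1 p1 pq (bbT_spectral mu) muq.
  have N0 : 0 < spectral_norm q (bbT mu) by apply: lt_le_trans N1.
  have [||nu numu] := @exists_mixture _ (lam / spectral_norm q (bbT mu)) mu.
  - by rewrite divr_ge0// ltW.
  - by rewrite ler_pdivrMr// mul1r (le_trans lam1).
  apply: ereal_sup_ubound; exists nu; first by exists mu.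
  rewrite (mixture_AVaR p1 pq lam0 lam1 Zp muq numu) /spectral_norm sE.
  rewrite /rho_spectral; congr (_ + _ * _)%E; apply: eq_integral => t.
  by rewrite inE/= in_itv/= => /muE ->.
apply: ge_ereal_sup => _ [nu [mu [muq numu]] <-].
rewrite (mixture_AVaR p1 pq lam0 lam1 Zp muq numu).
by apply: ereal_sup_ubound; exists (bbT mu) => //; split => //; exact: bbT_spectral.
Qed.

End kusuoka_set.

(** * A moment criterion for weak convergence *)

Section bernstein.
Context {R : realType}.
Implicit Types (g h : nat -> R) (f : R -> R) (x : R).

(* Expectation of g at a binomial variable with parameters n and x, computed by
   conditioning on the first trial. *)
Fixpoint bernstein n g x : R :=
  if n is n'.+1 then (1 - x) * bernstein n' g x + x * bernstein n' (g \o succn) x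
  else g 0.

Lemma bernstein_le n g h x : 0 <= x <= 1 ->
  (forall k, (k <= n)%N -> g k <= h k) -> bernstein n g x <= bernstein n h x.
Proof.
move=> /andP[x0 x1]; elim: n g h => [|n ih] g h gh /=; first exact: gh.
apply: lerD; apply: ler_wpM2l; rewrite ?subr_ge0//; apply: ih => k kn; apply: gh => //.
exact: leqW.
Qed.

(** The binomial law has mean n x and variance n x (1 - x). The parameter a must vary in the
    induction, since a success in the first trial turns a into a - 1. *)
Lemma bernstein_variance n x (a c d : R) :
  bernstein n (fun k => c + d * (k%:R - a) ^+ 2) x =
  c + d * (n%:R * x * (1 - x) + (n%:R * x - a) ^+ 2).
Proof.
elim: n a => [|n ih] a /=; first by ring.
rewrite ih (_ : (fun k => _) \o succn = fun k => c + d * (k%:R - (a - 1)) ^+ 2).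
  by rewrite ih -natr1; ring.
by apply/funext => k /=; rewrite -natr1; congr (_ + _ * _ ^+ _); ring.
Qed.

Lemma heine_itv01 f (e : R) : {within `[0, 1], continuous f} -> 0 < e ->
  exists2 d, 0 < d & forall x y, 0 <= x <= 1 -> 0 <= y <= 1 ->
    `|x - y| < d -> `|f x - f y| <= e.
Proof.
move=> cf e0; have e20 : 0 < e / 2 by rewrite divr_gt0.
have /compact_near_coveringP nc := @segment_compact R 0 1.
pose P (d x : R) := forall y, 0 <= x <= 1 -> 0 <= y <= 1 -> `|x - y| < d ->
  `|f x - f y| <= e.
have /nc : forall x, x \in `[0, 1] ->
    \forall x' \near x & d \near (0:R)^'+, P d x'.
  move=> x; rewrite in_itv/= => x01.
  have x01' : `[0, 1]%classic x by rewrite /= in_itv.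
  have /subspace_continuousP/(_ x x01') := cf.
  move=> /cvgrPdist_lt/(_ _ e20); rewrite nearE /within/=.
  move=> /nbhs_ballP[d /= d0 hd].
  exists (ball x (d / 2), [set t | 0 < t < d / 2]).
    split => /=.
      by apply: nbhsx_ballx; rewrite divr_gt0.
    near=> t; rewrite /=; apply/andP; split.
      by near: t; exact: nbhs_right_gt.
    by near: t; apply: nbhs_right_lt; rewrite divr_gt0.
  move=> [x' t] /= [xx' /andP[t0 td]] y x'01 y01 x'y.
  have h1 : `|f x - f x'| < e / 2.
    apply: hd; last by rewrite in_itv.
    by apply: lt_le_trans xx' _; rewrite ler_pdivrMr// ler_peMr ?ler1n// ltW.
  have h2 : `|f x - f y| < e / 2.
    apply: hd; last by rewrite in_itv.
    rewrite /ball/= (le_lt_trans (ler_distD x' _ _))// (splitr d) ltrD//.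
    exact: lt_trans x'y td.
  rewrite -(subrK (f x) (f x')) -addrA (le_trans (ler_normD _ _))// distrC.
  by rewrite (splitr e) lerD// ltW.
move=> hP.
have [d [d0 hd]] : exists d, 0 < d /\ (`[0, 1] `<=` P d).
  apply: (@filter_ex _ (0:R)^'+); apply: filterI; last exact: hP.
  exact: nbhs_right_gt.
by exists d => // x y x01 y01 xy; apply: hd.
Unshelve. all: by end_near. Qed.

(** If k/n is within d of x, uniform continuity bounds the difference of the values of f by e / 2;
    otherwise it is at most 2 M <= c (k/n - x)^2 with c = 2 M / d^2. Monotonicity of the expectation
    transfers the sum of the two bounds, and the variance contributes at most c / n <= e / 2. *)
Lemma bernstein_uniform f (e : R) : {within `[0, 1], continuous f} -> 0 < e ->
  exists n, forall x, 0 <= x <= 1 ->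
    `|bernstein n (fun k => f (k%:R / n%:R)) x - f x| <= e.
Proof.
move=> cf e0; have e20 : 0 < e / 2 by rewrite divr_gt0.
have [d d0 hd] := heine_itv01 cf e20.
have [M M0 hM] : exists2 M : R, 0 < M & forall x : R, 0 <= x <= 1 -> `|f x| <= M.
  have /compact_bounded[M [_ hM]] := continuous_compact cf (@segment_compact R 0 1).
  exists (`|M| + 1); first by rewrite ltr_pwDr.
  move=> x x01; apply: hM; first by rewrite (le_lt_trans (ler_norm _))// ltrDl.
  by exists x => //; rewrite /= in_itv.
pose c := 2 * M / d ^+ 2.
have c0 : 0 < c by rewrite divr_gt0 ?exprn_gt0// mulr_gt0.
pose n := (truncn (c / (e / 2))).+1; exists n => x x01.
have n0 : 0 < n%:R :> R by rewrite ltr0n.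
have cn : c / n%:R <= e / 2.
  rewrite ler_pdivrMr// -ler_pdivrMl// mulrC ltW//.
  exact: truncnS_gt.
have k01 k : (k <= n)%N -> 0 <= (k%:R / n%:R : R) <= 1.
  by move=> kn; rewrite divr_ge0//= ler_pdivrMr// mul1r ler_nat.
have est k : (k <= n)%N -> `|f (k%:R / n%:R) - f x| <=
    e / 2 + c / n%:R ^+ 2 * (k%:R - n%:R * x) ^+ 2.
  move=> kn; set y := k%:R / n%:R.
  have -> : c / n%:R ^+ 2 * (k%:R - n%:R * x) ^+ 2 = c * (y - x) ^+ 2.
    by rewrite /y; field; rewrite gt_eqF.
  have [yx|yx] := ltP `|y - x| d.
    rewrite (le_trans (hd _ _ (k01 k kn) x01 yx))// lerDl mulr_ge0 ?sqr_ge0//.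
    exact: ltW.
  apply: (@le_trans _ _ (2 * M)).
    rewrite (le_trans (ler_normB _ _))// mulr_natl mulr2n lerD// ?hM//.
    exact: k01.
  rewrite -[leLHS]add0r lerD ?(ltW e20)// /c mulrAC ler_pdivlMr ?exprn_gt0//.
  rewrite ler_wpM2l ?mulr_ge0 ?(ltW M0)//.
  by rewrite -[leRHS]real_normK ?num_real// lerXn2r ?nnegrE ?normr_ge0 ?(ltW d0).
have var : c / n%:R ^+ 2 * (n%:R * x * (1 - x) + (n%:R * x - n%:R * x) ^+ 2) <= e / 2.
  apply: le_trans cn.
  rewrite subrr expr0n/= addr0.
  have -> : c / n%:R ^+ 2 * (n%:R * x * (1 - x)) = c / n%:R * (x * (1 - x)).
    by field; rewrite gt_eqF.
  have cn0 : 0 <= c / n%:R by rewrite divr_ge0// ltW.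
  rewrite -[leRHS]mulr1; apply: ler_wpM2l => //.
  by case/andP: x01 => x0 x1; rewrite mulr_ile1 ?subr_ge0// lerBlDr lerDl.
rewrite ler_distl; apply/andP; split.
  have := @bernstein_le n (fun k => (f x - e / 2) + (- (c / n%:R ^+ 2)) * (k%:R - n%:R * x) ^+ 2)
    (fun k => f (k%:R / n%:R)) x x01.
  rewrite bernstein_variance => h; apply: le_trans (h _); first by lra.
  by move=> k kn; have := est k kn; rewrite ler_distl => /andP[+ _]; lra.
have := @bernstein_le n (fun k => f (k%:R / n%:R))
  (fun k => (f x + e / 2) + (c / n%:R ^+ 2) * (k%:R - n%:R * x) ^+ 2) x x01.
rewrite bernstein_variance => h; apply: (le_trans (h _)); last by lra.
by move=> k kn; have := est k kn; rewrite ler_distl => /andP[_ +]; lra.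
Qed.

End bernstein.

Section weak_convergence.
Context {R : realType}.
Implicit Types (mu nu : frakP R) (F G f : R -> R).

Definition mean01 nu F : R := \int[measure_of nu]_(x in `[0, 1[) F x.

Lemma mean01_integrable nu F (M : R) : measurable_fun (`[0, 1[%classic : set R) F ->
  (forall x : R, 0 <= x < 1 -> `|F x| <= M) ->
  (measure_of nu).-integrable `[0, 1[ (EFin \o F).
Proof.
move=> mF FM; apply: measurable_bounded_integrable => //.
  by apply: le_lt_trans (ltry 1); exact: probability_le1.
exists M; split; first exact: num_real.
move=> y My x /=; rewrite in_itv/= => x01; exact: le_trans (FM x x01) (ltW My).
Qed.

Lemma mean01_close nu F G (e : R) :
  (measure_of nu).-integrable `[0, 1[ (EFin \o F) ->
  (measure_of nu).-integrable `[0, 1[ (EFin \o G) ->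
  (forall x : R, 0 <= x < 1 -> `|F x - G x| <= e) ->
  `|mean01 nu F - mean01 nu G| <= e.
Proof.
move=> iF iG FG; have mA : measurable (`[0, 1[%classic : set (measurableTypeR R)).
  exact: measurable_itv.
have iFG := integrableB mA iF iG.
rewrite /mean01 -RintegralB//; apply: le_trans (le_normr_Rintegral _ _) _ => //.
apply: (@le_trans _ _ (\int[measure_of nu]_(x in `[0, 1[) e)).
  apply: le_Rintegral => //.
  - exact: (integrable_norm iFG).
  - exact: finite_measure_integrable_cst.
rewrite Rintegral_cst//.
by rewrite [X in fine X](_ : _ = 1%E) ?mulr1//; exact: measure_of_itv.
Qed.

(** The topology integrates over [0, 1], whereas AV@R has a meaning on [0, 1[ only; elements of
    [frakP] do not charge the difference. *)
Lemma integralsE nu (f : C01 R) : integrals (nu : prob01 R) f = mean01 nu (set_val f).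
Proof.
rewrite /integrals /mean01 -/(measure_of nu).
have cf : {within `[0, 1], continuous (set_val f : R -> R)} by exact: (set_valP f).
have mf : measurable_fun (`[0, 1]%classic : set R) (set_val f : R -> R).
  by apply: subspace_continuous_measurable_fun => //; exact: measurable_itv.
have mf' : measurable_fun (`[0, 1[%classic : set R) (set_val f : R -> R).
  by apply: measurable_funS mf => // x /=; rewrite !in_itv/= => /andP[-> /ltW].
rewrite /Rintegral; congr fine; rewrite integral_mkcond [RHS]integral_mkcond.
apply: ae_eq_integral => //.
- apply/(measurable_restrictT _ _).1 => //; exact/measurable_EFinP.
- apply/(measurable_restrictT _ _).1 => //; exact/measurable_EFinP.
have FF : Filter (nbhs (almost_everywhere (measure_of nu))).
  exact: ae_filter_ringOfSetsType.
have : {ae measure_of nu, forall a, 0 <= a < 1} by exact: measure_of_ae.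
apply: filterS => a /andP[a0 a1] _.
by rewrite !patchE !mem_set//= in_itv/= a0 ?ltW.
Qed.

Lemma frakP_cvg (u : nat -> frakP R) nu :
  (forall f : C01 R, integrals (u k : prob01 R) f @[k --> \oo] -->
    integrals (nu : prob01 R) f) ->
  u @ \oo --> nu.
Proof.
move=> h; have : (fun k => integrals (u k : prob01 R)) @ \oo -->
    (integrals (nu : prob01 R) : {ptws C01 R -> R}).
  apply/cvg_sup => f A /= [_ [[B Bop <-] Bnu BA]].
  have : nbhs (integrals (nu : prob01 R) f) B by exact: open_nbhs_nbhs.
  by move=> /(h f)[n _ hn]; exists n => // k nk; apply: BA; exact: hn.
move=> c A /= [_ [[B Bop <-] Bnu BA]].
rewrite nbhs_filterE; have := c B; rewrite /= => /(_ _)[].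
  by apply: open_nbhs_nbhs.
move=> n _ hn; exists n => // k nk; apply: BA; exact: hn.
Qed.

Lemma closed_integrals_le (f : C01 R) (c : R) :
  closed [set nu : frakP R | integrals (nu : prob01 R) f <= c].
Proof.
have ci : continuous (@integrals R : frakP R -> {ptws C01 R -> R}).
  exact: initial_continuous.
have cp : continuous (fun g : {ptws C01 R -> R} => g f).
  exact: (@proj_continuous _ (fun=> R) f).
have : closed ((fun g : {ptws C01 R -> R} => g f) @^-1` [set x : R | x <= c]).
  by apply: closed_comp; [move=> g _; exact: cp|exact: closed_le].
move=> h; rewrite -[X in closed X]/((@integrals R : frakP R -> {ptws C01 R -> R}) @^-1`
  ((fun g : {ptws C01 R -> R} => g f) @^-1` [set x : R | x <= c])).
by apply: closed_comp => // g _; exact: ci.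
Qed.

(* The functions F whose products with all powers of 1 - x have converging means
   form a class stable under (F, G) |-> (1 - x) F + x G, hence containing all
   Bernstein polynomials. *)
Lemma weak_cvg_moments (u : nat -> frakP R) nu :
  (forall i, mean01 (u k) (fun x => (1 - x) ^+ i) @[k --> \oo] -->
    mean01 nu (fun x => (1 - x) ^+ i)) ->
  u @ \oo --> nu.
Proof.
move=> hm.
pose W F := [/\ measurable_fun setT F, exists M : R, forall x : R, 0 <= x < 1 -> `|F x| <= M &
  forall i, mean01 (u k) (fun x => F x * (1 - x) ^+ i) @[k --> \oo] -->
    mean01 nu (fun x => F x * (1 - x) ^+ i)].
have pw1 i (x : R) : 0 <= x < 1 -> `|(1 - x) ^+ i| <= 1.
  move=> /andP[x0 x1]; rewrite normrX exprn_ile1//.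
  by rewrite ler_norml; apply/andP; split; lra.
have mpw i : measurable_fun setT (fun x : R => (1 - x) ^+ i).
  by apply: measurable_funX; exact: measurable_funB.
have Wi F i : W F -> forall n, (measure_of n).-integrable `[0, 1[
    (EFin \o (fun x => F x * (1 - x) ^+ i)).
  move=> [mF [M FM] _] n; apply: (@mean01_integrable _ _ M).
    by apply: measurable_funTS; exact: measurable_funM.
  move=> x x01; rewrite normrM -[leRHS]mulr1; apply: ler_pM => //.
    exact: FM.
  exact: pw1.
have Wc c : W (cst c).
  split; [exact: measurable_cst|by exists `|c| |move=> i].
  have Wpi (n : frakP R) : (measure_of n).-integrable `[0, 1[
      (EFin \o (fun x : R => (1 - x) ^+ i)).
    by apply: (@mean01_integrable _ _ 1); [exact: measurable_funTS|exact: pw1].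
  have E (n : frakP R) : mean01 n (fun x => cst c x * (1 - x) ^+ i) =
      c * mean01 n (fun x => (1 - x) ^+ i).
    by rewrite /mean01 -RintegralZl//; exact: Wpi.
  rewrite E; under eq_fun do rewrite E.
  by apply: cvgM; [exact: cvg_cst|exact: hm].
have Ws F G : W F -> W G -> W (fun x => (1 - x) * F x + x * G x).
  move=> WF WG; have [mF [M FM] cF] := WF; have [mG [N GN] cG] := WG; split.
  - apply: measurable_funD; apply: measurable_funM => //.
    exact: measurable_funB.
  - exists (M + N) => x /[dup] x01 /andP[x0 x1].
    rewrite (le_trans (ler_normD _ _))// lerD// normrM.
      apply: le_trans (FM x x01); apply: ler_piMl => //.
      by have := pw1 1%N x x01; rewrite expr1.
    apply: le_trans (GN x x01); apply: ler_piMl => //.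
    by rewrite ger0_norm// ltW.
  - move=> i.
    (* Writing x = 1 - (1 - x) leaves only powers of 1 - x as extra factors. *)
    have E (n : frakP R) : mean01 n (fun x => ((1 - x) * F x + x * G x) * (1 - x) ^+ i) =
        mean01 n (fun x => F x * (1 - x) ^+ i.+1) +
        (mean01 n (fun x => G x * (1 - x) ^+ i) -
         mean01 n (fun x => G x * (1 - x) ^+ i.+1)).
      have i1 := Wi _ i.+1 WF n; have i2 := Wi _ i WG n; have i3 := Wi _ i.+1 WG n.
      rewrite /mean01 -RintegralB// -RintegralD//; last exact: (integrableB _ i2 i3).
      by apply: eq_Rintegral => x _; rewrite !exprS; ring.
    rewrite E; under eq_fun do rewrite E.
    by apply: cvgD; [exact: cF|apply: cvgB; [exact: cG|exact: cG]].
have Wb n g : W (bernstein n g).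
  elim: n g => [|n ih] g /=; first exact: Wc.
  by apply: Ws; exact: ih.
apply: frakP_cvg => f; rewrite integralsE; under eq_fun do rewrite integralsE.
have cf : {within `[0, 1], continuous (set_val f : R -> R)} by exact: (set_valP f).
move: (set_val f : R -> R) cf => {}f cf.
apply/cvgrPdist_le => e e0.
have e30 : 0 < e / 3 by rewrite divr_gt0.
have [n hn] := bernstein_uniform cf e30.
have := Wb n (fun k => f (k%:R / n%:R)); set b := bernstein n _ => Wbb.
have [mb [M bM] cb] := Wbb; have {}cb := cb 0%N.
have bi (m : frakP R) : (measure_of m).-integrable `[0, 1[ (EFin \o b).
  by apply: (@mean01_integrable _ _ M) => //; exact: measurable_funTS.
have mf' : measurable_fun (`[0, 1[%classic : set R) f.
  have mf : measurable_fun (`[0, 1]%classic : set R) f.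
    by apply: subspace_continuous_measurable_fun => //; exact: measurable_itv.
  by apply: measurable_funS mf => // x /=; rewrite !in_itv/= => /andP[-> /ltW].
have bf (x : R) : 0 <= x < 1 -> `|b x - f x| <= e / 3.
  by move=> /andP[x0 x1]; apply: hn; rewrite x0 ltW.
have fi (m : frakP R) : (measure_of m).-integrable `[0, 1[ (EFin \o f).
  apply: (@mean01_integrable _ _ (M + e / 3)) => // x x01.
  rewrite -(subrK (b x) (f x)) addrC (le_trans (ler_normD _ _))// lerD ?bM//.
  by rewrite distrC bf.
have mc (m : frakP R) := mean01_close (bi m) (fi m) bf.
have E (m : frakP R) : mean01 m (fun x => b x * (1 - x) ^+ 0) = mean01 m b.
  by apply: eq_Rintegral => x _; rewrite expr0 mulr1.
rewrite E in cb; move: cb; under eq_fun do rewrite E.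
move=> /cvgrPdist_le/(_ _ e30); apply: filterS => k hk.
have h1 := mc nu; have h2 := mc (u k).
rewrite (_ : e = e / 3 + e / 3 + e / 3); last by field.
have -> : mean01 nu f - mean01 (u k) f = (mean01 nu f - mean01 nu b) +
  (mean01 nu b - mean01 (u k) b) + (mean01 (u k) b - mean01 (u k) f) by ring.
rewrite (le_trans (ler_normD _ _))// lerD// (le_trans (ler_normD _ _))// lerD//.
by rewrite distrC.
Qed.

End weak_convergence.

(** * Spectral means and test functions *)

Section spectral_mean.
Context {R : realType}.
Implicit Types (nu : frakP R) (z y w : R -> R) (p lam : R).

Definition spectral_mean nu z : R := \int[U01 R]_t ((bbT nu \_ `[0, 1[) t * z t).

Lemma U01_dominated (f_ : nat -> R -> R) (f g : R -> R) :
  (forall n, measurable_fun setT (f_ n)) -> measurable_fun setT f ->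
  (U01 R).-integrable setT (EFin \o g) ->
  (forall n t, 0 < t < 1 -> `|f_ n t| <= g t) ->
  (forall t, 0 < t < 1 -> f_ n t @[n --> \oo] --> f t) ->
  (U01 R).-integrable setT (EFin \o f) /\
  \int[U01 R]_t f_ n t @[n --> \oo] --> \int[U01 R]_t f t.
Proof.
move=> mf_ mf gi fg fcv.
have [] := @dominated_convergence _ _ _ (U01 R) setT measurableT
  (fun n => EFin \o f_ n) (EFin \o f) (EFin \o g).
- by move=> n; apply/measurable_EFinP; exact: mf_.
- exact/measurable_EFinP.
- apply: filterS U01_ae_itvoo => t t01 _; apply/fine_cvgP; split; first by near=> n.
  exact: fcv.
- exact: gi.
- by apply: filterS U01_ae_itvoo => t t01 n _ /=; rewrite lee_fin fg.
move=> fi _ h; split => //.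
rewrite /Rintegral; apply: fine_cvg; rewrite fineK//.
exact: (integrable_fin_num _ fi).
Unshelve. all: by end_near. Qed.

Lemma U01_bounded_integrable z (M : R) : measurable_fun setT z ->
  (forall t, `|z t| <= M) -> (U01 R).-integrable setT (EFin \o z).
Proof.
move=> mz zM; apply: (@in_Lp_integrable1 _ 1%E z (lexx _)).
exact: in_Lp_bounded (lexx _) mz zM.
Qed.

Lemma bbT_integrable nu : (U01 R).-integrable setT (EFin \o (bbT nu \_ `[0, 1[)).
Proof.
apply/integrableP; split; first by apply/measurable_EFinP; exact: measurable_bbT.
under eq_integral do rewrite /= (ger0_norm (bbT_restr_ge0 _ _)).
by rewrite tonelli_tail_average ltry.
Qed.

Lemma U01_mul_bounded_integrable y z (M : R) : (U01 R).-integrable setT (EFin \o y) ->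
  measurable_fun setT z -> (forall t, `|z t| <= M) ->
  (U01 R).-integrable setT (EFin \o (fun t => y t * z t)).
Proof.
move=> iy mz zM; have := integrableZl measurableT M iy.
move=> ig; apply: le_integrable ig => //.
- apply/measurable_EFinP; apply: measurable_funM => //.
  by apply/measurable_EFinP; exact: measurable_int iy.
- move=> t _ /=; rewrite lee_fin !normrM mulrC; apply: ler_pM => //.
  exact: le_trans (zM t) (ler_norm _).
Qed.

Lemma bbT_bounded_integrable nu z (M : R) : measurable_fun setT z ->
  (forall t, `|z t| <= M) ->
  (U01 R).-integrable setT (EFin \o (fun t => (bbT nu \_ `[0, 1[) t * z t)).
Proof. exact: U01_mul_bounded_integrable (bbT_integrable nu). Qed.

Lemma spectral_mean_tail_average nu z (M : R) : measurable_fun setT z ->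
  (forall t, `|z t| <= M) ->
  (\int[measure_of nu]_(a in `[0%R, 1%R[) (tail_average z a)%:E =
    (spectral_mean nu z)%:E)%E.
Proof.
move=> mz zM.
have [_] := fubini_tail_average (U01_bounded_integrable mz zM)
  (bbT_bounded_integrable nu mz zM).
by [].
Qed.

Lemma spectral_meanD nu z y (M N e : R) :
  measurable_fun setT z -> (forall t, `|z t| <= M) ->
  measurable_fun setT y -> (forall t, `|y t| <= N) ->
  spectral_mean nu (fun t => z t + e * y t) =
  spectral_mean nu z + e * spectral_mean nu y.
Proof.
move=> mz zM my yN; rewrite /spectral_mean.
have iz := bbT_bounded_integrable nu mz zM.
have iy := bbT_bounded_integrable nu my yN.
rewrite -RintegralZl// -RintegralD//; last exact: (integrableZl measurableT e iy).
by apply: eq_Rintegral => t _; ring.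
Qed.

Lemma AVaR_spectral_mean nu z (mz : measurable_fun setT z) (M : R) :
  (forall t, `|z t| <= M) ->
  (forall s t, 0 < s -> s <= t -> t < 1 -> z s <= z t) ->
  (forall t, 0 < t < 1 -> z x @[x --> t^'+] --> z t) ->
  (\int[measure_of nu]_(a in `[0%R, 1%R[) AVaR a (U01_rv mz) =
   (spectral_mean nu z)%:E)%E.
Proof.
move=> zM znd zrc; rewrite -(spectral_mean_tail_average nu mz zM).
apply: tail_average_AVaR; first exact: U01_bounded_integrable mz zM.
by apply: quantile_monotone.
Qed.

(** Two families have transforms of this shape: elements of M, with P = sigma and A = lam /
    ||sigma||_q, and measures given by the derivative of the semideviation at w, with P = w_+^(p-1).
    The formula brings both into the form of [semidev_slope]. *)
Lemma spectral_mean_affine nu (A : R) (P : R -> R) y (L : R) :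
  (U01 R).-integrable setT (EFin \o P) ->
  (forall t, 0 < t < 1 -> bbT nu t = 1 - A * \int[U01 R]_u P u + A * P t) ->
  measurable_fun setT y -> (forall t, `|y t| <= L) ->
  spectral_mean nu y = \int[U01 R]_t y t +
    A * \int[U01 R]_t ((y t - \int[U01 R]_u y u) * P t).
Proof.
move=> iP; set I := \int[U01 R]_u P u => nuE my yL; rewrite /spectral_mean.
set m := \int[U01 R]_u y u.
have mP : measurable_fun setT P by apply/measurable_EFinP; exact: measurable_int iP.
have iy := U01_bounded_integrable my yL.
have mym : measurable_fun setT (fun t => y t - m) by exact: measurable_funB.
pose Q t := (y t - m) * P t.
have iQ : (U01 R).-integrable setT (EFin \o Q).
  rewrite (_ : Q = fun t => P t * (y t - m)); last by apply/funext => t; exact: mulrC.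
  apply: (U01_mul_bounded_integrable (M := L + `|m|) iP) => // t.
  by rewrite (le_trans (ler_normB _ _))// lerD2r.
transitivity (\int[U01 R]_t (y t + A * Q t + (A * m * P t - A * I * y t))).
  apply: U01_eq_Rintegral.
  - by apply: measurable_funM => //; exact: measurable_bbT.
  - apply: measurable_funD; last by apply: measurable_funB; apply: measurable_funM.
    by apply: measurable_funD => //; apply: measurable_funM => //; exact: measurable_funM.
  - move=> t /andP[t0 t1]; rewrite patchE mem_set/= ?in_itv/= ?t1 ?ltW//.
    by rewrite nuE ?t0// /Q; ring.
have i1 := integrableZl measurableT A iQ.
have i2 := integrableZl measurableT (A * m) iP.
have i3 := integrableZl measurableT (A * I) iy.
rewrite RintegralD//; last 2 first.
- exact: (integrableD measurableT iy i1).
- exact: (integrableB measurableT i2 i3).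
rewrite RintegralD// RintegralB// !RintegralZl// -/I -/m.
by rewrite [A * m * I]mulrAC subrr addr0.
Qed.

(* Normalized so that its tail average from a is (1 - a) ^ i. *)
Definition moment_fun i : R -> R := (fun t : R => i.+1%:R * (1 - t) ^+ i) \_ `[0, 1].

Lemma moment_funE i (t : R) : 0 <= t <= 1 -> moment_fun i t = i.+1%:R * (1 - t) ^+ i.
Proof. by move=> t01; rewrite /moment_fun patchE mem_set//= in_itv. Qed.

Lemma onem_exp_le1 i (t : R) : 0 <= t <= 1 -> 0 <= (1 - t) ^+ i <= 1.
Proof.
move=> /andP[t0 t1]; rewrite exprn_ge0 ?subr_ge0//= exprn_ile1 ?subr_ge0//.
by rewrite lerBlDr lerDl.
Qed.

Lemma measurable_moment_fun i : measurable_fun setT (moment_fun i).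
Proof.
apply/(measurable_restrictT _ _).1 => //; apply: measurable_funTS.
apply: measurable_funM => //; apply: measurable_funX; exact: measurable_funB.
Qed.

Lemma moment_fun_bounded i t : `|moment_fun i t| <= i.+1%:R.
Proof.
rewrite /moment_fun patchE; case: ifPn => [|_]; last by rewrite normr0.
rewrite inE/= in_itv/= => /(onem_exp_le1 i)/andP[h0 h1].
by rewrite ger0_norm ?mulr_ge0// ler_piMr.
Qed.

(** With y this function, w + e y stays nondecreasing as soon as |e| times the Lipschitz constant is
    at most the rate of increase of w. *)
Lemma moment_fun_lipschitz i (s t : R) : 0 < s -> s <= t -> t < 1 ->
  `|moment_fun i t - moment_fun i s| <= i.+1%:R * i%:R * (t - s).
Proof.
move=> s0 st t1.
have s01 : 0 <= s <= 1 by rewrite ltW//= (le_trans st)// ltW.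
have t01 : 0 <= t <= 1 by rewrite (ltW t1) andbT (le_trans (ltW s0)).
rewrite !moment_funE// -mulrBr normrM ger0_norm// -mulrA ler_wpM2l//.
elim: i => [|i ih]; first by rewrite !expr0 subrr normr0 mul0r.
have -> : (1 - t) ^+ i.+1 - (1 - s) ^+ i.+1 =
  (1 - t) * ((1 - t) ^+ i - (1 - s) ^+ i) - (t - s) * (1 - s) ^+ i.
  by rewrite !exprS; ring.
have -> : i.+1%:R * (t - s) = i%:R * (t - s) + (t - s) by rewrite -natr1; ring.
rewrite (le_trans (ler_normB _ _))// lerD//.
  rewrite normrM -[leRHS]mul1r; apply: ler_pM => //.
  by rewrite ler_norml; apply/andP; split; lra.
have /andP[h0 h1] := onem_exp_le1 i s01.
by rewrite normrM (ger0_norm h0) ger0_norm ?subr_ge0// ler_piMr// subr_ge0.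
Qed.

Lemma moment_fun_rc i (t : R) : 0 < t < 1 -> moment_fun i x @[x --> t^'+] --> moment_fun i t.
Proof.
move=> /andP[t0 t1].
have : (i.+1%:R * (1 - x) ^+ i) @[x --> t^'+] --> moment_fun i t.
  rewrite moment_funE ?(ltW t0) ?(ltW t1)//.
  apply: cvg_at_right_filter; apply: cvgM; first exact: cvg_cst.
  apply: (@cvg_comp _ _ _ (fun x => 1 - x) (fun x => x ^+ i)).
    by apply: cvgB; [exact: cvg_cst|exact: cvg_id].
  exact: exprn_continuous.
apply: cvg_trans; apply: near_eq_cvg; near=> x.
rewrite moment_funE//; apply/andP; split.
  by apply: (le_trans (ltW t0)); near: x; exact: nbhs_right_ge.
by near: x; exact: nbhs_right_le.
Unshelve. all: by end_near. Qed.

Lemma tail_average_moment i (a : R) : 0 <= a < 1 ->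
  tail_average (moment_fun i) a = (1 - a) ^+ i.
Proof.
move=> /andP[a0 a1]; rewrite /tail_average.
suff -> : \int[U01 R]_(t in `[a, 1]) moment_fun i t = (1 - a) ^+ i.+1.
  by rewrite exprS mulKf// subr_eq0 gt_eqF.
transitivity (\int[lebesgue_measure]_(t in `[a, 1]) (i.+1%:R * (1 - t) ^+ i)).
  rewrite /Rintegral; congr fine; rewrite -integral_U01_sub//.
  - apply: eq_integral => t; rewrite inE/= in_itv/= => /andP[at' t1].
    by rewrite moment_funE// t1 (le_trans a0).
  - by move=> t /=; rewrite !in_itv/= => /andP[/(le_trans a0) -> ->].
  - apply/measurable_EFinP; apply: measurable_funTS; exact: measurable_moment_fun.
rewrite /Rintegral.
rewrite (@continuous_FTC2 _ _ (fun x => - (1 - x) ^+ i.+1))//=.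
- by rewrite subrr expr0n/= oppr0 add0r opprK.
- apply: continuous_in_subspaceT => x _.
  by apply: cvgM; [exact: cvg_cst|exact: continuous_onemXn].
- have h := @derivable_oo_LRcontinuous_onemXnMr R i.+1 (-1).
  have -> : (fun x : R => - (1 - x) ^+ i.+1) = (fun x => unstable.onem x ^+ i.+1 * -1).
    by apply/funext => x; rewrite mulrN1.
  split.
  + by move=> x _; apply: derivableM => //; exact: onemXn_derivable.
  + apply: cvg_at_right_filter; apply: cvgM; last exact: cvg_cst.
    exact: continuous_onemXn.
  + apply: cvg_at_left_filter; apply: cvgM; last exact: cvg_cst.
    exact: continuous_onemXn.
- move=> x _.
  have -> : (fun x : R => - (1 - x) ^+ i.+1) = (fun x => unstable.onem x ^+ i.+1 * -1).
    by apply/funext => u; rewrite mulrN1.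
  rewrite derive1Mr; last exact: onemXn_derivable.
  by rewrite derive_onemXn mulrN1 mulNr opprK.
Qed.

(** This links the moments in the criterion for weak convergence to the directions in which w is
    perturbed. *)
Lemma mean01_moment nu i :
  mean01 nu (fun x => (1 - x) ^+ i) = spectral_mean nu (moment_fun i).
Proof.
apply: EFin_inj.
rewrite -(spectral_mean_tail_average nu (measurable_moment_fun i) (moment_fun_bounded i)).
rewrite /mean01 /Rintegral fineK.
  apply: eq_integral => a; rewrite inE/= in_itv/= => a01.
  by rewrite tail_average_moment.
apply: integrable_fin_num; first exact: measurable_itv.
apply: (@mean01_integrable _ _ _ 1).
  by apply: measurable_funTS; apply: measurable_funX; exact: measurable_funB.
move=> x /andP[x0 x1]; have /(onem_exp_le1 i)/andP[h0 h1] : 0 <= x <= 1.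
  by rewrite x0 ltW.
by rewrite ger0_norm.
Qed.

(** Convexity of x_+^p: the tangent at x lies below the graph at y. It comes from Young's inequality
    for y_+ and x_+^(p-1), so nothing has to be differentiated. *)
Lemma powR_pos_tangent p (x y : R) : 1 < p ->
  Num.max x 0 `^ p <= Num.max y 0 `^ p + p * (x - y) * Num.max x 0 `^ (p - 1).
Proof.
move=> p1; have p0 : 0 < p by apply: lt_trans p1.
have p10 : 0 < p - 1 by rewrite subr_gt0.
set X := Num.max x 0; set Y := Num.max y 0.
have X0 : 0 <= X by rewrite le_max lexx orbT.
have Y0 : 0 <= Y by rewrite le_max lexx orbT.
have yY : y <= Y by rewrite le_max lexx.
have XX : x * X `^ (p - 1) = X `^ p.
  rewrite /X; case: (lerP x 0) => h.
    by rewrite !powR0 ?mulr0// gt_eqF.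
  by rewrite -{1}[x]powRr1 ?(ltW h)// -powRD ?subrKC// ?gt_eqF//; apply/implyP => _; rewrite gt_eqF.
have young := @conjugate_powR R Y (X `^ (p - 1)) p (p / (p - 1)) Y0 (powR_ge0 _ _) p0.
have {}young : Y * X `^ (p - 1) <= Y `^ p / p + X `^ p / (p / (p - 1)).
  have E : (X `^ (p - 1)) `^ (p / (p - 1)) = X `^ p.
    by rewrite -powRrM mulrC divfK// gt_eqF.
  rewrite -E; apply: young; first by rewrite divr_gt0.
  by rewrite invf_div -{1}(mul1r p^-1) -mulrDl addrC subrK divff// gt_eqF.
have yXY : y * X `^ (p - 1) <= Y * X `^ (p - 1) by rewrite ler_wpM2r// powR_ge0.
have -> : p * (x - y) * X `^ (p - 1) = p * X `^ p - p * (y * X `^ (p - 1)).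
  by rewrite -XX; ring.
have h : p * (y * X `^ (p - 1)) <= Y `^ p + (p - 1) * X `^ p.
  have -> : Y `^ p + (p - 1) * X `^ p = p * (Y `^ p / p + X `^ p / (p / (p - 1))).
    by field; rewrite !gt_eqF.
  by rewrite ler_pM2l// (le_trans yXY).
by lra.
Qed.

(** Concavity of the p-th root: its tangent at s^p, of slope s^(1-p) / p, lies above the graph. It
    is Young's inequality for X^(1/p) and s^(p-1), multiplied by s^(1-p). *)
Lemma powR_root_tangent p (X s : R) : 1 < p -> 0 <= X -> 0 < s ->
  X `^ p^-1 <= s + s `^ (1 - p) / p * (X - s `^ p).
Proof.
move=> p1 X0 s0; have p0 : 0 < p by apply: lt_trans p1.
have p10 : 0 < p - 1 by rewrite subr_gt0.
have young : X `^ p^-1 * s `^ (p - 1) <= X / p + s `^ p / (p / (p - 1)).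
  have E1 : (X `^ p^-1) `^ p = X by rewrite -powRrM mulVf ?gt_eqF// powRr1.
  have E2 : (s `^ (p - 1)) `^ (p / (p - 1)) = s `^ p.
    by rewrite -powRrM mulrC divfK// gt_eqF.
  rewrite -{2}E1 -E2; apply: conjugate_powR; rewrite ?powR_ge0 ?divr_gt0//.
  by rewrite invf_div -{1}(mul1r p^-1) -mulrDl addrC subrK divff// gt_eqF.
have s1p : s `^ (1 - p) * s `^ (p - 1) = 1.
  rewrite -powRD; last by apply/implyP => _; rewrite gt_eqF.
  by rewrite (_ : 1 - p + (p - 1) = 0) ?powRr0//; ring.
have sp : s `^ (1 - p) * s `^ p = s.
  rewrite -powRD; last by apply/implyP => _; rewrite gt_eqF.
  by rewrite subrK powRr1// ltW.
have -> : s + s `^ (1 - p) / p * (X - s `^ p) =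
    s `^ (1 - p) * (X / p + s `^ p / (p / (p - 1))).
  have -> : s `^ (1 - p) * (X / p + s `^ p / (p / (p - 1))) =
    s `^ (1 - p) / p * X + (s `^ (1 - p) * s `^ p) * (1 - p^-1).
    by field; rewrite !gt_eqF.
  have -> : s `^ (1 - p) / p * (X - s `^ p) =
    s `^ (1 - p) / p * X - (s `^ (1 - p) * s `^ p) / p by field; rewrite gt_eqF.
  by rewrite sp; field; rewrite gt_eqF.
have -> : X `^ p^-1 = s `^ (1 - p) * (X `^ p^-1 * s `^ (p - 1)).
  by rewrite mulrCA s1p mulr1.
by rewrite ler_pM2l ?powR_gt0.
Qed.

End spectral_mean.

(** * Exposed measures *)

Section exposed.
Context {R : realType}.
Implicit Types (nu : frakP R) (x y z w : R -> R) (p lam : R).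

Lemma measurable_pos_powR (r : R) z : measurable_fun setT z ->
  measurable_fun setT (fun t => pos_part z t `^ r).
Proof.
move=> mz; apply: (measurableT_comp (measurable_powR r)) => //.
exact: measurable_maxr.
Qed.

Lemma pos_powR_bounded (r : R) z (M t : R) : 0 <= r -> `|z t| <= M ->
  0 <= pos_part z t `^ r <= M `^ r.
Proof.
move=> r0 zM; rewrite powR_ge0/=; apply: ge0_ler_powR => //.
- by rewrite nnegrE pos_part_ge0.
- by rewrite nnegrE (le_trans _ zM).
- rewrite /pos_part ge_max (le_trans (ler_norm _) zM)/=.
  exact: le_trans zM.
Qed.

Lemma dev_pos_powR_integrable (r c : R) z y (M N : R) : 0 <= r ->
  measurable_fun setT z -> (forall t, `|z t| <= M) ->
  measurable_fun setT y -> (forall t, `|y t| <= N) ->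
  (U01 R).-integrable setT (EFin \o (fun t => (y t - c) * pos_part z t `^ r)).
Proof.
move=> r0 mz zM my yN; apply: (@U01_bounded_integrable _ _ ((N + `|c|) * M `^ r)).
  apply: measurable_funM; first exact: measurable_funB.
  exact: measurable_pos_powR.
move=> t; have /andP[h0 h1] := pos_powR_bounded r0 (zM t).
rewrite normrM (ger0_norm h0); apply: ler_pM => //.
by rewrite (le_trans (ler_normB _ _))// lerD2r.
Qed.

(* At x = w this is the derivative of the semideviation at a centered w in the
   direction y; for x = w + e (y - E y) it bounds the difference quotient. *)
Definition semidev_slope p lam w x y : R :=
  \int[U01 R]_t y t + lam * ((\int[U01 R]_t (pos_part w t `^ p)) `^ p^-1) `^ (1 - p) *
    \int[U01 R]_t ((y t - \int[U01 R]_u y u) * pos_part x t `^ (p - 1)).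

(** Convexity of x_+^p is used at the perturbed point and concavity of the root at the unperturbed
    value K. This gives an upper bound without remainder for e of either sign; all dependence on the
    size of e sits in the point where the slope is taken. *)
Lemma semidev_tangent p lam w y (M N e : R) : 1 < p -> 0 <= lam ->
  measurable_fun setT w -> (forall t, `|w t| <= M) ->
  measurable_fun setT y -> (forall t, `|y t| <= N) ->
  \int[U01 R]_t w t = 0 -> 0 < \int[U01 R]_t (pos_part w t `^ p) ->
  semidev p lam (fun t => w t + e * y t) <= semidev p lam w +
    e * semidev_slope p lam w (fun t => w t + e * (y t - \int[U01 R]_u y u)) y.
Proof.
move=> p1 lam0 mw wM my yN w0; set K := Rintegral _ _ _ => K0.
have p0 : 0 < p by apply: lt_trans p1.
have iw := U01_bounded_integrable mw wM.
have iy := U01_bounded_integrable my yN.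
rewrite /semidev_slope -/K; set m := \int[U01 R]_u y u.
set x := fun t => w t + e * (y t - m); set s := K `^ p^-1.
pose J := \int[U01 R]_t ((y t - m) * pos_part x t `^ (p - 1)); rewrite -/J.
have mx : measurable_fun setT x.
  by apply: measurable_funD => //; apply: measurable_funM => //; exact: measurable_funB.
have xB t : `|x t| <= M + `|e| * (N + `|m|).
  rewrite (le_trans (ler_normD _ _))// lerD// normrM ler_wpM2l//.
  by rewrite (le_trans (ler_normB _ _))// lerD2r.
have E1 : \int[U01 R]_t (w t + e * y t) = e * m.
  rewrite RintegralD//; last exact: (integrableZl measurableT e iy).
  by rewrite w0 add0r RintegralZl.
rewrite /semidev E1 w0 add0r.
have -> : (fun s0 => w s0 + e * y s0 - e * m) = x.
  by apply/funext => t; rewrite /x; ring.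
have -> : (fun s0 => w s0 - 0) = w by apply/funext => t; rewrite subr0.
rewrite -/K -/s; set X := \int[U01 R]_t _.
have iKp : (U01 R).-integrable setT (EFin \o (fun t => pos_part w t `^ p)).
  apply: (@U01_bounded_integrable _ _ (M `^ p)); first exact: measurable_pos_powR.
  by move=> t; have /andP[h0 h1] := pos_powR_bounded (ltW p0) (wM t); rewrite (ger0_norm h0).
have iXp : (U01 R).-integrable setT (EFin \o (fun t => pos_part x t `^ p)).
  apply: (@U01_bounded_integrable _ _ ((M + `|e| * (N + `|m|)) `^ p)).
    exact: measurable_pos_powR.
  by move=> t; have /andP[h0 h1] := pos_powR_bounded (ltW p0) (xB t); rewrite (ger0_norm h0).
have iJ : (U01 R).-integrable setT (EFin \o (fun t => (y t - m) * pos_part x t `^ (p - 1))).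
  by apply: (dev_pos_powR_integrable _ _ mx xB my yN); rewrite subr_ge0 ltW.
have XK : X <= K + p * e * J.
  have iJ' := integrableZl measurableT (p * e) iJ.
  rewrite /J -RintegralZl// -RintegralD//.
  apply: le_Rintegral => //; first exact: (integrableD measurableT iKp iJ').
  move=> t _; have := powR_pos_tangent (x t) (w t) p1; rewrite -!/(pos_part _ _).
  by rewrite (_ : x t - w t = e * (y t - m)); [rewrite !mulrA|rewrite /x; ring].
have s0 : 0 < s by rewrite powR_gt0.
have sK : s `^ p = K by rewrite /s -powRrM mulVf ?gt_eqF// powRr1// ltW.
have X0 : 0 <= X by apply: Rintegral_ge0 => t _; exact: powR_ge0.
have h1 := powR_root_tangent p1 X0 s0.
have h2 : s `^ (1 - p) / p * (X - s `^ p) <= s `^ (1 - p) * (e * J).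
  rewrite -mulrA ler_wpM2l ?powR_ge0// mulrC ler_pdivrMr// sK.
  by rewrite lerBlDl (_ : e * J * p = p * e * J) //; ring.
have h3 : lam * X `^ p^-1 <= lam * (s + s `^ (1 - p) * (e * J)).
  by rewrite ler_wpM2l//; lra.
apply: le_trans (lerD (lexx (e * m)) h3) _.
by rewrite le_eqVlt; apply/orP; left; apply/eqP; ring.
Qed.

Lemma semidev_slope_cvg p lam w y (M N c : R) (e : nat -> R) : 1 < p ->
  measurable_fun setT w -> (forall t, `|w t| <= M) ->
  measurable_fun setT y -> (forall t, `|y t| <= N) ->
  (forall n, `|e n| <= c) -> e n @[n --> \oo] --> 0 ->
  semidev_slope p lam w (fun t => w t + e n * (y t - \int[U01 R]_u y u)) y @[n --> \oo] -->
    semidev_slope p lam w w y.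
Proof.
move=> p1 mw wM my yN ec e0; have p10 : 0 < p - 1 by rewrite subr_gt0.
rewrite /semidev_slope; set m := \int[U01 R]_u y u.
have N0 : 0 <= N by exact: le_trans (yN 0).
have c0 : 0 <= c by exact: le_trans (ec 0).
apply: cvgD; first exact: cvg_cst.
apply: cvgM; first exact: cvg_cst.
pose x n t := w t + e n * (y t - m).
have mx n : measurable_fun setT (x n).
  by apply: measurable_funD => //; apply: measurable_funM => //; exact: measurable_funB.
have yB t : `|y t - m| <= N + `|m| by rewrite (le_trans (ler_normB _ _))// lerD2r.
have xB n t : `|x n t| <= M + c * (N + `|m|).
  by rewrite (le_trans (ler_normD _ _))// lerD// normrM ler_pM.
pose B := (N + `|m|) * (M + c * (N + `|m|)) `^ (p - 1).
have [] // := @U01_dominated _ (fun n t => (y t - m) * pos_part (x n) t `^ (p - 1))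
  (fun t => (y t - m) * pos_part w t `^ (p - 1)) (cst B).
- move=> n; apply: measurable_funM; first exact: measurable_funB.
  exact: measurable_pos_powR.
- apply: measurable_funM; first exact: measurable_funB.
  exact: measurable_pos_powR.
- by apply: (@U01_bounded_integrable _ _ `|B|).
- move=> n t _; have /andP[h0 h1] := pos_powR_bounded (ltW p10) (xB n t).
  by rewrite normrM (ger0_norm h0) /B; apply: ler_pM.
move=> t _; apply: cvgM; first exact: cvg_cst.
have xt : x n t @[n --> \oo] --> w t.
  rewrite -[X in _ --> X]addr0; apply: cvgD; first exact: cvg_cst.
  by rewrite -[X in _ --> X](mul0r (y t - m)); apply: cvgM => //; exact: cvg_cst.
exact: (@continuous_cvg _ _ _ _ _ (fun n => x n t) (fun u : R => Num.max u 0 `^ (p - 1))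
  (w t) (@pos_powR_continuous _ _ p10 (w t)) xt).
Qed.

Section closed_Kusuoka_set.
Context (p lam : R) (N : set (frakP R)) (p1 : 1 < p) (lam0 : 0 <= lam)
  (NK : Kusuoka_set p (semideviation p lam) N).

Let bounded_in_Lp z (M : R) : measurable_fun setT z -> (forall t, `|z t| <= M) ->
  in_Lp p%:E z.
Proof. by move=> mz zM; apply: in_Lp_bounded mz zM; rewrite lee_fin ltW. Qed.

Lemma Kusuoka_sup z (M : R) : measurable_fun setT z -> (forall t, `|z t| <= M) ->
  (forall s t, 0 < s -> s <= t -> t < 1 -> z s <= z t) ->
  (forall t, 0 < t < 1 -> z x @[x --> t^'+] --> z t) ->
  ((semidev p lam z)%:E = ereal_sup [set (spectral_mean nu z)%:E | nu in N])%E.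
Proof.
move=> mz zM znd zrc; have zp := bounded_in_Lp mz zM.
rewrite -(@semideviation_semidev _ p lam (U01_rv mz) (ltW p1) zp).
rewrite (NK (Z := U01_rv mz) zp); congr ereal_sup; apply: eq_imagel => nu _.
by have := AVaR_spectral_mean nu mz zM znd zrc.
Qed.

(* The test function z = w + e y stays nondecreasing for small |e|, so measures of
   N nearly attaining the supremum at w satisfy
   e * spectral_mean y <= semidev z - semidev w + o(1) for both signs of e. *)
Lemma exposed_in_closed_Kusuoka w (M k : R) nu : closed N ->
  measurable_fun setT w -> (forall t, `|w t| <= M) -> 0 < k ->
  (forall s t, 0 < s -> s <= t -> t < 1 -> k * (t - s) <= w t - w s) ->
  (forall t, 0 < t < 1 -> w x @[x --> t^'+] --> w t) ->
  \int[U01 R]_t w t = 0 -> 0 < \int[U01 R]_t (pos_part w t `^ p) ->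
  (forall i, spectral_mean nu (moment_fun i) = semidev_slope p lam w w (moment_fun i)) ->
  N nu.
Proof.
move=> Ncl mw wM k0 wk wrc w0 K0 nuE.
have aux1 (a b c d f g : R) : a + b <= c -> c <= d + f -> d - g < a -> b - f <= g by lra.
have aux2 (a b c d f g : R) : - (f * (b - a)) <= g -> g <= d - c -> c + f * a <= d + f * b.
  by lra.
have aux3 (a b d f r X : R) : 0 < f -> `|r - a| <= d / 2 -> `|r - b| <= d / 2 ->
    f * (X - a) <= f * (d / 2) -> - f * (X - b) <= f * (d / 2) -> `|r - X| <= d.
  move=> f0; rewrite mulNr -mulrN !ler_pM2l// !ler_distl => /andP[h1 h2] /andP[h3 h4] h5 h6.
  by apply/andP; split; lra.
have wnd s t : 0 < s -> s <= t -> t < 1 -> w s <= w t.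
  move=> s0 st t1; rewrite -subr_ge0 (le_trans _ (wk _ _ s0 st t1))//.
  by rewrite mulr_ge0 ?subr_ge0// ltW.
have supw := Kusuoka_sup mw wM wnd wrc.
have /choice[u hu] : forall n : nat, exists nu', N nu' /\
    semidev p lam w - n.+1%:R^-1 < spectral_mean nu' w.
  move=> n; have n0 : 0 < n.+1%:R^-1 :> R by rewrite invr_gt0.
  have := ub_ereal_sup_adherent (S := [set (spectral_mean nu' w)%:E | nu' in N]) n0.
  rewrite -supw => /(_ isT)[_ [nu' Nnu' <-]] h.
  by exists nu'; split => //; move: h; rewrite -EFinB lte_fin.
have Ncu n : N (u n) by have [] := hu n.
suff : u @ \oo --> nu by apply: closed_cvg => //; exact: nearW.
apply: weak_cvg_moments => i; under eq_fun do rewrite mean01_moment.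
rewrite mean01_moment nuE.
set y := moment_fun i; set r := semidev_slope _ _ _ _ _.
have my : measurable_fun setT y := measurable_moment_fun i.
have yB t : `|y t| <= i.+1%:R := moment_fun_bounded i t.
pose L : R := i.+1%:R * i%:R; have L0 : 0 <= L by rewrite mulr_ge0.
pose m := \int[U01 R]_u y u.
pose sl (e : R) := semidev_slope p lam w (fun t => w t + e * (y t - m)) y.
have key (e : R) n : `|e| * L <= k -> e * (spectral_mean (u n) y - sl e) <= n.+1%:R^-1.
  move=> eL.
  have mz : measurable_fun setT (fun t => w t + e * y t).
    by apply: measurable_funD => //; exact: measurable_funM.
  have zB t : `|w t + e * y t| <= M + `|e| * i.+1%:R.
    by rewrite (le_trans (ler_normD _ _))// lerD// normrM ler_wpM2l.
  have znd s t : 0 < s -> s <= t -> t < 1 -> w s + e * y s <= w t + e * y t.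
    move=> s0 st t1; have h1 := wk s t s0 st t1.
    have h2 := moment_fun_lipschitz i s0 st t1; rewrite -/y -/L in h2.
    have h3 : - (e * (y t - y s)) <= k * (t - s).
      apply: (@le_trans _ _ (`|e| * (L * (t - s)))).
        apply: (le_trans (ler_norm _)); rewrite normrN normrM.
        by apply: ler_wpM2l.
      by rewrite mulrA; apply: ler_wpM2r; rewrite ?subr_ge0.
    exact: aux2 h3 h1.
  have zrc t : 0 < t < 1 -> (w x + e * y x) @[x --> t^'+] --> w t + e * y t.
    move=> t01; apply: cvgD; first exact: wrc.
    by apply: cvgM; [exact: cvg_cst|exact: moment_fun_rc].
  have h1 : spectral_mean (u n) (fun t => w t + e * y t) <=
      semidev p lam (fun t => w t + e * y t).
    rewrite -lee_fin (Kusuoka_sup mz zB znd zrc); apply: ereal_sup_ubound.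
    by exists (u n).
  have h2 := semidev_tangent e p1 lam0 mw wM my yB w0 K0.
  have h3 := (hu n).2.
  rewrite (spectral_meanD _ _ mw wM my yB) in h1.
  rewrite -/m -/(sl e) in h2; rewrite mulrBr.
  exact: aux1 h1 h2 h3.
(* The factor k / (L + 1) ensures |e| L <= k; the summand 1 avoids a division by 0 at i = 0, where L
   = 0. *)
pose e n : R := k / (L + 1) * n.+1%:R^-1.
have L10 : 0 < L + 1 by rewrite ltr_wpDl.
have e_gt0 n : 0 < e n by rewrite mulr_gt0 ?divr_gt0 ?invr_gt0.
have n1 n : n.+1%:R^-1 <= 1 :> R by rewrite invf_le1// ler1n.
have eLk n : e n * L <= k.
  apply: (@le_trans _ _ (k / (L + 1) * L)).
    by rewrite ler_wpM2r// ler_piMr// divr_ge0// ltW.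
  by rewrite mulrAC ler_pdivrMr// ler_wpM2l ?(ltW k0)// lerDl.
have ek n : e n <= k / (L + 1) by rewrite ler_piMr// divr_ge0// ltW.
have e_cvg : e n @[n --> \oo] --> 0.
  rewrite -[X in _ --> X](mulr0 (k / (L + 1))).
  by apply: cvgM; [exact: cvg_cst|exact: cvg_harmonic].
have slp : sl (e n) @[n --> \oo] --> r.
  apply: (@semidev_slope_cvg p lam w y _ _ (k / (L + 1)) e p1 mw wM my yB) => // n.
  by rewrite gtr0_norm; [exact: ek|exact: e_gt0].
have sln : sl (- e n) @[n --> \oo] --> r.
  apply: (@semidev_slope_cvg p lam w y _ _ (k / (L + 1)) (fun n => - e n) p1 mw wM my yB).
    by move=> n; rewrite normrN gtr0_norm; [exact: ek|exact: e_gt0].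
  by rewrite -[X in _ --> X]oppr0; exact: cvgN.
apply/cvgrPdist_le => d d0; have d20 : 0 < d / 2 by rewrite divr_gt0.
(* The step f = e n is fixed first, so that the slopes for f and - f are both within d / 2 of r.
   Only then does j grow, until the defect 1 / (j + 1) is below f d / 2 and survives division by
   f. *)
have [n [hp hn]] : exists n, `|r - sl (e n)| <= d / 2 /\ `|r - sl (- e n)| <= d / 2.
  apply: (@filter_ex _ (\oo : set_system nat)); apply: filterI.
    by move: slp => /cvgrPdist_le; apply.
  by move: sln => /cvgrPdist_le; apply.
have en0 := e_gt0 n; have eLn := eLk n; move: (e n) en0 eLn hp hn => f f0 fL hp hn.
have fd : 0 < f * (d / 2) by rewrite mulr_gt0.
have : \forall j \near \oo, j.+1%:R^-1 <= f * (d / 2).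
  have /cvgrPdist_le/(_ _ fd) := @cvg_harmonic R.
  apply: filterS => j; rewrite sub0r normrN; apply: le_trans.
  exact: (ler_norm (harmonic j)).

apply: filterS => j hj.
have kp : f * (spectral_mean (u j) y - sl f) <= f * (d / 2).
  by apply: le_trans (key f j _) hj; rewrite gtr0_norm.
have kn : - f * (spectral_mean (u j) y - sl (- f)) <= f * (d / 2).
  by apply: le_trans (key (- f) j _) hj; rewrite normrN gtr0_norm.
exact: aux3 f0 hp hn kp kn.
Qed.

End closed_Kusuoka_set.
End exposed.

(** * Approximation by exposed measures *)

Section truncation.
Context {R : realType}.
Implicit Types (mu nu : frakP R) (w y g : R -> R) (p lam a k : R).

(* Young's inequality gives (int w_+^p)^(1/p) * int w_+^(p-1) <= int w_+^p; together
   with lam <= 1 this makes the density of the measure nonnegative. *)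
Lemma semidev_slope_realized p lam w (M : R) : 1 < p -> 0 <= lam -> lam <= 1 ->
  measurable_fun setT w -> (forall t, `|w t| <= M) ->
  (forall s t, 0 <= s -> s <= t -> t < 1 -> w s <= w t) ->
  (forall t, 0 <= t < 1 -> w x @[x --> t^'+] --> w t) ->
  0 < \int[U01 R]_t (pos_part w t `^ p) ->
  exists nu, forall y (L : R), measurable_fun setT y -> (forall t, `|y t| <= L) ->
    spectral_mean nu y = semidev_slope p lam w w y.
Proof.
move=> p1 lam0 lam1 mw wM wnd wrc; set K := \int[U01 R]_t _ => K0.
have p0 : 0 < p by apply: lt_trans p1.
have p10 : 0 < p - 1 by rewrite subr_gt0.
set s := K `^ p^-1; have s0 : 0 < s by rewrite powR_gt0.
have sK : s `^ p = K by rewrite /s -powRrM mulVf ?gt_eqF// powRr1// ltW.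
have ss : s * s `^ (p - 1) = K by rewrite -sK -{1}(powRr1 (ltW s0)) -powRD ?subrKC// gt_eqF.
pose P t := pos_part w t `^ (p - 1); pose I := \int[U01 R]_t P t.
have mP : measurable_fun setT P by exact: measurable_pos_powR.
have PB t : `|P t| <= M `^ (p - 1).
  have /andP[h0 h1] := pos_powR_bounded (ltW p10) (wM t).
  by rewrite (ger0_norm h0).
have P0 t : 0 <= P t by exact: powR_ge0.
have iP := U01_bounded_integrable mP PB.
have I0 : 0 <= I by apply: Rintegral_ge0.
have iKp : (U01 R).-integrable setT (EFin \o (fun t => pos_part w t `^ p)).
  apply: (@U01_bounded_integrable _ _ (M `^ p)); first exact: measurable_pos_powR.
  by move=> t; have /andP[h0 h1] := pos_powR_bounded (ltW p0) (wM t); rewrite (ger0_norm h0).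
have wP t : (pos_part w t - s) * P t = pos_part w t `^ p - s * P t.
  rewrite mulrBl; congr (_ - _); rewrite /P.
  have [->|w0] := eqVneq (pos_part w t) 0; first by rewrite mul0r powR0 ?gt_eqF.
  have wp : 0 < pos_part w t by rewrite lt0r w0 pos_part_ge0.
  by rewrite -{1}(powRr1 (ltW wp)) -powRD ?subrKC// gt_eqF.
have sI : s * I <= K.
  have i1 := integrableZl measurableT s iP.
  have i2 := integrableB measurableT iKp i1.
  pose T t := p * (pos_part w t `^ p - s * P t).
  have iT : (U01 R).-integrable setT (EFin \o T) := integrableZl measurableT p i2.
  have iK : (U01 R).-integrable setT (EFin \o cst K) := finite_measure_integrable_cst _ K measurableT.
  (* The tangent inequality between w_+ and the constant s, with s^p = K, is integrated: K cancels
     and 0 <= K - s I remains. *)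
  have : K <= \int[U01 R]_t (cst K t + T t).
    apply: le_Rintegral => //; first exact: (integrableD measurableT iK iT).
    move=> t _; have := @powR_pos_tangent _ p (pos_part w t) s p1.
    rewrite -/(pos_part w t) (max_idPl (pos_part_ge0 w t)) (max_idPl (ltW s0)) sK.
    by rewrite -mulrA -/(P t) wP.
  rewrite RintegralD// Rintegral_U01_cst RintegralZl// RintegralB// RintegralZl// -/K -/I.
  by rewrite lerDl pmulr_rge0// subr_ge0.
have s1 : s `^ (1 - p) * s `^ (p - 1) = 1.
  rewrite -powRD; last by apply/implyP => _; rewrite gt_eqF.
  by rewrite (_ : 1 - p + (p - 1) = 0) ?powRr0//; ring.
pose A := lam * s `^ (1 - p); have A0 : 0 <= A by rewrite mulr_ge0 ?powR_ge0.
have AI : A * I <= 1.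
  apply: le_trans lam1; rewrite -[leRHS]mulr1 -mulrA ler_wpM2l// -[leRHS]s1.
  by rewrite ler_wpM2l ?powR_ge0// -(ler_pM2l s0) ss.
pose S t : R := 1 - A * I + A * P t.
have iC : (U01 R).-integrable setT (EFin \o cst (1 - A * I)) :=
  finite_measure_integrable_cst _ _ measurableT.
have iAP := integrableZl measurableT A iP.
have mS : measurable_fun setT S by apply: measurable_funD => //; exact: measurable_funM.
have iS : (U01 R).-integrable setT (EFin \o S) := integrableD measurableT iC iAP.
have S1 : \int[U01 R]_t S t = 1.
  rewrite RintegralD//.
  by rewrite Rintegral_U01_cst RintegralZl// -/I subrK.
have mSr : measurable_fun setT (S \_ `[0, 1[).
  by apply/(measurable_restrictT _ _).1 => //; exact: measurable_funTS.
have SE t : 0 < t < 1 -> (S \_ `[0, 1[) t = S t.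
  by move=> /andP[t0 t1]; rewrite patchE mem_set//= in_itv/= ltW.
have Ssp : spectral S.
  split.
  - by move=> t _; rewrite addr_ge0 ?subr_ge0// mulr_ge0.
  - move=> u t u0 ut t1; rewrite lerD2l ler_wpM2l// ge0_ler_powR ?nnegrE ?pos_part_ge0//.
      exact: ltW.
    by rewrite /pos_part; apply: le_max2; [exact: wnd|exact: lexx].
  - move=> t t01; apply: cvgD; first exact: cvg_cst.
    apply: cvgM; first exact: cvg_cst.
    exact: (@continuous_cvg _ _ _ _ _ w (fun u : R => Num.max u 0 `^ (p - 1)) (w t)
      (@pos_powR_continuous _ _ p10 (w t)) (wrc t t01)).
  - rewrite spectral_integralE//.
    have iSr := U01_eq_integrable mSr SE iS.
    rewrite -[LHS]fineK; last exact: (integrable_fin_num _ iSr).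
    rewrite -[fine _]/(\int[U01 R]_t ((S \_ `[0, 1[) t)).
    by rewrite (U01_eq_Rintegral mSr mS SE) S1.
have [nu nuE] := bbT_surjective Ssp mSr.
exists nu => y L my yL; rewrite /spectral_mean /semidev_slope -/K -/s -/A.
apply: (spectral_mean_affine iP _ my yL) => t /andP[t0 t1].
by rewrite nuE ?(ltW t0).
Qed.

(* k t + min (g t) n on [a, 1[, lowered to k t - B on [0, a[ where the constant B
   restores mean zero. *)
Lemma centered_truncation g (n a k : R) : measurable_fun setT g ->
  (forall t, 0 <= t < 1 -> 0 <= g t) ->
  (forall s t, 0 <= s -> s <= t -> t < 1 -> g s <= g t) ->
  (forall t, 0 <= t < 1 -> g x @[x --> t^'+] --> g t) ->
  0 <= n -> 0 < a < 1 -> 0 < k <= 1 ->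
  exists w, [/\ measurable_fun setT w /\ (exists M : R, forall t, `|w t| <= M),
    forall s t, 0 <= s -> s <= t -> t < 1 -> k * (t - s) <= w t - w s,
    forall t, 0 <= t < 1 -> w x @[x --> t^'+] --> w t,
    \int[U01 R]_t w t = 0 &
    (forall t, 0 < t < 1 -> pos_part w t <= g t + 1) /\
    (forall t, a <= t < 1 -> w t = k * t + Num.min (g t) n)].
Proof.
move=> mg g0 gnd grc n0 /andP[a0 a1] /andP[k0 k1].
pose mn t := Num.min (g t) n.
pose h (B t : R) := if a <= t then mn t else - B.
pose w (B : R) := (fun t => k * t + h B t) \_ `[0, 1[.
have mn0 t : 0 <= t < 1 -> 0 <= mn t <= n.
  by move=> t01; rewrite le_min g0//= n0 ge_min lexx orbT.
have wE B t : 0 <= t < 1 -> w B t = k * t + h B t.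
  by move=> t01; rewrite /w patchE mem_set//= in_itv.
have wout B t : ~~ (0 <= t < 1) -> w B t = 0.
  move=> t01; rewrite /w patchE ifF//.
  by apply/negbTE; rewrite notin_setE/= in_itv/=; exact/negP.
have mh B : measurable_fun setT (h B).
  apply: measurable_fun_ifT => //.
  - exact: measurable_fun_ler.
  - exact: measurable_minr.
have mw B : measurable_fun setT (w B).
  apply/(measurable_restrictT _ _).1 => //; apply: measurable_funTS.
  by apply: measurable_funD => //; exact: measurable_funM.
have hB B t : 0 <= B -> 0 <= t < 1 -> - B <= h B t <= n.
  move=> B0 /mn0/andP[h0 h1]; rewrite /h; case: ifP => _; last by lra.
  by rewrite h1 andbT; lra.
have wM B t : 0 <= B -> `|w B t| <= k + (n + B).
  move=> B0; have [t01|t01] := boolP (0 <= t < 1); last first.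
    by rewrite wout// normr0; lra.
  have /andP[h0 h1] := hB B t B0 t01; rewrite wE//; move/andP: t01 => [t0 t1].
  have kt : 0 <= k * t <= k by rewrite mulr_ge0 ?(ltW k0)//= ler_piMr ?ltW.
  by rewrite ler_norml; apply/andP; split; lra.
have iw B : 0 <= B -> (U01 R).-integrable setT (EFin \o w B).
  by move=> B0; apply: (U01_bounded_integrable (mw B)) => t; exact: wM.
pose I := \int[U01 R]_t w 0 t.
have I0 : 0 <= I.
  apply: Rintegral_ge0 => t _; have [t01|t01] := boolP (0 <= t < 1); last first.
    by rewrite wout.
  have /andP[h0 h1] := hB 0 t (lexx 0) t01; rewrite wE//; move/andP: t01 => [t0 t1].
  by rewrite addr_ge0// ?mulr_ge0 ?(ltW k0)//; lra.
have B0 : 0 <= I / a by rewrite divr_ge0// ltW.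
have hnd B s t : 0 <= B -> 0 <= s -> s <= t -> t < 1 -> h B s <= h B t.
  move=> B1 s0 st t1; have t0 := le_trans s0 st; have s1 := le_lt_trans st t1.
  rewrite /h; case: ifPn => as_.
    by rewrite (le_trans as_ st) /mn; apply: le_min2 => //; exact: gnd.
  have t01 : 0 <= t < 1 by rewrite t0.
  case: ifPn => // _; have /andP[h0 _] := mn0 t t01.
  by apply: le_trans h0; rewrite oppr_le0.
(* Lowering the function by B on [0, a[ lowers its mean by B a, and I is the mean for B = 0. *)
exists (w (I / a)); split.
- by split; [exact: mw|exists (k + (n + I / a)) => t; exact: wM].
- move=> s t s0 st t1; have t0 := le_trans s0 st; have s1 := le_lt_trans st t1.
  rewrite !wE ?s0 ?t0//; have := hnd _ _ _ B0 s0 st t1; lra.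
- move=> t t01; rewrite wE//; move/andP: t01 => [t0 t1].
  have : (k * x + h (I / a) x) @[x --> t^'+] --> k * t + h (I / a) t.
    apply: cvgD.
      by apply: cvgM; [exact: cvg_cst|exact: cvg_at_right_filter].
    rewrite {2}/h; case: ifPn => at_.
      have : mn x @[x --> t^'+] --> mn t.
        apply: (@continuous_cvg _ _ _ _ _ g (fun u : R => Num.min u n) (g t)).
          by apply: continuous_min; [exact: cvg_id|exact: cvg_cst].
        by apply: grc; rewrite t0.
      apply: cvg_trans; apply: near_eq_cvg; near=> x.
      rewrite /h ifT//; apply: (le_trans at_); near: x; exact: nbhs_right_ge.
    rewrite -ltNge in at_.
    apply: (@cvg_trans _ (cst (- (I / a)) x @[x --> t^'+])); last exact: cvg_cst.
    apply: near_eq_cvg; near=> x; rewrite /h ifF//; apply/negbTE; rewrite -ltNge.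
    by near: x; exact: nbhs_right_lt.
  apply: cvg_trans; apply: near_eq_cvg; near=> x; rewrite wE//; apply/andP; split.
    by apply: (le_trans t0); near: x; exact: nbhs_right_ge.
  by near: x; exact: nbhs_right_lt.
- pose ind := (\1_(`[0, a[%classic : set R) : R -> R).
  have mind : measurable_fun setT ind by exact: measurable_indic.
  have iind : (U01 R).-integrable setT (EFin \o ind).
    apply: (@U01_bounded_integrable _ _ 1) => // t.
    by rewrite /ind indicE ger0_norm// lern1; case: (_ \in _).
  have ind1 : \int[U01 R]_t ind t = a.
    rewrite /Rintegral integral_indic// setIT.
    rewrite [X in fine X](_ : _ = lebesgue_measure (`[0, a[%classic : set R)).
      by rewrite lebesgue_measure_itv/= lte_fin a0 sube0.
    by apply: U01_itv; apply: subset_itvl; rewrite bnd_simp ltW.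
  have wd t : w (I / a) t = w 0 t - I / a * ind t.
    have [t01|t01] := boolP (0 <= t < 1); last first.
      rewrite !wout// /ind indicE.
      rewrite memNset ?mulr0 ?subr0//= in_itv/= => /andP[t0 ta]; move/negP: t01; apply.
      by rewrite t0 (lt_trans ta).
    rewrite !wE// /ind indicE /h; case: (leP a t) => at_.
      by rewrite memNset ?mulr0 ?subr0//= in_itv/= ltNge at_ andbF.
    by rewrite mem_set/= ?in_itv/= ?at_ ?andbT ?mulr1 ?oppr0 ?addr0//; case/andP: t01.
  under eq_Rintegral do rewrite wd.
  rewrite RintegralB//; last exact: (integrableZl measurableT (I / a) iind).
    by rewrite RintegralZl// ind1 divfK ?gt_eqF// subrr.
  exact: iw.
- split.
    move=> t /andP[t0 t1]; have t01 : 0 <= t < 1 by rewrite ltW.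
    have gt0 := g0 t t01; have kt : 0 <= k * t <= 1.
      by rewrite mulr_ge0 ?(ltW k0) ?(ltW t0)//= mulr_ile1 ?(ltW k0) ?(ltW t0) ?(ltW t1).
    rewrite /pos_part wE// ge_max; apply/andP; split; last by lra.
    rewrite /h; case: ifP => _; last by lra.
    have mgt : mn t <= g t by rewrite ge_min lexx.
    by lra.
  move=> t /andP[at_ t1]; have t0 := lt_le_trans a0 at_.
  by rewrite wE ?(ltW t0)// /h at_.
Unshelve. all: by end_near. Qed.

Lemma cvg_powR (u : nat -> R) (l r : R) : 0 < r -> (forall n, 0 <= u n) -> 0 <= l ->
  u n @[n --> \oo] --> l -> u n `^ r @[n --> \oo] --> l `^ r.
Proof.
move=> r0 u0 l0 ul.
have -> : (fun n => u n `^ r) = (fun x : R => Num.max x 0 `^ r) \o u.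
  by apply/funext => n /=; rewrite (max_idPl (u0 n)).
rewrite -[in X in _ --> X](max_idPl l0).
exact: (@continuous_cvg _ _ _ _ _ u (fun x : R => Num.max x 0 `^ r) l
  (@pos_powR_continuous _ _ r0 l) ul).
Qed.

Lemma cvg_powRN (u : nat -> R) (l r : R) : 0 < r -> (forall n, 0 <= u n) -> 0 < l ->
  u n @[n --> \oo] --> l -> u n `^ (- r) @[n --> \oo] --> l `^ (- r).
Proof.
move=> r0 u0 l0 ul; rewrite powRN; under eq_fun do rewrite powRN.
by apply: cvgV; [rewrite gt_eqF// powR_gt0|exact: cvg_powR (ltW l0) ul].
Qed.

(** The slope depends on w n through its positive part only, so the limit g need not be centered.
    Since g + 1 >= 1, the function (g + 1)^p dominates both powers of the positive parts. *)
Lemma semidev_slope_dominated p lam (w : nat -> R -> R) g y (L : R) : 1 < p ->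
  (forall n, measurable_fun setT (w n)) -> (forall t, 0 <= g t) -> in_Lp p%:E g ->
  (forall n t, 0 < t < 1 -> pos_part (w n) t <= g t + 1) ->
  (forall t, 0 < t < 1 -> pos_part (w n) t @[n --> \oo] --> g t) ->
  0 < \int[U01 R]_t (g t `^ p) ->
  measurable_fun setT y -> (forall t, `|y t| <= L) ->
  \int[U01 R]_t (pos_part (w n) t `^ p) @[n --> \oo] --> \int[U01 R]_t (g t `^ p) /\
  semidev_slope p lam (w n) (w n) y @[n --> \oo] --> semidev_slope p lam g g y.
Proof.
move=> p1 mw g0 gp wg wcv K0 my yL.
have p0 : 0 < p by apply: lt_trans p1.
have p10 : 0 < p - 1 by rewrite subr_gt0.
have pq1 : (1 <= p%:E)%E by rewrite lee_fin ltW.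
have mg := in_Lp_measurable gp.
have [_ iG] := (in_Lp_integrable _ (ltW p1)).1 (in_LpD pq1 gp (@in_Lp_cst _ _ 1 pq1)).
have g1 t : 1 <= g t + 1 by rewrite lerDr.
have gE : pos_part g = g by apply/funext => t; rewrite /pos_part; exact/max_idPl.
have normg t : `|g t + cst 1 t| = g t + 1 by rewrite ger0_norm// addr_ge0.
have wr (r : R) n t : 0 <= r -> 0 < t < 1 -> pos_part (w n) t `^ r <= (g t + 1) `^ r.
  move=> r0 t01; apply: ge0_ler_powR => //; rewrite ?nnegrE ?pos_part_ge0//.
    by rewrite addr_ge0.
  exact: wg.
have Kcv : \int[U01 R]_t (pos_part (w n) t `^ p) @[n --> \oo] --> \int[U01 R]_t (g t `^ p).
  have [] // := @U01_dominated _ (fun n t => pos_part (w n) t `^ p) (fun t => g t `^ p)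
    (fun t => `|g t + cst 1 t| `^ p).
  - by move=> n; exact: measurable_pos_powR.
  - exact: (measurableT_comp (measurable_powR p)).
  - by move=> n t t01; rewrite ger0_norm ?powR_ge0// normg wr// ltW.
  - move=> t t01; apply: cvg_powR => //; last exact: wcv.
    by move=> n; exact: pos_part_ge0.
split => //; rewrite /semidev_slope gE; set m := \int[U01 R]_u y u.
apply: cvgD; first exact: cvg_cst.
apply: cvgM.
  apply: cvgM; first exact: cvg_cst.
  have -> : 1 - p = - (p - 1) by rewrite opprB.
  apply: cvg_powRN => //; [by move=> n; exact: powR_ge0|by rewrite powR_gt0|].
  apply: cvg_powR; [by rewrite invr_gt0| |exact: ltW|exact: Kcv].
  by move=> n; apply: Rintegral_ge0 => t _; exact: powR_ge0.
have iB := integrableZl measurableT (L + `|m|) iG.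
have [] // := @U01_dominated _ (fun n t => (y t - m) * pos_part (w n) t `^ (p - 1))
  (fun t => (y t - m) * g t `^ (p - 1)) (fun t => (L + `|m|) * `|g t + cst 1 t| `^ p).
- move=> n; apply: measurable_funM; first exact: measurable_funB.
  exact: measurable_pos_powR.
- apply: measurable_funM; first exact: measurable_funB.
  exact: (measurableT_comp (measurable_powR (p - 1))).
- move=> n t t01; rewrite normrM normg; apply: ler_pM => //.
    by rewrite (le_trans (ler_normB _ _))// lerD2r.
  rewrite ger0_norm ?powR_ge0//; apply: (le_trans (wr _ n t (ltW p10) t01)).
  by apply: ler_powR => //; rewrite gerBl.
- move=> t t01; apply: cvgM; first exact: cvg_cst.
  apply: cvg_powR => //; last exact: wcv.
  by move=> n; exact: pos_part_ge0.
Qed.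

End truncation.

(** * Elements of M lie in every closed Kusuoka set *)

Section minimality.
Context {R : realType}.
Implicit Types (mu nu : frakP R) (p lam : R) (q : \bar R) (N : set (frakP R)).

Lemma frakM_in_closed_Kusuoka p q lam N : 1 < p -> ((p%:E)^-1 + q^-1 = 1)%E ->
  0 <= lam -> lam <= 1 -> closed N -> Kusuoka_set p (semideviation p lam) N ->
  frakM q lam `<=` N.
Proof.
move=> p1 pq lam0 lam1 Ncl NK nu [mu [Tq mix]].
have p0 : 0 < p by apply: lt_trans p1.
have p10 : 0 < p - 1 by rewrite subr_gt0.
have pV0 : 0 < (p - 1)^-1 by rewrite invr_gt0.
have n1 := spectral_norm_ge1 (ltW p1) pq (bbT_spectral mu) Tq.
have n0 : 0 < spectral_norm q (bbT mu) by apply: lt_le_trans n1.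
set c := lam / spectral_norm q (bbT mu) in mix.
have c0 : 0 <= c by rewrite divr_ge0// ltW.
have c1 : c <= 1 by rewrite ler_pdivrMr// mul1r (le_trans lam1).
have nuE := bbT_mixture c0 c1 mix.
pose s := bbT mu \_ `[0, 1[; have s0 t : 0 <= s t by exact: bbT_restr_ge0.
have ms : measurable_fun setT s by exact: measurable_bbT.
have sE t : 0 <= t < 1 -> s t = bbT mu t.
  by move=> t01; rewrite /s patchE mem_set//= in_itv.
have is1 : (U01 R).-integrable setT (EFin \o s) := bbT_integrable mu.
have s1 : \int[U01 R]_t s t = 1 by rewrite /Rintegral tonelli_tail_average.
(* With this exponent g^(p-1) = sigma and g^p = sigma^q, so g is in L_p because sigma is in L_q. *)
pose g t := s t `^ (p - 1)^-1; have g0 t : 0 <= g t by exact: powR_ge0.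
have mg : measurable_fun setT g by exact: (measurableT_comp (measurable_powR _)).
have gnd x y : 0 <= x -> x <= y -> y < 1 -> g x <= g y.
  move=> x0 xy y1; apply: ge0_ler_powR; rewrite ?nnegrE ?(ltW pV0)//.
  rewrite !sE ?(le_trans x0 xy) ?x0 ?(le_lt_trans xy y1)//.
  exact: bbT_nondecreasing.
have grc t : 0 <= t < 1 -> g x @[x --> t^'+] --> g t.
  move=> /andP[t0 t1].
  have src : s x @[x --> t^'+] --> s t.
    have h := @bbT_right_continuous _ mu t _; rewrite sE ?t0//.
    apply: cvg_trans (h _); last by rewrite t0.
    apply: near_eq_cvg; near=> x; rewrite sE//; apply/andP; split.
      by apply: (le_trans t0); near: x; exact: nbhs_right_ge.
    by near: x; exact: nbhs_right_lt.
  have gE x : g x = Num.max (s x) 0 `^ (p - 1)^-1 by rewrite (max_idPl (s0 x)).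
  rewrite gE; under eq_fun do rewrite gE.
  exact: (@continuous_cvg _ _ _ _ _ s (fun u : R => Num.max u 0 `^ (p - 1)^-1) (s t)
    (@pos_powR_continuous _ _ pV0 (s t)) src).
have gp1 t : g t `^ (p - 1) = s t.
  by rewrite /g -powRrM mulVf ?gt_eqF// powRr1.
have qE := conjugate_fin p1 pq.
have gp t : g t `^ p = s t `^ (p / (p - 1)) by rewrite /g -powRrM mulrC.
have q1 : 1 <= p / (p - 1) by rewrite ler_pdivlMr// mul1r gerBl.
have sq : in_Lp (p / (p - 1))%:E s by rewrite -qE.
have [_ isq] := (in_Lp_integrable _ q1).1 sq.
have gLp : in_Lp p%:E g.
  apply/(in_Lp_integrable _ (ltW p1)); split => //.
  rewrite (_ : (fun t => _) = fun t => `|s t| `^ (p / (p - 1)))//.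
  by apply/funext => t; rewrite (ger0_norm (g0 t)) gp (ger0_norm (s0 t)).
pose K := \int[U01 R]_t (g t `^ p).
have K0' : 0 <= K by apply: Rintegral_ge0 => t _; exact: powR_ge0.
have normE : spectral_norm q (bbT mu) = K `^ (p / (p - 1))^-1.
  rewrite /spectral_norm qE -[LHS]/(Lp_norm _ s) (Lp_normE q1 sq) /K.
  by under eq_Rintegral => t _ do rewrite (ger0_norm (s0 t)) -gp.
have K0 : 0 < K.
  rewrite lt0r K0' andbT; apply/eqP => K00; move: n1; rewrite normE K00 powR0.
    by rewrite ler10.
  by rewrite invr_eq0 gt_eqF// divr_gt0.
(* Since 1/q = (p - 1)/p, the inverse norm K^(-1/q) is (K^(1/p))^(1-p): the weight in M is the
   factor in front of the derivative at g. *)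
have cE : c = lam * (K `^ p^-1) `^ (1 - p).
  rewrite /c normE; congr (_ * _); rewrite -powRN -powRrM; congr (_ `^ _).
  by field; rewrite !gt_eqF.
have gpos : pos_part g = g by apply/funext => t; rewrite /pos_part; exact/max_idPl.
have meanE (y : R -> R) (L : R) : measurable_fun setT y -> (forall t, `|y t| <= L) ->
    spectral_mean nu y = semidev_slope p lam g g y.
  move=> my yL; rewrite (@spectral_mean_affine _ nu c s y L is1 _ my yL).
    rewrite /semidev_slope gpos -/K -cE.
    by congr (_ + _ * _); apply: eq_Rintegral => t _; rewrite gp1.
  move=> t /andP[t0 t1]; have t01 : 0 <= t < 1 by rewrite ltW.
  by rewrite s1 mulr1 sE// nuE.
(* Slope, cut and truncation level all depend on n. The cut 1 / (n + 2) lies in ]0, 1[ even for n =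
   0, and every fixed t > 0 eventually lies to its right. *)
have /choice[w hw] : forall n : nat, exists w : R -> R,
    [/\ measurable_fun setT w /\ (exists M : R, forall t, `|w t| <= M),
    forall s t, 0 <= s -> s <= t -> t < 1 -> n.+1%:R^-1 * (t - s) <= w t - w s,
    forall t, 0 <= t < 1 -> w x @[x --> t^'+] --> w t,
    \int[U01 R]_t w t = 0 &
    (forall t, 0 < t < 1 -> pos_part w t <= g t + 1) /\
    (forall t, n.+2%:R^-1 <= t < 1 -> w t = n.+1%:R^-1 * t + Num.min (g t) n%:R)].
  move=> n; apply: centered_truncation => //.
  - by rewrite invr_gt0 ltr0n/= invf_lt1// ltr1n.
  - by rewrite invr_gt0 ltr0n/= invf_le1// ler1n.
have mw n : measurable_fun setT (w n) by case: (hw n) => -[].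
have wle n t : 0 < t < 1 -> pos_part (w n) t <= g t + 1 by case: (hw n) => _ _ _ _ [+ _]; apply.
have wcv t : 0 < t < 1 -> pos_part (w n) t @[n --> \oo] --> g t.
  move=> /andP[t0 t1].
  have h : (@harmonic R n * t + g t) @[n --> \oo] --> g t.
    rewrite -[X in _ --> X]add0r; apply: cvgD; last exact: cvg_cst.
    rewrite -[X in _ --> X](mul0r t).
    by apply: cvgM; [exact: cvg_harmonic|exact: cvg_cst].
  apply: cvg_trans h; apply: near_eq_cvg.
  have /cvgrPdist_le/(_ t t0) := @cvg_harmonic R.
  apply: filter_app; near=> n; rewrite sub0r normrN => hn.
  have nt : n.+2%:R^-1 <= t.
    apply: (@le_trans _ _ (harmonic n)); last exact: le_trans (ler_norm _) hn.
    by rewrite /harmonic/= lef_pV2 ?posrE ?ltr0n// ler_nat.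
  have gn : g t <= n%:R by near: n; exact: nbhs_infty_ger.
  case: (hw n) => _ _ _ _ [_ /(_ t)]; rewrite nt t1 => /(_ isT) E.
  rewrite /pos_part E (min_idPl gn); apply/esym/max_idPl.
  by rewrite addr_ge0// mulr_ge0// ltW.
have dom := semidev_slope_dominated lam p1 mw g0 gLp wle wcv K0.
have Kcv : \int[U01 R]_t (pos_part (w n) t `^ p) @[n --> \oo] --> K.
  by case: (dom _ _ (measurable_moment_fun 0) (moment_fun_bounded 0)).
(* The integral of the p-th power is positive only eventually, by convergence to K > 0; before that
   nu itself serves as a placeholder. *)
have /choice[u hu] : forall n : nat, exists nu', 0 < \int[U01 R]_t (pos_part (w n) t `^ p) ->
    N nu' /\ forall i, spectral_mean nu' (moment_fun i) =
      semidev_slope p lam (w n) (w n) (moment_fun i).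
  move=> n; have [Kn|Kn] := boolP (0 < \int[U01 R]_t (pos_part (w n) t `^ p)); last by exists nu.
  have [[_ [M wM]] wk wrc w0 _] := hw n.
  have wnd x y : 0 <= x -> x <= y -> y < 1 -> w n x <= w n y.
    move=> x0 xy y1; rewrite -subr_ge0 (le_trans _ (wk _ _ x0 xy y1))//.
    by rewrite mulr_ge0 ?subr_ge0.
  have [nu' hnu'] := semidev_slope_realized p1 lam0 lam1 (mw n) wM wnd wrc Kn.
  have nuE' i := hnu' _ _ (@measurable_moment_fun R i) (moment_fun_bounded i).
  exists nu' => _; split => //.
  apply: (@exposed_in_closed_Kusuoka _ p lam N p1 lam0 NK (w n) M n.+1%:R^-1 nu' Ncl) => //.
  - by move=> x y x0; apply: wk; exact: ltW.
  - by move=> t /andP[t0 t1]; apply: wrc; rewrite ltW.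
have Kpos : \forall n \near \oo, 0 < \int[U01 R]_t (pos_part (w n) t `^ p).
  exact: (cvgr_gt _ Kcv).
suff : u @ \oo --> nu.
  by apply: closed_cvg => //; apply: filterS Kpos => n /hu[].
apply: weak_cvg_moments => i; rewrite mean01_moment.
rewrite (meanE _ _ (@measurable_moment_fun R i) (moment_fun_bounded i)).
have [_ h] := dom _ _ (@measurable_moment_fun R i) (moment_fun_bounded i).
apply: cvg_trans h; apply: near_eq_cvg; apply: filterS Kpos => n /hu[_ E].
by rewrite mean01_moment E.
Unshelve. all: by end_near. Qed.

End minimality.

(** * The closure of M *)

Section closure_of_frakM.
Context {R : realType}.
Implicit Types (mu nu : frakP R) (g : R -> R) (p lam : R) (q : \bar R).

(** On [x, y[ the function g is at most g y, and on [y, 1] it is at least g y, so discarding the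
    first interval raises the average. *)
Lemma tail_average_nondecreasing g x y : (U01 R).-integrable setT (EFin \o g) ->
  (forall s t, 0 < s -> s <= t -> t < 1 -> g s <= g t) ->
  0 <= x -> x <= y -> y < 1 -> tail_average g x <= tail_average g y.
Proof.
move=> ig gnd x0; rewrite le_eqVlt => /predU1P[->//|xy] y1.
have aux (A B u : R) : A * (1 - y) <= u * (y - x) * (1 - y) ->
  u * (1 - y) * (y - x) <= B * (y - x) -> (1 - y) * (A + B) <= (1 - x) * B by lra.
have y0 : 0 < y := le_lt_trans x0 xy; have x1 : x < 1 := lt_trans xy y1.
have mxy : measurable (`[x, y[%classic : set (measurableTypeR R)) by exact: measurable_itv.
have my1 : measurable (`[y, 1%R]%classic : set (measurableTypeR R)) by exact: measurable_itv.
have icst (D : set (measurableTypeR R)) : measurable D ->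
    (U01 R).-integrable D (EFin \o cst (g y)) by exact: finite_measure_integrable_cst.
have igD (D : set (measurableTypeR R)) : measurable D -> (U01 R).-integrable D (EFin \o g).
  by move=> mD; apply: integrableS ig.
have restr (h : R -> R) (D : set (measurableTypeR R)) : measurable D ->
    (U01 R).-integrable D (EFin \o h) -> (U01 R).-integrable setT (EFin \o (h \_ D)).
  by move=> mD /(integrable_mkcond _ mD).1; rewrite restrict_EFin.
pose A := \int[U01 R]_(t in `[x, y[) g t; pose B := \int[U01 R]_(t in `[y, 1]) g t.
have AB : \int[U01 R]_(t in `[x, 1]) g t = A + B.
  rewrite (@itv_bndbnd_setU _ _ _ (BLeft y)) ?bnd_simp ?(ltW xy) ?(ltW y1)//.
  rewrite Rintegral_setU//; first exact: igD (measurableU _ _ mxy my1).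
  apply/disj_setPRL => t /=; rewrite !in_itv/= => /andP[yt _] /andP[_].
  by rewrite ltNge yt.
have Ag : A <= g y * (y - x).
  have -> : g y * (y - x) = \int[U01 R]_(t in `[x, y[) g y.
    rewrite Rintegral_cst//; congr (_ * _).
    rewrite [X in fine X](_ : _ = lebesgue_measure (`[x, y[%classic : set R)).
      by rewrite lebesgue_measure_itv/= lte_fin xy.
    by apply: U01_itv => t /=; rewrite !in_itv/= => /andP[/(le_trans x0) -> /ltW/le_trans->//]; exact: ltW.
  rewrite /A Rintegral_mkcond [leRHS]Rintegral_mkcond; apply: U01_le_Rintegral.
  - exact: restr (igD _ _).
  - exact: restr (icst _ _).
  - move=> t /andP[t0 t1]; rewrite !patchE; case: ifPn => //.
    by rewrite inE/= in_itv/= => /andP[_ /ltW ty]; exact: gnd.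
have Bg : g y * (1 - y) <= B.
  have -> : g y * (1 - y) = \int[U01 R]_(t in `[y, 1%R]) g y.
    rewrite Rintegral_cst//; congr (_ * _).
    rewrite [X in fine X](_ : _ = lebesgue_measure (`[y, 1%R]%classic : set R)).
      by rewrite lebesgue_measure_itv/= lte_fin y1.
    by apply: U01_itv => t /=; rewrite !in_itv/= => /andP[/(le_trans (ltW y0)) -> ->].
  rewrite /B Rintegral_mkcond [leRHS]Rintegral_mkcond; apply: U01_le_Rintegral.
  - exact: restr (icst _ _).
  - exact: restr (igD _ _).
  - move=> t /andP[t0 t1]; rewrite !patchE; case: ifPn => //.
    by rewrite inE/= in_itv/= => /andP[yt _]; exact: gnd.
rewrite /tail_average AB -/B ler_pdivrMl ?subr_gt0// mulrCA ler_pdivlMl ?subr_gt0//.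
have h1 : A * (1 - y) <= g y * (y - x) * (1 - y) by rewrite ler_wpM2r// subr_ge0 ltW.
have h2 : g y * (1 - y) * (y - x) <= B * (y - x) by rewrite ler_wpM2r// subr_ge0 ltW.
exact: aux h1 h2.
Qed.

(* Continuity of x |-> \int_x^1 g only holds on [0, 1[, hence the clamping. *)
Lemma tail_average_clamp_continuous g c : (U01 R).-integrable setT (EFin \o g) ->
  0 <= c < 1 -> {within `[0, 1], continuous (fun x : R => tail_average g (Num.min x c))}.
Proof.
move=> ig /andP[c0 c1].
have mg : measurable_fun setT g by apply/measurable_EFinP; exact: measurable_int ig.
have m01 : measurable (`[0%R, 1%R]%classic : set (measurableTypeR R)) by exact: measurable_itv.
pose g0 := g \_ `[0, 1].
have ig0T : lebesgue_measure.-integrable setT (EFin \o g0 : measurableTypeR R -> \bar R).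
  rewrite /g0 -restrict_EFin; apply/(integrable_mkcond _ m01).1.
  apply/integrableP; split; first by apply: measurable_funTS; exact/measurable_EFinP.
  have /integrableP[_] := ig; rewrite integral_U01//.
  by apply: measurableT_comp => //; exact/measurable_EFinP.
have ig0 (D : set (measurableTypeR R)) : measurable D ->
    lebesgue_measure.-integrable D (EFin \o g0).
  by move=> mD; apply: integrableS ig0T.
(* Integrating from -1, with g0 extended by 0 up to 2, makes 0 and 1 interior points of the interval
   on which the integral is continuous. *)
pose Q x := \int[lebesgue_measure]_(t in `[-1, x]) g0 t.
have Qc x : -1 < x < 2 -> {for x, continuous Q}.
  move=> x12; have lt12 : -1 < 2 :> R by lra.
  have := @parameterized_integral_continuous R (-1) 2 g0 (ltW lt12) (ig0 _ (measurable_itv _)).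
  by move=> /(continuous_within_itvP _ lt12)[+ _ _]; apply; rewrite in_itv.
have QE x : 0 <= x -> x < 1 -> \int[U01 R]_(t in `[x, 1]) g t = Q 1 - Q x.
  move=> x0 x1; rewrite /Q Rintegral_itvB; last 3 first.
  - by apply: ig0; exact: measurable_itv.
  - by rewrite bnd_simp; lra.
  - by rewrite bnd_simp ltW.
  rewrite Rintegral_itv_obnd_cbnd; last by apply: ig0; exact: measurable_itv.
  have sub01 : `[x, 1]%classic `<=` (`[0, 1]%classic : set R).
    by move=> t /=; rewrite !in_itv/= => /andP[/(le_trans x0) -> ->].
  rewrite /Rintegral -integral_U01_sub//; last first.
    by apply: measurable_funTS; exact/measurable_EFinP.
  congr fine; apply: eq_integral => t; rewrite inE/= => xt.
  by rewrite /g0 patchE mem_set//; exact: sub01.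
pose F x := (1 - x)^-1 * (Q 1 - Q x).
apply: (@subspace_eq_continuous _ _ _ (F \o (fun x => Num.min x c))).
  move=> x; rewrite inE/= in_itv/= => /andP[x0 x1].
  rewrite -[RHS]/(tail_average g (Num.min x c)) /F/= /tail_average.
  by rewrite QE// ?le_min ?x0// gt_min c1 orbT.
apply: continuous_in_subspaceT => x; rewrite inE/= in_itv/= => /andP[x0 x1].
apply: continuous_comp; first by apply: continuous_min; [exact: cvg_id|exact: cvg_cst].
have m0 : 0 <= Num.min x c by rewrite le_min x0.
have m1 : Num.min x c < 1 by rewrite gt_min c1 orbT.
apply: cvgM; last first.
  by apply: cvgB; [exact: cvg_cst|apply: Qc; apply/andP; split; lra].
apply: cvgV; first by rewrite subr_eq0 gt_eqF.
by apply: cvgB; [exact: cvg_cst|exact: cvg_id].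
Qed.

(** AV@R_a(Z) may be unbounded as a tends to 1, so its integral is not weakly continuous in the
    measure. As a supremum of weakly continuous functions it is lower semicontinuous, which is the
    direction that an upper bound on a closure requires. *)
Lemma closure_frakM_AVaR_le p q lam nu (Z : {RV (U01 R) >-> R}) : 1 <= p ->
  ((p%:E)^-1 + q^-1 = 1)%E -> 0 <= lam -> lam <= 1 -> in_Lp p%:E Z ->
  closure (frakM q lam) nu ->
  (\int[measure_of nu]_(a in `[0%R, 1%R[) AVaR a Z <= semideviation p lam Z)%E.
Proof.
move=> p1 pq lam0 lam1 Zp clnu; have Gp := in_Lp_quantile_fun p1 Zp.
have q1 := conjugate_ge1 p1 pq; have pq1 : (1 <= p%:E)%E by rewrite lee_fin.
set G := quantile_fun Z in Gp; have Gi := in_Lp_integrable1 pq1 Gp.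
have AE mu := tail_average_AVaR mu Gi (@quantile_funE _ Z).
rewrite (semideviation_semidev _ p1 Zp); set C := semidev p lam Z.
pose a := tail_average G.
have m01 : measurable (`[0%R, 1%R[%classic : set (measurableTypeR R)) by exact: measurable_itv.
have and_ x y : 0 <= x -> x <= y -> y < 1 -> a x <= a y.
  by apply: tail_average_nondecreasing => // s t s0 st t1; exact: quantile_fun_le.
pose c k : R := 1 - k.+2%:R^-1.
have c01 k : 0 <= c k < 1.
  by rewrite /c subr_ge0 invf_le1// ler1n/= ltrBlDr ltrDl invr_gt0.
pose f k (x : R) := a (Num.min x (c k)).
have fC k : C01 R (f k) by exact: tail_average_clamp_continuous.
have clamp01 k x : 0 <= x -> 0 <= Num.min x (c k) < 1.
  by move=> x0; have /andP[ck0 ck1] := c01 k; rewrite le_min x0 ck0 gt_min ck1 orbT.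
have f_ge k x : 0 <= x < 1 -> a 0 <= f k x.
  by move=> /andP[x0 x1]; have /andP[h0 h1] := clamp01 k x x0; exact: and_.
have f_le k x : 0 <= x < 1 -> f k x <= a x.
  move=> /andP[x0 x1]; have /andP[h0 h1] := clamp01 k x x0.
  by apply: and_ => //; rewrite ge_min lexx.
have f_nd x : 0 <= x < 1 -> {homo f^~ x : m n / (m <= n)%N >-> m <= n}.
  move=> /andP[x0 x1] m n mn; have /andP[h0 _] := clamp01 m x x0.
  have /andP[_ h1] := clamp01 n x x0; apply: and_ => //; apply: le_min2 => //.
  by rewrite /c lerD2l lerN2 lef_pV2 ?posrE ?ltr0n// ler_nat.
have f_lim x : 0 <= x < 1 -> f n x @[n --> \oo] --> a x.
  move=> /andP[x0 x1]; apply: cvg_near_cst.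
  have x10 : 0 < 1 - x by rewrite subr_gt0.
  have /cvgrPdist_le/(_ _ x10) := @cvg_harmonic R.
  apply: filterS => n; rewrite sub0r normrN => hn; rewrite /f; congr a; apply/min_idPl.
  have : harmonic n <= 1 - x by apply: le_trans (ler_norm _) hn.
  rewrite /harmonic/= /c => {}hn.
  have n21 : n.+2%:R^-1 <= n.+1%:R^-1 :> R by rewrite lef_pV2 ?posrE ?ltr0n// ler_nat.
  by rewrite lerBrDr -lerBrDl (le_trans n21).
have fM k x : 0 <= x < 1 -> `|f k x| <= `|a 0| + `|a (c k)|.
  move=> x01; have h1 := f_ge k x x01; have /andP[x0 x1] := x01.
  have h2 : f k x <= a (c k).
    have /andP[m0 m1] := clamp01 k x x0; have /andP[ck0 ck1] := c01 k.
    by apply: and_ => //; rewrite ge_min lexx orbT.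
  have := ler_norm (a (c k)); have := lerNnormlW (lexx `|a 0|).
  have := normr_ge0 (a 0); have := normr_ge0 (a (c k)).
  by rewrite ler_norml => *; apply/andP; split; lra.
have mf k : measurable_fun (`[0, 1[%classic : set R) (f k).
  have mf : measurable_fun (`[0, 1]%classic : set R) (f k).
    by apply: subspace_continuous_measurable_fun; [exact: measurable_itv|exact: fC].
  by apply: measurable_funS mf => // x /=; rewrite !in_itv/= => /andP[-> /ltW].
have fi k mu : (measure_of mu).-integrable `[0, 1[ (EFin \o f k).
  exact: mean01_integrable (mf k) (fM k).
have fM_le k mu : frakM q lam mu -> mean01 mu (f k) <= C.
  move=> Mmu; have [mu0 [sq mix]] := Mmu; rewrite /= in mix.
  have n1 := spectral_norm_ge1 p1 pq (bbT_spectral mu0) sq.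
  have n0 : 0 < spectral_norm q (bbT mu0) by apply: lt_le_trans n1.
  have c0 : 0 <= lam / spectral_norm q (bbT mu0) by rewrite divr_ge0// ltW.
  have c1 : lam / spectral_norm q (bbT mu0) <= 1.
    by rewrite ler_pdivrMr// mul1r (le_trans lam1).
  have TG := hoelder_integrable p1 pq (mixture_spectral_Lq q1 c0 c1 sq mix) Gp.
  have [ia Ea] := fubini_tail_average Gi TG.
  have {}ia : (measure_of mu).-integrable `[0, 1[ (EFin \o a).
    by apply/(integrable_mkcond _ m01); rewrite restrict_EFin.
  have meanC : mean01 mu a <= C.
    rewrite -lee_fin /mean01 /Rintegral fineK; last exact: (integrable_fin_num _ ia).
    rewrite -AE -(semideviation_semidev _ p1 Zp).
    rewrite (frakM_Kusuoka_set p1 pq lam0 lam1 Zp).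
    by apply: ereal_sup_ubound; exists mu.
  apply: le_trans meanC; apply: (le_Rintegral m01 (fi k mu) ia) => x.
  by rewrite /= in_itv/= => x01; exact: f_le.
have f_nu k : mean01 nu (f k) <= C.
  pose fk : C01 R := (exist _ (f k) (mem_set (fC k)) : set_type (C01 R)).
  have /closureS/(_ nu clnu) : frakM q lam `<=` [set mu : frakP R | integrals (mu : prob01 R) fk <= C].
    by move=> mu /(fM_le k); rewrite /= integralsE.
  by move=> /closed_integrals_le/=; rewrite integralsE.
have i1 : (measure_of nu).-integrable `[0, 1[ (EFin \o cst (a 0)).
  exact: finite_measure_integrable_cst.
have cst0 : \int[measure_of nu]_(x in `[0, 1[) a 0 = a 0.
  by rewrite Rintegral_cst// [X in fine X](_ : _ = 1%E) ?mulr1//; exact: measure_of_itv.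
(* Subtracting the minimum AV@R_0(Z) makes the increasing sequence nonnegative, as monotone
   convergence asks. *)
pose h k (x : R) := (f k x - a 0)%:E.
have h_le k : (\int[measure_of nu]_(x in `[0%R, 1%R[) h k x <= (C - a 0)%:E)%E.
  have ih := integrableB m01 (fi k nu) i1.
  rewrite -[leLHS]fineK; last exact: (integrable_fin_num m01 ih).
  rewrite -[fine _]/(\int[measure_of nu]_(x in `[0%R, 1%R[) (f k x - a 0)).
  by rewrite (RintegralB m01 (fi k nu) i1) [X in _ - X]cst0 lee_fin lerD2r; exact: f_nu.
have mh k : measurable_fun (`[0%R, 1%R[%classic : set R) (h k).
  by apply/measurable_EFinP; apply: measurable_funB.
have lim_h : (\int[measure_of nu]_(x in `[0%R, 1%R[) (a x - a 0)%:E <= (C - a 0)%:E)%E.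
  have -> : (\int[measure_of nu]_(x in `[0%R, 1%R[) (a x - a 0)%:E =
      \int[measure_of nu]_(x in `[0%R, 1%R[) limn (h^~ x))%E.
    apply: eq_integral => x; rewrite inE/= in_itv/= => x01; apply/esym/cvg_lim => //.
    apply: cvg_EFin; first by near=> n.
    by apply: cvgB; [exact: f_lim|exact: cvg_cst].
  have mono : (\int[measure_of nu]_(x in `[0%R, 1%R[) h n x)%E @[n --> \oo] -->
      (\int[measure_of nu]_(x in `[0%R, 1%R[) limn (h^~ x))%E.
    apply: (cvg_monotone_convergence m01 mh).
    - by move=> n x /=; rewrite in_itv/= => x01; rewrite lee_fin subr_ge0 f_ge.
    - move=> x /=; rewrite in_itv/= => x01 m n mn.
      by rewrite lee_fin lerD2r; exact: f_nd.
  rewrite -(cvg_lim _ mono)//; apply: lime_le; first by apply/cvg_ex; eexists; exact: mono.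
  by apply: nearW => n; exact: h_le.
have ma : measurable_fun (`[0%R, 1%R[%classic : set R) a.
  apply: measurable_fun_nondecreasing_on; first exact: interval_is_interval.
  move=> x y; rewrite !inE/= !in_itv/= => /andP[x0 _] /andP[_ y1] xy.
  exact: and_.
have ih : (measure_of nu).-integrable `[0, 1[ (EFin \o (fun x => a x - a 0)).
  apply/integrableP; split; first by apply/measurable_EFinP; exact: measurable_funB.
  apply: le_lt_trans (ltry (C - a 0)); apply: le_trans lim_h.
  rewrite le_eqVlt; apply/orP; left; apply/eqP; apply: eq_integral => x.
  rewrite inE/= in_itv/= => /andP[x0 x1]; rewrite ger0_norm// subr_ge0.
  exact: and_.
rewrite AE -/a.
have -> : (\int[measure_of nu]_(x in `[0%R, 1%R[) (a x)%:E =
    \int[measure_of nu]_(x in `[0%R, 1%R[) (a x - a 0)%:E + (a 0)%:E)%E.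
  rewrite -[X in (_ + X%:E)%E]cst0 /Rintegral fineK; last exact: (integrable_fin_num m01 i1).
  rewrite -integralD//; apply: eq_integral => x _.
  by rewrite /= -EFinD subrK.
by rewrite -leeBrDr// -EFinB.
Unshelve. all: by end_near. Qed.

Lemma closure_frakM_Kusuoka_set p q lam : 1 <= p -> ((p%:E)^-1 + q^-1 = 1)%E ->
  0 <= lam -> lam <= 1 -> Kusuoka_set p (semideviation p lam) (closure (frakM q lam)).
Proof.
move=> p1 pq lam0 lam1 Z Zp; apply/eqP; rewrite eq_le; apply/andP; split.
  rewrite (frakM_Kusuoka_set p1 pq lam0 lam1 Zp); apply: le_ereal_sup.
  by apply: image_subset; exact: subset_closure.
by apply: ge_ereal_sup => _ [nu clnu <-]; exact: closure_frakM_AVaR_le clnu.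
Qed.

End closure_of_frakM.

Theorem proposition5p2 (R : realType) (p : R) (q : \bar R) (lam : R)
    (p_ge1 : 1 <= p) (pq : ((p%:E)^-1 + q^-1 = 1)%E)
    (lam_ge0 : 0 <= lam) (lam_le1 : lam <= 1) :
  [/\ forall Z : {RV (U01 R) >-> R}, in_Lp p%:E Z ->
        semideviation p lam Z = ereal_sup
          [set ((1 - lam / spectral_norm q sigma)%:E * 'E_(U01 R)[Z]
                + (lam / spectral_norm q sigma)%:E * rho_spectral sigma Z)%E
            | sigma in [set sigma : R -> R
                         | spectral sigma /\ spectral_Lq q sigma]],
      Kusuoka_set p (semideviation p lam) (frakM q lam)
    & 1 < p ->
      minimal_Kusuoka_set p (semideviation p lam) (closure (frakM q lam))].
Proof.
split=> [Z Zp||p1]; first exact: semideviation_spectral.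
  exact: frakM_Kusuoka_set.
split; [exact: closure_frakM_Kusuoka_set|exact: closed_closure|move=> N Ncl NK nu].
by move=> /(closureS (frakM_in_closed_Kusuoka p1 pq lam_ge0 lam_le1 Ncl NK)) /Ncl.
Qed.
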